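(* Assume $\Phi^*\in\mathcal P$, $c^*\in\mathcal C$ and $\alpha^*\in\mathcal F_\Psi(\Phi^* )$ satisfy $$E_{c^*}(\alpha^* )=\inf_{\Phi\in\mathcal P}\ \inf_{c\in\mathcal C}\ \inf_{\alpha\in\mathcal F_\Psi(\Phi)}E_c(\alpha),$$ with $\Phi^*\in C^{2,\mu}$ (for some $0<\mu<1$) non-singular. Let $p\in R\cap A\subset X_{\Phi^*}$ be a regular point, and let $\Sigma_1,\Sigma_2,\Sigma_3$ be the three embedded surfaces, meeting along the embedded real analytic curve $\gamma$ with outer unit conormals $\eta_i$ satisfying $\eta_1+\eta_2+\eta_3=0$ along $\gamma$, whose union is the image of $\alpha^*$ in a neighborhood of $\alpha^*(p)$. Then, for each $i=1,2,3$, the surface $\Sigma_i$ can be extended real analytically across the curve $\gamma$, and this extended surface is parametrized by the conformal, harmonic map $U_i:\triangle\to\mathbf R^n$ obtained by the multi-sheeted reflection.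
   Context: Let $\triangle\subset\mathbf R^2$ be the (open) unit disk and $\triangle_1,\triangle_2,\triangle_3$ three copies of it. Put $B_i=\partial\triangle_i\cap\{y\ge 0\}$ and $A_i=\partial\triangle_i\cap\{y\le 0\}$. Gluing maps: $\mathcal P$ is the set of triples $\Phi=(\phi_1,\phi_2,\phi_3)$ of homeomorphisms $\phi_i:\partial\triangle_i\to\partial\triangle_i$ with $\phi_i(-1,0)=(-1,0)$, $\phi_i(1,0)=(1,0)$, $\phi_i(0,1)=(0,1)$. $\Phi$ is $C^{k,\mu}$ if each $\phi_i$ is. A $C^1$ gluing map $\Phi$ is non-singular if $\frac{d\phi_i}{d\theta}(p)\ne 0$ for all $p\in\partial\triangle_i$ and all $i$, where $\theta$ is arc length on $\partial\triangle_i$. The quotient space $X_\Phi$ is the union of the three disks with $s\in A_i$ identified with $t\in A_j$ when $\phi_i^{-1}(s)=\phi_j^{-1}(t)$; the common image of the $A_i$ in $X_\Phi$ is denoted $A$. Boundary data: $\Gamma$ is a graph embedded in $\mathbf R^n$ consisting of three arcs $\Gamma_1,\Gamma_2,\Gamma_3$ sharing common end points $q_-$ and $q_+$. A fixed uniform parameterization $\Psi=(\psi_1,\psi_2,\psi_3)$ of $\Gamma$ is given: $\psi_i:B_i\to\mathbf R^n$ is a constant speed parameterization of $\Gamma_i$ with $\psi_i(-1,0)=q_-$ and $\psi_i(1,0)=q_+$. Admissible maps: $\mathcal F_\Psi(\Phi)$ is the set of $\alpha=(\alpha_1,\alpha_2,\alpha_3)$ with $\alpha_i:\overline{\triangle_i}\to\mathbf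 R^n$, $\alpha_i\in W^{1,2}(\triangle_i)\cap C^0(\overline{\triangle_i})$, satisfying the matching condition $\alpha_i\circ\phi_i|_{A_i}=\alpha_j\circ\phi_j|_{A_j}$ for all $i,j$ (the $A_i$ being identified as copies of the same arc) and the boundary condition $\alpha_i\circ\phi_i|_{B_i}=\psi_i$ for all $i$. By the matching condition $\alpha$ is viewed as a continuous map on $X_\Phi$. Energy: $E(\alpha_i)=\int_{\triangle_i}|\nabla\alpha_i|^2\,dx\,dy$ is the Dirichlet energy. Let $\mathcal C=\{c=(c_1,c_2,c_3)\in\mathbf R^3: c_1+c_2+c_3=1,\ c_i\ge 0\}$. For $c\in\mathcal C$, $\alpha$ is compatible with $c$ if $E(\alpha_i)=0$ whenever $c_i=0$; the $c$-weighted $l^2$-energy is $E_c(\alpha)=\left(\sum_{i:\,c_i\ne 0}\frac1{c_i}E(\alpha_i)^2\right)^{1/2}$ if $\alpha$ is compatible with $c$ and $E_c(\alpha)=\infty$ otherwise. Regular and singular sets: for a minimizing triple $(\Phi^*,c^*,\alpha^* )$ with $\Phi^*\in C^{2,\mu}$ non-singular, each $\alpha_i^*$ is a weakly conformal harmonic map in $C^{1,\gamma}(\triangle_i\cup A_i)$, so $d\alpha_i^*$ is defined and continuous on $\triangle_i\cup A_i$. Let $S_i\subset\triangle_i\cup A_i$ be the set of isolated points where $d\alpha_i^*$ has rank zero, $S=\{p\in X_{\Phi^*}: p\in S_i\text{ for some }i\}$ the singular set, and $R=X_{\Phi^*}\setminus S$ the regular set. The outer unit conormal $\eta_i$ of $\Sigma_i$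 along its boundary curve $\gamma$ is the outer unit vector tangent to $\Sigma_i$ and normal to $\gamma$. The space $Y_0$: let $\triangle_i^+=\{(x,y)\in\triangle_i:y>0\}$ and let $I_i$ be the part of $\partial\triangle_i^+$ on the $x$-axis. $Y_0$ is the union of the three closed half disks $\overline{\triangle_1^+},\overline{\triangle_2^+},\overline{\triangle_3^+}$ identified along $I_1,I_2,I_3$ by the identity map. A map $f=(f_1,f_2,f_3):Y_0\to\mathbf R^n$ is conformal if each $f_i:\overline{\triangle_i^+}\to\mathbf R^n$ is conformal with respect to the standard Euclidean metric and $f_i(x,0)=f_j(x,0)$ for all $-1<x<1$ and all $i,j$; it is harmonic if each $f_i$ is harmonic on $\triangle_i^+$. Multi-sheeted reflection: let $f=(f_1,f_2,f_3):Y_0\to\mathbf R^n$ be a conformal, harmonic map parameterizing the image of $\alpha^*$ in a neighborhood of $\alpha^*(p)$, with $f_i$ parameterizing $\Sigma_i$ and the $x$-axis mapped to $\gamma$ (such an $f$ exists under the stated hypotheses). For $y<0$ set $\tilde f_i(x,y)=-f_i(x,-y)+\frac23\sum_{j=1}^3f_j(x,-y)$, and define $U_i:\triangle\to\mathbf R^n$ by $U_i(x,y)=f_i(x,y)$ for $y\ge 0$ and $U_i(x,y)=\tilde f_i(x,y)$ for $y<0$. The passage from $f_i$ to $U_i$ is called the multi-sheeted reflection. *)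

(* Defs.v *)
From HB Require Import structures.
From mathcomp Require Import all_boot all_order all_algebra.
From mathcomp Require Import all_classical all_reals all_analysis.
Import Order.TTheory GRing.Theory Num.Theory.
Import numFieldNormedType.Exports.

Set Implicit Arguments.
Unset Strict Implicit.
Unset Printing Implicit Defensive.

Local Open Scope classical_set_scope.
Local Open Scope ring_scope.

Section Regions.
Context {R : realType}.

Definition sqnorm2 (z : R * R) : R := z.1 ^+ 2 + z.2 ^+ 2.

Definition disk : set (R * R) := [set z | sqnorm2 z < 1].
Definition closed_disk : set (R * R) := [set z | sqnorm2 z <= 1].
Definition circle : set (R * R) := [set z | sqnorm2 z = 1].
Definition upper_arc : set (R * R) := circle `&` [set z | 0 <= z.2].
Definition lower_arc : set (R * R) := circle `&` [set z | z.2 <= 0].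

Definition upper_plane : set (R * R) := [set z | 0 <= z.2].
Definition x_axis : set (R * R) := [set z | z.2 = 0].
Definition open_half_disk : set (R * R) := disk `&` [set z | 0 < z.2].
Definition closed_half_disk : set (R * R) := closed_disk `&` upper_plane.

Definition circle_pt (t : R) : R * R := (cos t, sin t).

Definition e1 : R * R := (1, 0).
Definition e2 : R * R := (0, 1).

End Regions.

Section Calculus.
Context {R : realType}.

(* [R^n] carries the library's (sup) norm as a topological vector space;
   lengths and angles are Euclidean. *)
Definition dotv (n : nat) (u v : 'rV[R]_n) : R := (u *m v^T) 0 0.
Definition enorm (n : nat) (u : 'rV[R]_n) : R := Num.sqrt (dotv u u).

(* Differential at z relative to D, which need not be a neighbourhood of z:
   (a, b) are the images of the two coordinate vectors. *)
Definition has_diff_within (n : nat) (D : set (R * R)) (f : R * R -> 'rV[R]_n)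
    (z : R * R) (a b : 'rV[R]_n) : Prop :=
  forall e : R, 0 < e -> \forall w \near within D (nbhs z),
    `|f w - f z - (w.1 - z.1) *: a - (w.2 - z.2) *: b| <= e * `|w - z|.

(* f is C^1 on D, with partial derivatives fx and fy; on the regions with
   boundary used here this is C^1 up to the part of the boundary in D. *)
Definition C1_within (n : nat) (D : set (R * R))
    (f fx fy : R * R -> 'rV[R]_n) : Prop :=
  [/\ {within D, continuous fx}, {within D, continuous fy} &
      forall z, D z -> has_diff_within D f z (fx z) (fy z)].

Fixpoint Ck_on (V : normedModType R) (k : nat) (D : set (R * R))
    (f : R * R -> V) : Prop :=
  (forall z, D z -> {for z, continuous f}) /\
  if k is k'.+1 then
    [/\ forall z, D z -> derivable f z e1 /\ derivable f z e2,
        Ck_on k' D (fun z => 'D_e1 f z) & Ck_on k' D (fun z => 'D_e2 f z)]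
  else True.

Definition harmonic_on (n : nat) (D : set (R * R)) (f : R * R -> 'rV[R]_n) :
    Prop :=
  Ck_on 2 D f /\
  forall z, D z -> 'D_e1 (fun w => 'D_e1 f w) z
                   + 'D_e2 (fun w => 'D_e2 f w) z = 0.

(* The conformality relations |f_x| = |f_y|, f_x . f_y = 0.  That f is an
   immersion, where needed, is part of [parametrizes] below. *)
Definition conformal_on (n : nat) (D : set (R * R)) (f : R * R -> 'rV[R]_n) :
    Prop :=
  exists fx fy : R * R -> 'rV[R]_n, C1_within D f fx fy /\
    forall z, D z -> enorm (fx z) = enorm (fy z) /\ dotv (fx z) (fy z) = 0.

(* The geometric bound on the coefficients makes the double series absolutely
   convergent on the bidisk of radius r, so square partial sums are harmless. *)
Definition real_analytic_on (n : nat) (D : set (R * R))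
    (f : R * R -> 'rV[R]_n) : Prop :=
  forall z, D z -> exists (r K : R) (u : nat -> nat -> 'rV[R]_n),
    [/\ 0 < r, forall i j : nat, `|u i j| * r ^+ (i + j) <= K &
        forall x y : R, `|x| < r -> `|y| < r ->
          (fun m : nat => \sum_(i < m) \sum_(j < m) (x ^+ i * y ^+ j) *: u i j)
            @ \oo --> f (z.1 + x, z.2 + y)].

Definition real_analytic_curve_on (n : nat) (W : set R) (g : R -> 'rV[R]_n) :
    Prop :=
  forall t, W t -> exists (r K : R) (u : nat -> 'rV[R]_n),
    [/\ 0 < r, forall i : nat, `|u i| * r ^+ i <= K &
        forall x : R, `|x| < r ->
          (fun m : nat => \sum_(i < m) x ^+ i *: u i) @ \oo --> g (t + x)].

(* h restricted to D is injective with continuous inverse (for h D -> D). *)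
Definition inverse_continuous (S T : topologicalType) (D : set S) (h : S -> T) :
    Prop :=
  forall z, D z -> forall N, nbhs z N ->
    \forall y \near nbhs (h z), forall w, D w -> h w = y -> N w.

End Calculus.

Section GluingMaps.
Context {R : realType}.

Definition circle_homeo (phi : R * R -> R * R) : Prop :=
  [/\ set_bij circle circle phi, {within circle, continuous phi} &
      exists phi', [/\ {within circle, continuous phi'},
        forall s, circle s -> phi' (phi s) = s &
        forall s, circle s -> phi (phi' s) = s]].

Definition gluing_map (Phi : 'I_3 -> R * R -> R * R) : Prop :=
  forall i, [/\ circle_homeo (Phi i), Phi i (-1, 0) = (-1, 0),
                Phi i (1, 0) = (1, 0) & Phi i (0, 1) = (0, 1)].

Definition holder_gluing (k : nat) (mu : R) (Phi : 'I_3 -> R * R -> R * R) :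
    Prop :=
  forall i, let g := fun t : R => Phi i (circle_pt t) in
    (forall j, (j < k)%N -> forall t, derivable (derive1n j g) t 1) /\
    exists K : R, forall s t,
      `|derive1n k g s - derive1n k g t| <= K * `|s - t| `^ mu.

Definition nonsingular_gluing (Phi : 'I_3 -> R * R -> R * R) : Prop :=
  forall i t, derive1 (fun t : R => Phi i (circle_pt t)) t != 0.

(* A point of X_Phi is an equivalence class of points (i, s), s in the i-th
   closed disk. *)
Definition sheets : set ('I_3 * (R * R)) := [set x | closed_disk x.2].

Definition glued (Phi : 'I_3 -> R * R -> R * R) (x y : 'I_3 * (R * R)) :
    Prop :=
  x = y \/
  [/\ lower_arc x.2, lower_arc y.2 &
      exists u, [/\ circle u, Phi x.1 u = x.2 & Phi y.1 u = y.2]].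

Definition glue_class (Phi : 'I_3 -> R * R -> R * R) (x : 'I_3 * (R * R)) :
    set ('I_3 * (R * R)) := [set y | glued Phi x y].

Definition quotient_space (Phi : 'I_3 -> R * R -> R * R) :
    set (set ('I_3 * (R * R))) := glue_class Phi @` sheets.

Definition free_curve (Phi : 'I_3 -> R * R -> R * R) :
    set (set ('I_3 * (R * R))) :=
  glue_class Phi @` [set x | lower_arc x.2].

(* Quotient topology of the disjoint union of the three closed disks. *)
Definition quotient_open (Phi : 'I_3 -> R * R -> R * R)
    (V : set (set ('I_3 * (R * R)))) : Prop :=
  V `<=` quotient_space Phi /\
  forall i, exists G : set (R * R), open G /\
    closed_disk `&` [set s | V (glue_class Phi (i, s))] = closed_disk `&` G.

Definition quotient_nbhs (Phi : 'I_3 -> R * R -> R * R)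
    (p : set ('I_3 * (R * R))) (V : set (set ('I_3 * (R * R)))) : Prop :=
  V `<=` quotient_space Phi /\
  exists V0, [/\ quotient_open Phi V0, V0 p & V0 `<=` V].

(* Image under the map that alpha induces on the quotient space. *)
Definition quotient_image (n : nat) (alpha : 'I_3 -> R * R -> 'rV[R]_n)
    (V : set (set ('I_3 * (R * R)))) : set 'rV[R]_n :=
  [set v | exists P x, [/\ V P, P x & v = alpha x.1 x.2]].

End GluingMaps.

Section BoundaryData.
Context {R : realType}.
Variable n : nat.

Definition arc_between (G : set 'rV[R]_n) (a b : 'rV[R]_n) : Prop :=
  exists g : R -> 'rV[R]_n,
    [/\ {within `[0, 1], continuous g}, {in `[0, 1] &, injective g},
        g @` `[0, 1] = G, g 0 = a & g 1 = b].

Definition triple_arc_graph (Gamma : 'I_3 -> set 'rV[R]_n)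
    (qm qp : 'rV[R]_n) : Prop :=
  (forall i, arc_between (Gamma i) qm qp) /\
  (forall i j, i != j -> Gamma i `&` Gamma j = [set qm; qp]).

Definition polygon_length (g : R -> 'rV[R]_n) (a b : R) (s : seq R) : R :=
  let F := g \o nth b (a :: s) in
  \sum_(0 <= k < size s) enorm (F k.+1 - F k).

Definition curve_length (g : R -> 'rV[R]_n) (a b : R) : \bar R :=
  ereal_sup [set (polygon_length g a b s)%:E | s in itv_partition a b].

(* The arcs are only assumed rectifiable, so constant speed means that length
   is proportional to arc length on the circle. *)
Definition uniform_parametrization (Gamma : 'I_3 -> set 'rV[R]_n)
    (qm qp : 'rV[R]_n) (psi : 'I_3 -> R * R -> 'rV[R]_n) : Prop :=
  forall i,
    [/\ {within upper_arc, continuous (psi i)},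
        set_bij upper_arc (Gamma i) (psi i),
        psi i (-1, 0) = qm, psi i (1, 0) = qp &
        exists v : R, forall s t, 0 <= s -> s <= t -> t <= pi ->
          curve_length (psi i \o circle_pt) s t = (v * (t - s))%:E].

End BoundaryData.

Section Energy.
Context {R : realType}.

Local Notation mu2 := (@lebesgue_measure R \x @lebesgue_measure R)%E.

Definition test_function (D : set (R * R)) (phi : R * R -> R) : Prop :=
  (forall k, Ck_on k setT phi) /\
  exists K, [/\ compact K, K `<=` D & forall z, ~ K z -> phi z = 0].

Definition square_integrable (D : set (R * R)) (g : R * R -> R) : Prop :=
  measurable_fun D g /\ mu2.-integrable D (fun z => (g z ^+ 2)%:E).

(* g is an L^2 weak derivative of f in the direction v. *)
Definition weak_deriv (D : set (R * R)) (v : R * R) (f g : R * R -> R) : Prop :=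
  square_integrable D g /\
  forall phi, test_function D phi ->
    (\int[mu2]_(z in D) (f z * 'D_v phi z)%:E
     = - \int[mu2]_(z in D) (g z * phi z)%:E)%E.

Definition sobolev12 (D : set (R * R)) (f : R * R -> R) : Prop :=
  [/\ square_integrable D f, exists g, weak_deriv D e1 f g &
      exists g, weak_deriv D e2 f g].

(* Unique up to null sets, for f in [sobolev12 D]. *)
Definition weak_partial (D : set (R * R)) (v : R * R) (f : R * R -> R) :
    R * R -> R := xget (cst 0) [set g | weak_deriv D v f g].

Definition coord (n : nat) (f : R * R -> 'rV[R]_n) (k : 'I_n) : R * R -> R :=
  fun z => f z 0 k.

Definition dirichlet_energy (n : nat) (f : R * R -> 'rV[R]_n) : \bar R :=
  (\int[mu2]_(z in disk)
    (\sum_(k < n) (weak_partial disk e1 (coord f k) z ^+ 2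
                   + weak_partial disk e2 (coord f k) z ^+ 2))%:E)%E.

Definition admissible (n : nat) (psi : 'I_3 -> R * R -> 'rV[R]_n)
    (Phi : 'I_3 -> R * R -> R * R) (alpha : 'I_3 -> R * R -> 'rV[R]_n) :
    Prop :=
  [/\ forall i k, sobolev12 disk (coord (alpha i) k),
      forall i, {within closed_disk, continuous (alpha i)},
      forall i j s, lower_arc s -> alpha i (Phi i s) = alpha j (Phi j s) &
      forall i s, upper_arc s -> alpha i (Phi i s) = psi i s].

Definition weights (c : 'I_3 -> R) : Prop :=
  \sum_(i < 3) c i = 1 /\ forall i, 0 <= c i.

Definition compatible (n : nat) (c : 'I_3 -> R)
    (alpha : 'I_3 -> R * R -> 'rV[R]_n) : Prop :=
  forall i, c i = 0 -> dirichlet_energy (alpha i) = 0%E.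

Definition weighted_energy (n : nat) (c : 'I_3 -> R)
    (alpha : 'I_3 -> R * R -> 'rV[R]_n) : \bar R :=
  (if `[< compatible c alpha >] then
     sqrte (\sum_(i < 3 | c i != 0%R)
              ((c i)^-1)%:E * dirichlet_energy (alpha i) ^+ 2)
   else +oo)%E.

Definition minimal_energy (n : nat) (psi : 'I_3 -> R * R -> 'rV[R]_n) :
    \bar R :=
  ereal_inf [set ereal_inf [set ereal_inf [set weighted_energy c alpha
    | alpha in [set alpha | admissible psi Phi alpha]]
    | c in [set c | weights c]]
    | Phi in [set Phi | gluing_map Phi]].

End Energy.

Section SingularSet.
Context {R : realType}.
Variable n : nat.

Definition disk_lower_arc : set (R * R) := disk `|` lower_arc.

(* At a point of the lower arc the differential is the one-sided one. *)
Definition rank_zero_points (f : R * R -> 'rV[R]_n) : set (R * R) :=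
  [set z | disk_lower_arc z /\ exists a b : 'rV[R]_n,
    has_diff_within disk_lower_arc f z a b /\ \rank (col_mx a b) = 0%N].

Definition sheet_singular_set (f : R * R -> 'rV[R]_n) : set (R * R) :=
  isolated (rank_zero_points f).

Definition singular_set (Phi : 'I_3 -> R * R -> R * R)
    (alpha : 'I_3 -> R * R -> 'rV[R]_n) : set (set ('I_3 * (R * R))) :=
  glue_class Phi @` [set x | sheet_singular_set (alpha x.1) x.2].

Definition regular_set (Phi : 'I_3 -> R * R -> R * R)
    (alpha : 'I_3 -> R * R -> 'rV[R]_n) : set (set ('I_3 * (R * R))) :=
  quotient_space Phi `\` singular_set Phi alpha.

End SingularSet.

Section Surfaces.
Context {R : realType}.
Variable n : nat.

(* h restricted to D is a C^1 embedding with image M. *)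
Definition parametrizes (D : set (R * R)) (h : R * R -> 'rV[R]_n)
    (M : set 'rV[R]_n) : Prop :=
  [/\ h @` D = M, inverse_continuous D h &
      exists hx hy, C1_within D h hx hy /\
        forall z, D z -> row_free (col_mx (hx z) (hy z))].

Definition boundary_chart (Sigma gamma : set 'rV[R]_n) (q : 'rV[R]_n)
    (W : set (R * R)) (h : R * R -> 'rV[R]_n) (z : R * R) : Prop :=
  [/\ open W, (W `&` x_axis) z, h z = q &
      exists N, [/\ open N, parametrizes (W `&` upper_plane) h (Sigma `&` N) &
                    h @` (W `&` x_axis) = gamma `&` N]].

Definition interior_chart (Sigma : set 'rV[R]_n) (q : 'rV[R]_n)
    (W : set (R * R)) (h : R * R -> 'rV[R]_n) : Prop :=
  open W /\ exists N, [/\ open N, N q & parametrizes W h (Sigma `&` N)].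

(* Embedded C^1 surface with boundary curve gamma (gamma included). *)
Definition embedded_surface (Sigma gamma : set 'rV[R]_n) : Prop :=
  [/\ gamma `<=` Sigma,
      forall q, gamma q -> exists W h z, boundary_chart Sigma gamma q W h z &
      forall q, (Sigma `\` gamma) q -> exists W h, interior_chart Sigma q W h].

Definition analytic_surface (M : set 'rV[R]_n) : Prop :=
  forall q, M q -> exists W h, interior_chart M q W h /\ real_analytic_on W h.

Definition embedded_analytic_curve (gamma : set 'rV[R]_n) : Prop :=
  forall q, gamma q -> exists (W : set R) (g : R -> 'rV[R]_n) N,
    [/\ open W, open N, N q, g @` W = gamma `&` N &
        [/\ inverse_continuous W g, real_analytic_curve_on W g &
            forall t, W t -> derive1 g t != 0]].

(* In a boundary chart the tangent plane is spanned by a and b, with a tangent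
   to gamma and b pointing into Sigma. *)
Definition outer_conormal (Sigma gamma : set 'rV[R]_n) (q eta : 'rV[R]_n) :
    Prop :=
  exists W h z (a b : 'rV[R]_n),
    [/\ boundary_chart Sigma gamma q W h z,
        has_diff_within (W `&` upper_plane) h z a b,
        exists s t : R, t < 0 /\ eta = s *: a + t *: b,
        dotv eta a = 0 & enorm eta = 1].

Definition balanced_sheets (Sigma : 'I_3 -> set 'rV[R]_n)
    (gamma : set 'rV[R]_n) (eta : 'I_3 -> 'rV[R]_n -> 'rV[R]_n) : Prop :=
  [/\ embedded_analytic_curve gamma,
      forall i, embedded_surface (Sigma i) gamma,
      forall i j, i != j -> Sigma i `&` Sigma j = gamma,
      forall i q, gamma q -> outer_conormal (Sigma i) gamma q (eta i q) &
      forall q, gamma q -> \sum_(i < 3) eta i q = 0].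

End Surfaces.

Section Reflection.
Context {R : realType}.
Variable n : nat.

Definition conformal_Y0 (f : 'I_3 -> R * R -> 'rV[R]_n) : Prop :=
  (forall i, conformal_on closed_half_disk (f i)) /\
  (forall i j (x : R), -1 < x < 1 -> f i (x, 0) = f j (x, 0)).

Definition harmonic_Y0 (f : 'I_3 -> R * R -> 'rV[R]_n) : Prop :=
  forall i, harmonic_on open_half_disk (f i).

(* Surfaces contain their boundary curve but not their outer edge, hence the
   domain {x^2 + y^2 < 1, y >= 0}. *)
Definition parametrizes_sheets (f : 'I_3 -> R * R -> 'rV[R]_n)
    (Sigma : 'I_3 -> set 'rV[R]_n) (gamma : set 'rV[R]_n) : Prop :=
  forall i, parametrizes (disk `&` upper_plane) (f i) (Sigma i) /\
            f i @` (disk `&` x_axis) = gamma.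

Definition multi_sheeted_reflection (f : 'I_3 -> R * R -> 'rV[R]_n)
    (i : 'I_3) : R * R -> 'rV[R]_n :=
  fun z => if 0 <= z.2 then f i z
           else - f i (z.1, - z.2)
                + (2 / 3 : R) *: \sum_(j < 3) f j (z.1, - z.2).

(* M extends Sigma as an analytic surface without boundary, so that gamma lies
   in its interior, and U parametrizes M.  Reflected sheets may branch or
   overlap away from the axis, so U need not be injective on the whole disk: M
   is the image of some neighbourhood of the closed upper side. *)
Definition analytic_extension_by (Sigma : set 'rV[R]_n)
    (U : R * R -> 'rV[R]_n) (M : set 'rV[R]_n) : Prop :=
  [/\ analytic_surface M, Sigma `<=` M, real_analytic_on disk U &
      exists O : set (R * R),
        [/\ open O, disk `&` upper_plane `<=` O, O `<=` disk &
            parametrizes O U M]].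

End Reflection.

(* Main.v *)
(** The outer conormals are -f_y / |f_y|, so along the axis the balancing
    condition says that the three normal derivatives sum to zero; as the traces
    agree, U_i is then differentiable at the axis, and it is harmonic off it.

    Such a function u is harmonic, indeed a power series Re (sum c_k z^k), on
    every closed disk of the open unit disk.  On the circle u is a uniform limit
    of averages of the kernels |z + w|^(2 m) over w in the (m + 1)-st roots of
    unity, which are trigonometric polynomials with bounded coefficients.  Their
    harmonic extensions converge to u in the whole disk, by a maximum principle
    whose barrier eps |y| has a kink that excludes maxima on the axis; the
    coefficients converge along an ultrafilter.

    Conformality propagates to the lower half because |U_x|^2 - |U_y|^2 and
    U_x . U_y are harmonic and vanish on the upper half.  Finally U_i is an
    embedding on the closed upper side and an immersion near it, hence an
    embedding on a neighbourhood. *)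

Require Import Defs.
From HB Require Import structures.
From mathcomp Require Import all_boot all_order all_algebra.
From mathcomp Require Import all_classical all_reals all_analysis.
From mathcomp Require Import cyclic separable cyclotomic complex.
From mathcomp Require Import ring lra zify.
Import Order.TTheory GRing.Theory Num.Theory.
Import numFieldNormedType.Exports.
Import Normc.

Set Implicit Arguments.
Unset Strict Implicit.
Unset Printing Implicit Defensive.

Local Open Scope classical_set_scope.
Local Open Scope ring_scope.

Local Notation coord := Defs.coord.

(** * Complex powers *)

Section ComplexPowers.
Context {R : realType}.
Implicit Types (z w : R * R) (k m : nat).

(** The axis is the obstacle: U_i is only known to be differentiable there, so harmonicity across it
    cannot be checked through second derivatives. A maximum principle that tolerates such a line
    takes the place of that check, and comparison with harmonic polynomials then identifies U_i. The
    kernel |z + w|^(2 m) keeps this free of integrals: it is a nonnegative trigonometric polynomial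
    of degree m with its peak at w = z, and averaging over m + 1 roots of unity annihilates all its
    nonzero frequencies, so the weights add up to 1 exactly. The ultrafilter yields limits of all
    coefficients at once. The last step is delicate because the half disk without its outer edge is
    not compact: the balls on which U_i is an embedding may shrink towards that edge, and points of
    balls of different sizes must be compared. *)

Definition cpx (z : R * R) : R[i] := Complex z.1 z.2.

Arguments cpx : simpl never.
Arguments conjc : simpl never.

Definition rpow k z : R := complex.Re (cpx z ^+ k).
Definition ipow k z : R := complex.Im (cpx z ^+ k).

Lemma rpow0 z : rpow 0 z = 1. Proof. by []. Qed.
Lemma ipow0 z : ipow 0 z = 0. Proof. by []. Qed.

Lemma rpowS k z : rpow k.+1 z = z.1 * rpow k z - z.2 * ipow k z.
Proof. by rewrite /rpow /ipow exprS; case: (_ ^+ k). Qed.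

Lemma ipowS k z : ipow k.+1 z = z.1 * ipow k z + z.2 * rpow k z.
Proof. by rewrite /rpow /ipow exprS; case: (_ ^+ k) => a b /=; rewrite addrC. Qed.

Lemma sqnorm_pow k z : rpow k z ^+ 2 + ipow k z ^+ 2 = sqnorm2 z ^+ k.
Proof.
elim: k => [|k IH]; first by rewrite rpow0 ipow0; ring.
by rewrite [RHS]exprS -IH rpowS ipowS /sqnorm2; ring.
Qed.

Lemma pow_bound k z r : 0 <= r -> sqnorm2 z <= r ^+ 2 ->
  `|rpow k z| <= r ^+ k /\ `|ipow k z| <= r ^+ k.
Proof.
move=> r0 zr.
have H : rpow k z ^+ 2 + ipow k z ^+ 2 <= (r ^+ k) ^+ 2.
  rewrite sqnorm_pow -exprM mulnC exprM lerXn2r // nnegrE ?exprn_ge0 //.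
  by rewrite addr_ge0 ?sqr_ge0.
have rk : 0 <= r ^+ k by rewrite exprn_ge0.
by split; rewrite -(ler_pXn2r (n := 2)) ?nnegrE // real_normK ?num_real //;
  apply: le_trans H; rewrite ?lerDl ?lerDr sqr_ge0.
Qed.

Lemma sqnorm2_cpx z : (sqnorm2 z)%:C%C = cpx z * conjc (cpx z).
Proof.
by apply/eqP; rewrite eq_complex /= /sqnorm2 -!expr2 mulrN opprK; apply/andP;
  split; apply/eqP; ring.
Qed.

Lemma cpxK (x : R[i]) : cpx (complex.Re x, complex.Im x) = x.
Proof. by case: x. Qed.

Lemma Re_sum (I : Type) (s : seq I) (F : I -> R[i]) :
  complex.Re (\sum_(i <- s) F i) = \sum_(i <- s) complex.Re (F i).
Proof. by apply: (big_morph (@complex.Re R)) => // -[? ?] [? ?]. Qed.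

Lemma Im_sum (I : Type) (s : seq I) (F : I -> R[i]) :
  complex.Im (\sum_(i <- s) F i) = \sum_(i <- s) complex.Im (F i).
Proof. by apply: (big_morph (@complex.Im R)) => // -[? ?] [? ?]. Qed.

Lemma Re_mulrn (x : R[i]) k : complex.Re (x *+ k) = complex.Re x *+ k.
Proof. by elim: k => //= k IH; rewrite !mulrS -IH; case: x {IH} (x *+ k) => ? ? []. Qed.

(** Fourier coefficient of |1 + v|^(2 m) on the unit circle; for k > 0 the factor 2 merges the equal
    contributions of the frequencies k and -k. *)
Definition kernel_coef (m k : nat) : R :=
  (if k is 0%N then 1 else 2) * ('C(m.*2, m + k))%:R.

(* The kernel is |1 + v|^(2 m) with v = z / w on the unit circle, where
   |1 + v|^2 = (1 + v)^2 / v. *)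
Lemma kernel_expand m z w : sqnorm2 z = 1 -> sqnorm2 w = 1 ->
  sqnorm2 (z + w) ^+ m =
  \sum_(k < m.+1) kernel_coef m k * (rpow k z * rpow k w + ipow k z * ipow k w).
Proof.
move=> z1 w1; set v : R[i] := cpx z * conjc (cpx w).
have zz : cpx z * conjc (cpx z) = 1 by rewrite -sqnorm2_cpx z1.
have ww : cpx w * conjc (cpx w) = 1 by rewrite -sqnorm2_cpx w1.
have vE : conjc v = conjc (cpx z) * cpx w by rewrite /v rmorphM; congr (_ * _); exact: conjcK.
have vv : v * conjc v = 1.
  by rewrite vE; transitivity ((cpx z * conjc (cpx z)) * (cpx w * conjc (cpx w)));
    [rewrite /v; ring | rewrite zz ww mulr1].
have rv k : complex.Re (v ^+ k) = rpow k z * rpow k w + ipow k z * ipow k w.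
  rewrite /v exprMn -rmorphXn /rpow /ipow /=.
  by case: (cpx z ^+ k) (cpx w ^+ k) => a b [c d] /=; rewrite mulrN opprK.
have rvc k : complex.Re (conjc v ^+ k) = complex.Re (v ^+ k).
  by rewrite -rmorphXn /=; case: (v ^+ k).
have S : (sqnorm2 (z + w) ^+ m)%:C%C = (1 + v) ^+ (m.*2) * conjc v ^+ m.
  rewrite -muln2 mulnC exprM -exprMn rmorphXn /=; congr (_ ^+ m).
  rewrite sqnorm2_cpx.
  have -> : cpx (z + w) = cpx z + cpx w by [].
  rewrite rmorphD /=.
  transitivity ((1 + v) * (1 + conjc v)).
    have -> : (1 + v) * (1 + conjc v) = 1 + v + conjc v + v * conjc v by ring.
    by rewrite mulrDl !mulrDr zz ww vv vE /v; ring.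
  by rewrite expr2 -mulrA; congr (_ * _); rewrite mulrDl mul1r vv addrC.
have -> : sqnorm2 (z + w) ^+ m = complex.Re ((sqnorm2 (z + w) ^+ m)%:C%C) by [].
rewrite S (exprDn (1 : R[i])) mulr_suml Re_sum.
have h1 l : (l <= m)%N -> v ^+ l * conjc v ^+ m = conjc v ^+ (m - l).
  by move=> lm; rewrite -{1}(subnK lm) exprD mulrCA -exprMn vv expr1n mulr1.
have h2 l : (m <= l)%N -> v ^+ l * conjc v ^+ m = v ^+ (l - m).
  by move=> lm; rewrite -{1}(subnK lm) exprD -mulrA -exprMn vv expr1n mulr1.
(* The summand of index l has frequency l - m. Its absolute value is enough, since conjugation of a
   power of v keeps the real part. *)
pose g (l : nat) : R := ('C(m.*2, l))%:R * complex.Re (v ^+ (if (l <= m)%N then m - l else l - m)%N).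
have E (i : 'I_(m.*2).+1) : complex.Re ((1 ^+ (m.*2 - i) * v ^+ i *+ 'C(m.*2, i)) * conjc v ^+ m) = g i.
  rewrite expr1n mul1r mulrnAl Re_mulrn -mulr_natl; congr (_ * _).
  case: ifPn => im; first by rewrite h1 // rvc.
  by rewrite h2 // ltnW // ltnNge.
under eq_bigr do rewrite E.
rewrite -(big_mkord xpredT g) /=.
(* The sum is cut after the central index m and its first half is reversed: the head has frequency
   0, and the i-th terms of the two remaining sums both have frequency i + 1. *)
rewrite (@big_cat_nat _ _ _ m.+1) //=; last first.
  by rewrite ltnS -addnn leq_addr.
rewrite big_nat_rev /= big_nat_recl //= add0n subSS subn0.
have -> : \sum_(m.+1 <= i < (m.*2).+1) g i = \sum_(0 <= i < m) g (i + m.+1)%N.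
  by rewrite -{1}[m.+1]add0n big_addn subSS -addnn addnK.
rewrite -addrA -big_split /= big_ord_recl /=; congr (_ + _).
  by rewrite /g leqnn subnn /kernel_coef addn0 mul1r rv.
rewrite big_mkord; apply: eq_bigr => i _.
rewrite /g /kernel_coef subSS.
have im := ltn_ord i.
rewrite leq_subr subKn; last by [].
have -> : (i + m.+1 <= m)%N = false by rewrite addnS ltnNge leq_addl.
have -> : (i + m.+1 - m = i.+1)%N by rewrite -addSnnS addnK.
rewrite -rv -(@bin_sub (m.*2) (m - i.+1)%N); last by rewrite -addnn (leq_trans (leq_subr _ _)) ?leq_addr.
have -> : (m.*2 - (m - i.+1) = m + i.+1)%N.
  by rewrite -addnn subnBA // addnAC addnK addnC.
rewrite /bump /= add1n; have -> : (i + m.+1 = m + i.+1)%N by rewrite addnC -addSnnS addSnnS.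
by ring.
Qed.

End ComplexPowers.

(** * Trigonometric approximation on the circle *)

Section Approximation.
Context {R : realType}.
Implicit Types (z w : R * R) (k m : nat).

Lemma sqnorm2_parallelogram z w :
  sqnorm2 (z + w) = 2 * sqnorm2 z + 2 * sqnorm2 w - sqnorm2 (z - w).
Proof.
case: z w => [x y] [x' y'].
have -> : (x, y) + (x', y') = (x + x', y + y') by [].
have -> : (x, y) - (x', y') = (x - x', y - y') by [].
by rewrite /sqnorm2 /=; ring.
Qed.

(** The points are the powers of a primitive N-th root of unity x, which exists because X^N - 1
    splits over R[i] with N distinct roots. The power sums are geometric sums of ratio x^k, and this
    ratio is not 1 for 0 < k < N. *)
Lemma unit_roots N : (0 < N)%N -> exists s : 'I_N -> R * R,
  (forall j, sqnorm2 (s j) = 1) /\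
  forall k, (0 < k < N)%N ->
    \sum_j rpow k (s j) = 0 /\ \sum_j ipow k (s j) = 0.
Proof.
move=> N0; pose p : {poly R[i]} := ('X^N - 1%:P)%R.
have [r Dp] := closed_field_poly_normal p.
move: Dp; rewrite (monicP _) ?monicXnsubC // scale1r => Dp.
have rn1 : all N.-unity_root r.
  by apply/allP => z; rewrite -root_prod_XsubC -Dp.
have sz_r : (N < (size r).+1)%N.
  by rewrite -(size_prod_XsubC r id) -Dp size_XnsubC.
have ur : uniq r.
  by rewrite -separable_prod_XsubC -Dp separable_Xn_sub_1 // pnatr_eq0 -lt0n.
have [x _ xP] := hasP (has_prim_root N0 rn1 ur sz_r).
have xN : x ^+ N = 1 by apply: prim_expr_order.
pose s (j : 'I_N) : R * R := (complex.Re (x ^+ j), complex.Im (x ^+ j)).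
have cs j : cpx (s j) = x ^+ j by rewrite cpxK.
exists s; split=> [j|k /andP[k0 kN]].
  apply/eqP; rewrite -(@pexpr_eq1 _ _ N) //; last by rewrite addr_ge0 ?sqr_ge0.
  suff : ((sqnorm2 (s j) ^+ N)%:C%C : R[i]) = 1 by move=> [->].
  rewrite rmorphXn /= sqnorm2_cpx exprMn cs -rmorphXn /= -exprM mulnC exprM xN expr1n.
  by rewrite mul1r rmorph1.
suff S : \sum_j cpx (s j) ^+ k = 0.
  by rewrite /rpow /ipow -Re_sum -Im_sum S.
under eq_bigr => j _ do rewrite cs -exprM mulnC exprM.
have := subrX1 (x ^+ k) N; rewrite -exprM mulnC exprM xN expr1n subrr.
move/esym/eqP; rewrite mulf_eq0 => /orP[|/eqP //].
rewrite subr_eq0 -(prim_order_dvd xP) => /(dvdn_leq k0).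
by rewrite leqNgt kN.
Qed.

Lemma bin_central_max m k : ('C(m.*2, m + k) <= 'C(m.*2, m))%N.
Proof.
elim: k => [|k IH]; first by rewrite addn0.
apply: leq_trans IH; rewrite addnS -(leq_pmul2l (ltn0Sn (m + k))).
rewrite mul_bin_left leq_mul2r; apply/orP; right.
by rewrite -addnn subnDl (leq_trans (leq_subr _ _)) // leqW // leq_addr.
Qed.

(** The 2 m + 1 binomials of row 2 m add up to 4^m, and the central one is the largest. It is the
    normalization of the kernel, which therefore cannot be much smaller than the peak value 4^m. *)
Lemma bin_central_ge m : (4 ^ m <= (m.*2).+1 * 'C(m.*2, m))%N.
Proof.
have -> : (4 ^ m = \sum_(i < (m.*2).+1) 'C(m.*2, i))%N.
  rewrite -[4%N]/(2 ^ 2)%N -expnM mul2n -{1}[2%N]/((1 + 1)%N) expnDn.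
  by apply: eq_bigr => i _; rewrite !exp1n !muln1.
rewrite -[X in (_ <= X * _)%N]card_ord -sum_nat_const; apply: leq_sum => i _.
case: (leqP m i) => im; first by rewrite -(subnKC im) bin_central_max.
rewrite -bin_sub; last by rewrite -ltnS.
have -> : (m.*2 - i = m + (m - i))%N by rewrite addnBA ?addnn // ltnW.
exact: bin_central_max.
Qed.

(** Each s^i with i < k is at least s^k, so k s^k is at most a geometric sum. *)
Lemma mulrn_geom_le (s : R) (k : nat) : 0 <= s < 1 -> k%:R * s ^+ k <= (1 - s)^-1.
Proof.
move=> /andP[s0 s1]; have s1' : 0 < 1 - s by rewrite subr_gt0.
rewrite -[leRHS]div1r ler_pdivlMr //.
have -> : k%:R * s ^+ k * (1 - s) = (\sum_(i < k) s ^+ k) * (1 - s).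
  by rewrite sumr_const card_ord -[s ^+ k *+ k]mulr_natl.
apply: (@le_trans _ _ ((\sum_(i < k) s ^+ i) * (1 - s))).
  rewrite ler_wpM2r ?(ltW s1') // ler_sum // => i _.
  by apply: ler_wiXn2l; rewrite ?(ltW s1) // ltnW.
have := subrX1 s k => /(congr1 -%R); rewrite opprB -mulNr opprB mulrC => <-.
by rewrite gerBl exprn_ge0.
Qed.

Lemma natmul_geom_cvg (q : R) : 0 <= q < 1 ->
  (fun m : nat => ((m.*2).+1)%:R * q ^+ m) @ \oo --> (0 : R).
Proof.
(* Of q^m = s^m s^m, one factor absorbs the linear growth by [mulrn_geom_le] and the other tends to
   0. *)
move=> /andP[q0 q1]; pose s := Num.sqrt q.
have s0 : 0 <= s by apply: sqrtr_ge0.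
have s1 : s < 1 by rewrite -[1]sqrtr1 ltr_sqrt.
have sq : q = s ^+ 2 by rewrite sqr_sqrtr.
pose B := 2 * (1 - s)^-1 + 1.
have B0 : 0 <= B by rewrite addr_ge0 // mulr_ge0 // invr_ge0 subr_ge0 ltW.
apply: (@squeeze_cvgr _ _ _ _ (fun=> 0) (fun m => B * s ^+ m)).
- near=> m; rewrite mulr_ge0 ?exprn_ge0 //=.
  have e2 : (2 * m = m + m)%N by rewrite mul2n addnn.
  rewrite sq -exprM e2 exprD mulrA ler_wpM2r ?exprn_ge0 //.
  rewrite -addn1 natrD -mul2n natrM mulrDl mul1r -mulrA lerD //.
    by rewrite ler_wpM2l // mulrn_geom_le // s0.
  by rewrite exprn_ile1 // ltW.
- exact: cvg_cst.
- by rewrite -[X in _ --> X](mulr0 B); apply: cvgMl_tmp; apply: cvg_expr; rewrite ger0_norm.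
Unshelve. all: by end_near. Qed.

(** The harmonic polynomial Re (sum of (a_k - i b_k) z^k over k < m). *)
Definition hsum (a b : nat -> R) (m : nat) z : R :=
  \sum_(k < m) (a k * rpow k z + b k * ipow k z).

(** The approximant at z is a weighted mean of the values of f at the nodes, with weights that
    concentrate near z. The coefficient bound has to be uniform in both m and k, since limit
    coefficients are extracted from it. *)
Lemma trig_approx (f : R * R -> R) (M : R) :
  (forall z, sqnorm2 z = 1 -> `|f z| <= M) ->
  (forall e : R, 0 < e -> exists2 d : R, 0 < d & forall z w, sqnorm2 z = 1 ->
     sqnorm2 w = 1 -> sqnorm2 (z - w) < d -> `|f z - f w| <= e) ->
  exists a b : nat -> nat -> R,
    (forall m k, `|a m k| <= 2 * M /\ `|b m k| <= 2 * M) /\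
    forall e : R, 0 < e -> \forall m \near \oo, forall z, sqnorm2 z = 1 ->
      `|f z - hsum (a m) (b m) m.+1 z| <= e.
Proof.
move=> fM fu.
have M0 : 0 <= M.
  by apply: le_trans (fM (1, 0) _) => //; rewrite /sqnorm2 /= expr1n expr0n /= addr0.
pose s m := projT1 (cid (unit_roots (ltn0Sn m))).
have sP m : (forall j, sqnorm2 (s m j) = 1) /\ forall k, (0 < k < m.+1)%N ->
    \sum_j rpow k (s m j) = 0 /\ \sum_j ipow k (s m j) = 0.
  exact: projT2 (cid (unit_roots (ltn0Sn m))).
have s1 m j : sqnorm2 (s m j) = 1 by have [] := sP m.
pose C m : R := ('C(m.*2, m))%:R.
have C0 m : 0 < C m by rewrite ltr0n bin_gt0 -addnn leq_addr.
pose N m : R := m.+1%:R.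
have N0 m : 0 < N m by rewrite ltr0n.
pose a m k := kernel_coef m k / C m * ((\sum_j f (s m j) * rpow k (s m j)) / N m).
pose b m k := kernel_coef m k / C m * ((\sum_j f (s m j) * ipow k (s m j)) / N m).
have bound m k (g : 'I_m.+1 -> R) : (forall j, `|g j| <= 1) ->
    `|kernel_coef m k / C m * ((\sum_j f (s m j) * g j) / N m)| <= 2 * M.
  move=> g1; rewrite normrM ler_pM //.
    rewrite normf_div (gtr0_norm (C0 m)) ler_pdivrMr // normrM [X in _ * X]ger0_norm //.
    rewrite ler_pM // ?ler_nat ?bin_central_max //.
    by case: k => [|k]; rewrite ?normr1 ?ler1n // ger0_norm.
  rewrite normf_div (gtr0_norm (N0 m)) ler_pdivrMr //.
  apply: le_trans (ler_norm_sum _ _ _) _.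
  have -> : M * N m = \sum_(j < m.+1) M by rewrite sumr_const card_ord mulr_natr.
  by apply: ler_sum => j _; rewrite normrM -[M]mulr1 ler_pM // fM.
have pw m j k : `|rpow k (s m j)| <= 1 /\ `|ipow k (s m j)| <= 1.
  by have := @pow_bound _ k (s m j) 1; rewrite s1 !expr1n; apply.
exists a, b; split=> [m k|e e0].
  by split; apply: bound => j; have [] := pw m j k.
(* The weight of the node s_j, normalized by the constant Fourier coefficient [C m] of the kernel
   and the number [N m] of nodes. *)
pose K m z j := sqnorm2 (z + s m j) ^+ m / (C m * N m).
have K0 m z j : 0 <= K m z j.
  by rewrite divr_ge0 ?exprn_ge0 ?addr_ge0 ?sqr_ge0 // mulr_ge0 // ltW.
have H1 m z : sqnorm2 z = 1 -> hsum (a m) (b m) m.+1 z = \sum_j f (s m j) * K m z j.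
  move=> z1; rewrite /hsum.
  transitivity (\sum_(k < m.+1) \sum_j f (s m j) / (C m * N m) *
     (kernel_coef m k * (rpow k z * rpow k (s m j) + ipow k z * ipow k (s m j)))).
    apply: eq_bigr => k _; rewrite /a /b.
    have -> : kernel_coef m k / C m * ((\sum_j f (s m j) * rpow k (s m j)) / N m) * rpow k z
     = (kernel_coef m k / C m / N m * rpow k z) * (\sum_j f (s m j) * rpow k (s m j)) by ring.
    have -> : kernel_coef m k / C m * ((\sum_j f (s m j) * ipow k (s m j)) / N m) * ipow k z
     = (kernel_coef m k / C m / N m * ipow k z) * (\sum_j f (s m j) * ipow k (s m j)) by ring.
    rewrite !mulr_sumr -big_split /=; apply: eq_bigr => j _.
    by rewrite invfM; ring.
  rewrite exchange_big /=; apply: eq_bigr => j _.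
  by rewrite -mulr_sumr /K kernel_expand // mulrAC mulrA.
(* The frequencies 1, ..., m of the kernel stay below m + 1, the number of nodes, so their sums over
   the nodes vanish and only frequency 0 is left. *)
have H2 m z : sqnorm2 z = 1 -> \sum_j K m z j = 1.
  move=> z1; rewrite /K -mulr_suml.
  under eq_bigr => j _ do rewrite kernel_expand //.
  rewrite exchange_big /= big_ord_recl /=.
  rewrite [X in _ + X]big1 ?addr0.
    under eq_bigr => j _ do rewrite !rpow0 !ipow0 mulr0 mulr1 addr0 mulr1.
    rewrite sumr_const card_ord -mulr_natr /kernel_coef mul1r addn0.
    by rewrite -/(C m) -/(N m) divff // mulf_neq0 // gt_eqF.
  move=> k _; rewrite -mulr_sumr big_split /= -!mulr_sumr.
  have [_ /(_ (bump 0 k))[|-> ->]] := sP m; last by rewrite !mulr0 addr0 mulr0.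
  by rewrite /= /bump /= add1n ltnS ltn_ord.
have [d d0 dP] := fu _ (divr_gt0 e0 (ltr0n _ 2)).
pose d' := Num.min d 1.
have d'0 : 0 < d' by rewrite lt_min d0 ltr01.
have d'1 : d' <= 1 by rewrite ge_min lexx orbT.
have d'd : d' <= d by rewrite ge_min lexx.
(* On the unit circle |z - w|^2 >= d forces |z + w|^2 <= 4 - d by the parallelogram law; q compares
   this with the peak value 4. The cap d' <= 1 keeps q nonnegative. *)
pose q := (4 - d') / 4.
have q01 : 0 <= q < 1 by rewrite /q; apply/andP; split; lra.
have /cvgrPdist_lt/(_ (e / 2 / (2 * M + 1)))[] := natmul_geom_cvg q01.
  by rewrite !divr_gt0 // ltr_wpDl // mulr_ge0.
move=> m0 _ m0P; exists m0 => // m /m0P /=; rewrite sub0r normrN => mP z z1.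
rewrite H1 // -[f z]mulr1 -(H2 m z z1) mulr_sumr -sumrB.
apply: le_trans (ler_norm_sum _ _ _) _.
(* Nodes near z are controlled by uniform continuity, distant ones by the decay of the kernel.
   Adding the two bounds gives one estimate that can be summed over all nodes. *)
have E j : `|f z * K m z j - f (s m j) * K m z j| <=
   e / 2 * K m z j + 2 * M * (((m.*2).+1)%:R * q ^+ m) / N m.
  rewrite -mulrBl normrM (ger0_norm (K0 _ _ _)).
  have T0 : 0 <= 2 * M * (((m.*2).+1)%:R * q ^+ m) / N m.
    by rewrite divr_ge0 ?mulr_ge0 ?exprn_ge0 ?(ltW (N0 m)) //; case/andP: q01.
  have [near_|far] := ltP (sqnorm2 (z - s m j)) d.
    by rewrite -[X in X <= _]addr0 lerD // ler_wpM2r // dP.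
  rewrite -[X in X <= _]add0r lerD //; first by rewrite mulr_ge0 // divr_ge0 // ltW.
  rewrite -mulrA ler_pM //.
    by apply: le_trans (ler_normB _ _) _; rewrite [2 * M]mulr_natl mulr2n lerD // fM.
  rewrite /K invfM mulrA ler_wpM2r ?invr_ge0 ?(ltW (N0 m)) //.
  rewrite ler_pdivrMr //.
  have q4 : q ^+ m * 4 ^+ m = (4 - d') ^+ m.
    by rewrite -exprMn; congr (_ ^+ _); rewrite /q divfK.
  apply: (@le_trans _ _ ((4 - d') ^+ m)).
    apply: lerXn2r.
    - by rewrite nnegrE addr_ge0 ?sqr_ge0.
    - by rewrite nnegrE; lra.
    by rewrite sqnorm2_parallelogram z1 s1; move: far d'd; lra.
  have -> : ((m.*2).+1)%:R * q ^+ m * C m = q ^+ m * (((m.*2).+1)%:R * C m) by ring.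
  rewrite -q4 ler_wpM2l ?exprn_ge0 //; first by case/andP: q01.
  by have := bin_central_ge m; rewrite -(ler_nat R) natrX natrM.
apply: le_trans (ler_sum _ (fun j _ => E j)) _.
rewrite big_split /= -mulr_sumr H2 // mulr1 sumr_const card_ord -[_ *+ m.+1]mulr_natr.
rewrite divfK ?gt_eqF // [leRHS]splitr lerD2l.
have t0 : 0 <= ((m.*2).+1)%:R * q ^+ m.
  by rewrite mulr_ge0 ?exprn_ge0 //; case/andP: q01.
move: mP; rewrite ger0_norm // ltr_pdivlMr; last by rewrite ltr_wpDl // mulr_ge0.
by move: t0; set t := _ * q ^+ m; nra.
Qed.

End Approximation.

(** * Laplacians and the maximum principle *)

Section Laplacian.
Context {R : realType}.
Implicit Types (z w v : R * R) (u g : R * R -> R).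

Lemma is_derive_line u z v (t d : R) :
  is_derive (t *: v + z) v u d -> is_derive t 1 (fun s : R => u (s *: v + z)) d.
Proof.
have E : (fun h : R => h^-1 *: (((fun s : R => u (s *: v + z)) \o shift t) (h *: 1) -
      u (t *: v + z)))
   = (fun h : R => h^-1 *: ((u \o shift (t *: v + z)) (h *: v) - u (t *: v + z))).
  apply/funext => h /=; congr (_ *: (u _ - _)).
  by rewrite [_%:A]mulr1 scalerDl addrA.
by move=> [H1 H2]; split; [rewrite /derivable E | rewrite /derive E].
Qed.

Lemma is_derive_additive u z v : {morph u : x y / x + y} ->
  (forall (h : R) w, u (h *: w) = h * u w) -> is_derive z v u (u v).
Proof.
move=> uD uZ.
have H : (fun h : R => h^-1 *: ((u \o shift z) (h *: v) - u z)) @ 0^' --> u v.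
  apply: cvg_near_cst; near=> h.
  have h0 : h != 0 by near: h; exact: nbhs_dnbhs_neq.
  by rewrite /= uD addrK uZ /GRing.scale /= mulrA mulVf // mul1r.
by apply: DeriveDef; [apply/cvg_ex; exists (u v) | apply/cvg_lim].
Unshelve. all: by end_near. Qed.

Lemma is_derive_fst z v : is_derive z v (fun w => w.1) v.1.
Proof. exact: (@is_derive_additive (fun w => w.1)). Qed.

Lemma is_derive_snd z v : is_derive z v (fun w => w.2) v.2.
Proof. exact: (@is_derive_additive (fun w => w.2)). Qed.

(** Second derivative test along the line through z. The first derivative g vanishes at z; if c > 0
    it would be positive just beyond z, and the mean value theorem would push u above u z. The
    second derivative is needed at z only. *)
Lemma deriv2_at_max u g z v (c : R) :
  (\forall w \near z, is_derive w v u (g w)) -> is_derive z v g c ->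
  (\forall w \near z, u w <= u z) -> c <= 0.
Proof.
move=> Hu Hg Hm; rewrite leNgt; apply/negP => c0.
pose L (t : R) := t *: v + z.
have L0 : L 0 = z by rewrite /L scale0r add0r.
have cL : L @ 0 --> z.
  rewrite -[X in _ --> X]L0; apply: cvgD; last exact: cvg_cst.
  by apply: cvgZr_tmp; exact: cvg_id.
have nu : \forall t \near 0, is_derive (L t) v u (g (L t)) by exact: cL Hu.
have nm : \forall t \near 0, u (L t) <= u z by exact: cL Hm.
have g0 : g z = 0.
  move: nu nm => /nbhs_ballP[r1 /= r10 B1] /nbhs_ballP[r2 /= r20 B2].
  pose r := Num.min r1 r2; have r0 : 0 < r by rewrite lt_min r10 r20.
  have tb t : t \in `]-r, r[%R -> ball (0 : R) r1 t /\ ball (0 : R) r2 t.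
    rewrite in_itv /= -ltr_norml lt_min /ball /= sub0r normrN.
    by move=> /andP[].
  have D t : t \in `]-r, r[%R -> is_derive t 1 (u \o L) (g (L t)).
    by move=> /tb[/B1 H _]; exact: is_derive_line H.
  have [] := @derive1_at_max R (u \o L) (-r) r 0.
  - by lra.
  - by move=> t /D [].
  - by rewrite in_itv /= oppr_lt0 r0.
  - by move=> t /tb[_ /B2] /=; rewrite L0.
  move=> _ d0; have z0 : (0 : R) \in `]-r, r[%R by rewrite in_itv /= oppr_lt0 r0.
  by have [_ E2] := D 0 z0; rewrite -[X in g X]L0 -E2 d0.
have [dg vg] := Hg.
have /cvgrPdist_lt/(_ c c0) H : (fun h : R => h^-1 *: ((g \o shift z) (h *: v) - g z)) @ 0^' --> c.
  by rewrite -vg; exact: dg.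
move: H nu nm; rewrite near_withinE => /nbhs_ballP[r3 /= r30 B3]
  /nbhs_ballP[r1 /= r10 B1] /nbhs_ballP[r2 /= r20 B2].
pose r := Num.min r1 (Num.min r2 r3) / 2.
have r0 : 0 < r by rewrite divr_gt0 // !lt_min r10 r20.
have r'0 : 0 < Num.min r1 (Num.min r2 r3) by rewrite !lt_min r10 r20.
have tb t : t \in `[-r, r]%R -> [/\ ball (0 : R) r1 t, ball (0 : R) r2 t & ball (0 : R) r3 t].
  rewrite in_itv /= -ler_norml => tr.
  have : `|t| < Num.min r1 (Num.min r2 r3).
    by apply: le_lt_trans tr _; rewrite ltr_pdivrMr // ltr_pMr // ltr1n.
  by rewrite !lt_min /ball /= sub0r normrN => /and3P[].
have D t : t \in `[-r, r]%R -> is_derive t 1 (u \o L) (g (L t)).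
  by move=> /tb[/B1 H _ _]; exact: is_derive_line H.
have sub t : t \in `[0, r]%R -> t \in `[-r, r]%R.
  rewrite !in_itv /= => /andP[t0 ->]; rewrite andbT.
  by apply: le_trans t0; rewrite oppr_le0 ltW.
have sub' t : t \in `]0, r[%R -> t \in `[0, r]%R.
  by rewrite !in_itv /= => /andP[/ltW-> /ltW->].
have D' t : t \in `]0, r[%R -> is_derive t 1 (u \o L) ((g \o L) t).
  by move=> /sub' /sub /D.
have C' : {within `[0, r], continuous (u \o L)}.
  by apply: derivable_within_continuous => t /sub /D [].
have [t tr E] := MVT r0 D' C'.
have := tr; rewrite in_itv /= => /andP[t0 _].
have [_ _ /B3/=] := tb _ (sub _ (sub' _ tr)); rewrite gt_eqF // => /(_ isT).
rewrite g0 subr0 distrC ltr_distl subrr => /andP[gt_pos _].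
have gt0 : 0 < g (L t).
  by move: gt_pos; rewrite /GRing.scale /= pmulr_rgt0 ?invr_gt0.
have rr : r \in `[-r, r]%R by rewrite in_itv /=; apply/andP; split; lra.
have [_ /B2 + _] := tb r rr.
rewrite -L0 -subr_le0 [X in X <= _]E subr0 leNgt mulr_gt0 //.
Qed.

(** At such a maximum the vertical difference quotients of u would be at most -e upwards and at
    least e downwards, yet both tend to d. *)
Lemma no_max_at_kink u z (c d e : R) : z.2 = c -> is_derive z e2 u d -> 0 < e ->
  ~ (\forall w \near z, u w + e * `|w.2 - c| <= u z).
Proof.
move=> zc [du vu] e0 Hm.
pose L (t : R) := t *: (e2 : R * R) + z.
have cL : L @ 0 --> z.
  have L0 : L 0 = z by rewrite /L scale0r add0r.
  rewrite -[X in _ --> X]L0; apply: cvgD; last exact: cvg_cst.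
  by apply: cvgZr_tmp; exact: cvg_id.
have nm : \forall t \near 0, u (L t) + e * `|t| <= u z.
  have : \forall t \near 0, u (L t) + e * `|(L t).2 - c| <= u z by exact: cL Hm.
  apply: filterS => t; suff -> : (L t).2 - c = t by [].
  by rewrite /L /= [_ *: 1]mulr1 zc addrK.
have /cvgrPdist_lt/(_ e e0) H :
    (fun h : R => h^-1 *: ((u \o shift z) (h *: e2) - u z)) @ 0^' --> d.
  by rewrite -vu; exact: du.
move: H nm; rewrite near_withinE => /nbhs_ballP[r1 /= r10 B1]
  /nbhs_ballP[r2 /= r20 B2].
pose r := Num.min r1 r2 / 2.
have m0 : 0 < Num.min r1 r2 by rewrite lt_min r10 r20.
have r0 : 0 < r by rewrite divr_gt0.
have tb t : `|t| = r -> [/\ ball (0 : R) r1 t & ball (0 : R) r2 t].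
  move=> tr; have : `|t| < Num.min r1 r2.
    by rewrite tr ltr_pdivrMr // ltr_pMr // ltr1n.
  by rewrite !lt_min /ball /= sub0r normrN => /andP[].
have rr : `|r| = r by rewrite gtr0_norm.
have nr : `|- r| = r by rewrite normrN.
have [/B1/= P1 /B2 P2] := tb r rr.
have [/B1/= N1 /B2 N2] := tb _ nr.
move: P1 N1; rewrite gt_eqF // lt_eqF ?oppr_lt0 // => /(_ isT) P1 /(_ isT) N1.
move: P1 N1 P2 N2; rewrite -/(L r) -/(L (- r)) rr nr /GRing.scale /= invrN mulNr.
rewrite !ltr_distl; set A := _^-1 * _; set B := _^-1 * _.
have EA : u (L r) - u z = r * A by rewrite /A mulrA divff ?gt_eqF // mul1r.
have EB : u (L (- r)) - u z = r * B by rewrite /B mulrA divff ?gt_eqF // mul1r.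
move=> /andP[a1 a2] /andP[b1 b2] P2 N2.
have : A <= - e by rewrite -(ler_pM2l r0) -EA; lra.
have : B <= - e by rewrite -(ler_pM2l r0) -EB; lra.
lra.
Qed.

(* The mixed second derivatives need not exist, and only the directional
   derivatives of u are required. *)
Definition has_laplacian u z (l : R) : Prop :=
  exists ux uy (uxx uyy : R), [/\ \forall w \near z, is_derive w e1 u (ux w),
    is_derive z e1 ux uxx, \forall w \near z, is_derive w e2 u (uy w),
    is_derive z e2 uy uyy & uxx + uyy = l].

Lemma has_laplacianD u g z (l l' : R) : has_laplacian u z l ->
  has_laplacian g z l' -> has_laplacian (u \+ g) z (l + l').
Proof.
move=> [ux [uy [a [b [H1 H2 H3 H4 <-]]]]] [vx [vy [c [d [K1 K2 K3 K4 <-]]]]].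
exists (ux \+ vx), (uy \+ vy), (a + c), (b + d); split.
- by near=> w; apply: is_deriveD; near: w.
- exact: is_deriveD.
- by near=> w; apply: is_deriveD; near: w.
- exact: is_deriveD.
- by ring.
Unshelve. all: by end_near. Qed.

Lemma has_laplacianZ u z (k l : R) : has_laplacian u z l ->
  has_laplacian (fun w => k * u w) z (k * l).
Proof.
move=> [ux [uy [a [b [H1 H2 H3 H4 <-]]]]].
have E : (fun w => k * u w) = k \*: u by [].
rewrite E; exists (k \*: ux), (k \*: uy), (k *: a), (k *: b); split.
- near=> w; have H : is_derive w e1 u (ux w) by near: w.
  exact: (is_derive_eq (is_deriveZ _ H)) erefl.
- exact: (is_deriveZ k H2).
- near=> w; have H : is_derive w e2 u (uy w) by near: w.
  exact: (is_derive_eq (is_deriveZ _ H)) erefl.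
- exact: (is_deriveZ k H4).
- by rewrite -scalerDr.
Unshelve. all: by end_near. Qed.

Lemma has_laplacian_sum (I : Type) (s : seq I) (F : I -> R * R -> R) z :
  (forall k, has_laplacian (F k) z 0) ->
  has_laplacian (fun w => \sum_(k <- s) F k w) z 0.
Proof.
move=> H; elim: s => [|k s IH].
  have -> : (fun w => \sum_(k <- [::]) F k w) = cst 0.
    by apply/funext => w; rewrite big_nil.
  exists (cst 0), (cst 0), 0, 0; split; last exact: addr0.
  - by near=> w; exact: is_derive_cst.
  - exact: is_derive_cst.
  - by near=> w; exact: is_derive_cst.
  - exact: is_derive_cst.
have -> : (fun w => \sum_(j <- k :: s) F j w) = F k \+ (fun w => \sum_(j <- s) F j w).
  by apply/funext => w; rewrite big_cons.
by rewrite -[X in has_laplacian _ _ X]addr0; exact: has_laplacianD (H k) IH.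
Unshelve. all: by end_near. Qed.

Lemma is_derive_coords z z0 v :
  is_derive z v (fun w => w.1 - z0.1) v.1 /\ is_derive z v (fun w => w.2 - z0.2) v.2.
Proof.
split; rewrite -[X in is_derive _ _ _ X]subr0.
  exact: is_deriveB (is_derive_fst z v) (is_derive_cst _ _ _).
exact: is_deriveB (is_derive_snd z v) (is_derive_cst _ _ _).
Qed.

Lemma is_derive_pow k z z0 :
  [/\ is_derive z e1 (fun w => rpow k (w - z0)) (k%:R * rpow k.-1 (z - z0)),
      is_derive z e1 (fun w => ipow k (w - z0)) (k%:R * ipow k.-1 (z - z0)),
      is_derive z e2 (fun w => rpow k (w - z0)) (- (k%:R * ipow k.-1 (z - z0))) &
      is_derive z e2 (fun w => ipow k (w - z0)) (k%:R * rpow k.-1 (z - z0))].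
Proof.
elim: k => [|k [H1 H2 H3 H4]].
  by split; rewrite mul0r ?oppr0; exact: is_derive_cst.
have Er : (fun w => rpow k.+1 (w - z0)) =
  (fun w => w.1 - z0.1) \* (fun w => rpow k (w - z0)) -
  (fun w => w.2 - z0.2) \* (fun w => ipow k (w - z0)).
  by apply/funext => w; rewrite rpowS.
have Ei : (fun w => ipow k.+1 (w - z0)) =
  (fun w => w.1 - z0.1) \* (fun w => ipow k (w - z0)) +
  (fun w => w.2 - z0.2) \* (fun w => rpow k (w - z0)).
  by apply/funext => w; rewrite ipowS.
have [c1 d1] := is_derive_coords z z0 e1.
have [c2 d2] := is_derive_coords z z0 e2.
(* At k = 0 the predecessor is 0 again and the recursion fails. The factor [*+ (k != 0)] switches
   both sides off there, at no cost because the identity is used only under the factor k. *)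
have R' : rpow k (z - z0) *+ (k != 0)%N = (z.1 - z0.1) * rpow k.-1 (z - z0) *+ (k != 0)%N - (z.2 - z0.2) * ipow k.-1 (z - z0) *+ (k != 0)%N.
  by case: (k) => [|j]; rewrite ?mulr0n ?subr0 // rpowS.
have I' : ipow k (z - z0) *+ (k != 0)%N = (z.1 - z0.1) * ipow k.-1 (z - z0) *+ (k != 0)%N + (z.2 - z0.2) * rpow k.-1 (z - z0) *+ (k != 0)%N.
  by case: (k) => [|j]; rewrite ?mulr0n ?addr0 // ipowS.
have kE (x : R) : k%:R * x = k%:R * (x *+ (k != 0)%N).
  by case: (k) => [|j]; rewrite ?mul0r.
rewrite Er Ei /= -natr1.
split.
- apply: (is_derive_eq (is_deriveB (is_deriveM c1 H1) (is_deriveM d1 H2))).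
  rewrite /GRing.scale /= [in RHS]mulrDl mul1r [k%:R * rpow k _]kE R'.
  by case: (k) => [|j]; rewrite ?mulr0n ?mulr1n; ring.
- apply: (is_derive_eq (is_deriveD (is_deriveM c1 H2) (is_deriveM d1 H1))).
  rewrite /GRing.scale /= [in RHS]mulrDl mul1r [k%:R * ipow k _]kE I'.
  by case: (k) => [|j]; rewrite ?mulr0n ?mulr1n; ring.
- apply: (is_derive_eq (is_deriveB (is_deriveM c2 H3) (is_deriveM d2 H4))).
  rewrite /GRing.scale /= [in RHS]mulrDl mul1r [k%:R * ipow k _]kE I'.
  by case: (k) => [|j]; rewrite ?mulr0n ?mulr1n; ring.
- apply: (is_derive_eq (is_deriveD (is_deriveM c2 H4) (is_deriveM d2 H3))).
  rewrite /GRing.scale /= [in RHS]mulrDl mul1r [k%:R * rpow k _]kE R'.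
  by case: (k) => [|j]; rewrite ?mulr0n ?mulr1n; ring.
Qed.

Lemma has_laplacian_pow k z z0 :
  has_laplacian (fun w => rpow k (w - z0)) z 0 /\
  has_laplacian (fun w => ipow k (w - z0)) z 0.
Proof.
have [H1 H2 H3 H4] := is_derive_pow k.-1 z z0.
split.
  exists (fun w => k%:R * rpow k.-1 (w - z0)), (fun w => - k%:R * ipow k.-1 (w - z0)).
  exists (k%:R * (k.-1%:R * rpow k.-1.-1 (z - z0))),
    (- k%:R * (k.-1%:R * rpow k.-1.-1 (z - z0))); split.
  - by near=> w; have [] := is_derive_pow k w z0.
  - exact: (is_deriveZ _ H1).
  - by near=> w; rewrite mulNr; have [] := is_derive_pow k w z0.
  - exact: (is_deriveZ _ H4).
  - by ring.
exists (fun w => k%:R * ipow k.-1 (w - z0)), (fun w => k%:R * rpow k.-1 (w - z0)).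
exists (k%:R * (k.-1%:R * ipow k.-1.-1 (z - z0))),
  (k%:R * - (k.-1%:R * ipow k.-1.-1 (z - z0))); split.
- by near=> w; have [] := is_derive_pow k w z0.
- exact: (is_deriveZ _ H2).
- by near=> w; have [] := is_derive_pow k w z0.
- exact: (is_deriveZ _ H3).
- by ring.
Unshelve. all: by end_near. Qed.

Lemma has_laplacian_hsum (a b : nat -> R) m z z0 :
  has_laplacian (fun w => hsum a b m (w - z0)) z 0.
Proof.
apply: (has_laplacian_sum _ (F := fun (k : 'I_m) w =>
   a k * rpow k (w - z0) + b k * ipow k (w - z0))) => k.
have [H1 H2] := has_laplacian_pow k z z0.
rewrite -[0](addr0 0) -{1}(mulr0 (a k)) -[X in _ + X](mulr0 (b k)).
exact: has_laplacianD (has_laplacianZ _ H1) (has_laplacianZ _ H2).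
Qed.

Lemma has_laplacian_sqnorm2 z z0 : has_laplacian (fun w => sqnorm2 (w - z0)) z 4.
Proof.
have D1 w v : is_derive w v (fun w => w.1 - z0.1) v.1 by case: (is_derive_coords w z0 v).
have D2 w v : is_derive w v (fun w => w.2 - z0.2) v.2 by case: (is_derive_coords w z0 v).
have E : (fun w => sqnorm2 (w - z0)) = (fun w => w.1 - z0.1) \* (fun w => w.1 - z0.1)
   + (fun w => w.2 - z0.2) \* (fun w => w.2 - z0.2) by apply/funext => w.
rewrite E; exists (fun w => 2 * (w.1 - z0.1)), (fun w => 2 * (w.2 - z0.2)), 2, 2; split.
- near=> w; apply: (is_derive_eq (is_deriveD (is_deriveM (D1 w e1) (D1 w e1)) (is_deriveM (D2 w e1) (D2 w e1)))).
  by rewrite /GRing.scale /=; ring.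
- by apply: (is_derive_eq (is_deriveZ 2 (D1 z e1))); rewrite /GRing.scale /= mulr1.
- near=> w; apply: (is_derive_eq (is_deriveD (is_deriveM (D1 w e2) (D1 w e2)) (is_deriveM (D2 w e2) (D2 w e2)))).
  by rewrite /GRing.scale /=; ring.
- by apply: (is_derive_eq (is_deriveZ 2 (D2 z e2))); rewrite /GRing.scale /= mulr1.
- by ring.
Unshelve. all: by end_near. Qed.

Lemma has_laplacian_snd z (c : R) : has_laplacian (fun w => w.2 - c) z 0.
Proof.
have D2 w v : is_derive w v (fun w => w.2 - c) v.2 by case: (is_derive_coords w (0, c) v).
exists (cst 0), (cst 1), 0, 0; split; last exact: addr0.
- by near=> w; exact: D2.
- exact: is_derive_cst.
- by near=> w; exact: D2.
- exact: is_derive_cst.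
Unshelve. all: by end_near. Qed.

Lemma laplacian_at_max u z (l : R) : has_laplacian u z l ->
  (\forall w \near z, u w <= u z) -> l <= 0.
Proof.
move=> [ux [uy [a [b [H1 H2 H3 H4 <-]]]]] Hm.
by rewrite -[0]addr0 lerD // ?(deriv2_at_max H1) // (deriv2_at_max H3).
Qed.

End Laplacian.

Section MaximumPrinciple.
Context {R : realType}.
Implicit Types (z w : R * R) (G u : R * R -> R).

Definition cdisk z0 (r : R) : set (R * R) := [set z | sqnorm2 (z - z0) <= r ^+ 2].

Lemma sqnorm2_ge0 z : 0 <= sqnorm2 z.
Proof. by rewrite addr_ge0 ?sqr_ge0. Qed.

Lemma abs_sqnorm2 z r : 0 <= r -> sqnorm2 z <= r ^+ 2 -> `|z.1| <= r /\ `|z.2| <= r.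
Proof.
move=> r0 zr.
by split; rewrite -(ler_pXn2r (n := 2)) ?nnegrE // real_normK ?num_real //;
  apply: le_trans zr; rewrite ?lerDl ?lerDr sqr_ge0.
Qed.

Lemma continuous_fst : continuous (fun z => z.1).
Proof. by move=> z; exact: cvg_fst. Qed.

Lemma continuous_snd : continuous (fun z => z.2).
Proof. by move=> z; exact: cvg_snd. Qed.

Lemma continuous_sqnorm2 z0 : continuous (fun z => sqnorm2 (z - z0)).
Proof.
move=> z; rewrite /sqnorm2.
have c1 : (fun w => w.1 - z0.1) @ z --> z.1 - z0.1.
  by apply: cvgB; [exact: continuous_fst | exact: cvg_cst].
have c2 : (fun w => w.2 - z0.2) @ z --> z.2 - z0.2.
  by apply: cvgB; [exact: continuous_snd | exact: cvg_cst].
exact: cvgD (cvgM c1 c1) (cvgM c2 c2).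
Qed.

Lemma compact_cdisk z0 r : 0 <= r -> compact (cdisk z0 r).
Proof.
move=> r0; apply: (@subclosed_compact _ _
  (`[z0.1 - r, z0.1 + r]%classic `*` `[z0.2 - r, z0.2 + r]%classic)).
- rewrite (_ : cdisk z0 r = (fun z => sqnorm2 (z - z0)) @^-1` [set x | x <= r ^+ 2]) //.
  apply: preimage_closed; last exact: closed_le.
  by move=> z _; exact: (@continuous_sqnorm2 z0 z).
- by apply: compact_setX; exact: segment_compact.
- move=> z /(abs_sqnorm2 r0)/= [].
  by rewrite !ler_distl !in_itv /= => -> ->.
Qed.

Lemma open_disk_nbhs z0 (r : R) z : sqnorm2 (z - z0) < r ->
  \forall w \near z, sqnorm2 (w - z0) < r.
Proof.
by move=> zr; have /cvgr_lt := @continuous_sqnorm2 z0 z; exact.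
Qed.

(** The perturbation d (|z - z0|^2 + |y - c|) serves both alternatives: where G has Laplacian 0 the
    quadratic term makes the Laplacian strictly positive, and on the line y = c the second term
    gives a convex kink. Neither permits an interior maximum. *)
Lemma max_principle G z0 (r c M : R) : 0 < r ->
  {within cdisk z0 r, continuous G} ->
  (forall z, sqnorm2 (z - z0) < r ^+ 2 -> has_laplacian G z 0 \/
     (z.2 = c /\ exists d, is_derive z e2 G d)) ->
  (forall z, sqnorm2 (z - z0) = r ^+ 2 -> G z <= M) ->
  forall z, cdisk z0 r z -> G z <= M.
Proof.
move=> r0 cG hG hM z zD.
(* An upper bound for |z - z0|^2 + |y - c| on the disk, so the perturbation costs at most d B. *)
pose B := r ^+ 2 + (r + `|z0.2 - c|).
have B0 : 0 <= B by rewrite /B !addr_ge0 ?sqr_ge0 // ltW.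
suff H d : 0 < d -> G z <= M + d * B.
  apply/ler_addgt0Pr => e e0.
  have B1 : 0 < B + 1 by rewrite ltr_wpDl.
  apply: le_trans (H (e / (B + 1)) _) _; first by rewrite divr_gt0.
  by rewrite lerD2l mulrAC ler_pdivrMr // ler_pM2l // lerDl.
move=> d0.
pose W w := G w + d * (sqnorm2 (w - z0) + `|w.2 - c|).
have cW : {within cdisk z0 r, continuous W}.
  apply: within_continuousD => //; apply: continuous_subspaceT => w.
  apply: cvgMl_tmp; apply: cvgD; first exact: continuous_sqnorm2.
  by apply: cvg_norm; apply: cvgB; [exact: continuous_snd | exact: cvg_cst].
have [|m mD mmax] := compact_EVT_max _ (compact_cdisk (ltW r0)) cW; first by exists z.
rewrite inE in mD.
have GW : G z <= W z.
  by rewrite /W lerDl; apply: mulr_ge0; [exact: ltW | exact: addr_ge0 (sqnorm2_ge0 _) _].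
apply: le_trans GW (le_trans (mmax z _) _); first by rewrite inE.
have mB : sqnorm2 (m - z0) + `|m.2 - c| <= B.
  rewrite lerD //; have -> : m.2 - c = (m - z0).2 + (z0.2 - c) by rewrite /= addrA subrK.
  apply: le_trans (ler_normD _ _) _; rewrite lerD2r.
  by have [] := abs_sqnorm2 (ltW r0) mD.
have [mb|mi|/hM mM] := ltgtP (sqnorm2 (m - z0)) (r ^+ 2); last first.
- by rewrite lerD // ler_pM2l.
- by move: mD; rewrite /cdisk /= leNgt mi.
exfalso; have Wm : \forall w \near m, W w <= W m.
  by apply: filterS (open_disk_nbhs mb) => w wr; apply: mmax; rewrite inE; exact: ltW.
have [L|[mc [dG hd]]] := hG _ mb.
- (* s (y - c) supports |y - c| from below at m, and is smooth. *)
  pose s := Num.sg (m.2 - c).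
  have L' : has_laplacian (fun w => G w + (d * sqnorm2 (w - z0) + d * s * (w.2 - c))) m (0 + (d * 4 + d * s * 0)).
    apply: has_laplacianD L _; apply: has_laplacianD; apply: has_laplacianZ.
      exact: has_laplacian_sqnorm2.
    exact: has_laplacian_snd.
  have := laplacian_at_max L' _; rewrite mulr0 add0r addr0 => /(_ _) H.
  suff : d * 4 <= 0 by rewrite leNgt mulr_gt0.
  apply: H; apply: filterS Wm => w; rewrite /W.
  have sm : s * (m.2 - c) = `|m.2 - c| by rewrite normrEsg.
  have sw : s * (w.2 - c) <= `|w.2 - c|.
    apply: le_trans (ler_norm _) _; rewrite normrM.
    by rewrite ler_piMl // /s normr_sg; case: (_ != 0).
  move: sw; rewrite -(ler_pM2l d0) -sm -!mulrA; set X := d * (s * _); lra.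
(* On the line, V is the part with a y-derivative and d |y - c| is the kink. *)
- pose V w := G w + d * sqnorm2 (w - z0).
  have hV : is_derive m e2 V (dG + d * (2 * (m.2 - z0.2))).
    apply: is_deriveD => //.
    have D1 v : is_derive m v (fun w => w.1 - z0.1) v.1 by case: (is_derive_coords m z0 v).
    have D2 v : is_derive m v (fun w => w.2 - z0.2) v.2 by case: (is_derive_coords m z0 v).
    have E : (fun w => d * sqnorm2 (w - z0)) = d \*: ((fun w => w.1 - z0.1) * (fun w => w.1 - z0.1)
       + (fun w => w.2 - z0.2) * (fun w => w.2 - z0.2)) by apply/funext => w.
    rewrite E; apply: (is_derive_eq (is_deriveZ d (is_deriveD (is_deriveM (D1 e2) (D1 e2)) (is_deriveM (D2 e2) (D2 e2))))).
    by rewrite /GRing.scale /=; ring.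
  apply: (no_max_at_kink mc hV d0); apply: filterS Wm => w; rewrite /W /V.
  by rewrite mc subrr normr0; lra.
Qed.

End MaximumPrinciple.

(** * Harmonic functions as power series *)

Section Representation.
Context {R : realType}.
Implicit Types (z w : R * R) (u : R * R -> R).

Lemma compact_unif (K : set (R * R)) u : compact K -> {within K, continuous u} ->
  forall e : R, 0 < e -> exists2 d : R, 0 < d &
    forall z w, K z -> K w -> `|z - w| < d -> `|u z - u w| <= e.
Proof.
move=> cK /subspace_continuousP cu e e0.
pose P (d : R) z := forall w, K w -> `|z - w| < d -> `|u z - u w| <= e.
have : \forall d \near (0 : R)^'+, K `<=` P d.
  apply: (near_covering_withinP K).2; first exact/compact_near_coveringP.
  move=> x Kx; have /cvgrPdist_lt/(_ _ (divr_gt0 e0 (ltr0n _ 2))) := cu x Kx.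
  rewrite near_withinE => /nbhs_ballP[r /= r0 B].
  have r20 : 0 < r / 2 by rewrite divr_gt0.
  have nx : \forall z \near x, `|x - z| < r / 2.
    by have := nbhsx_ballx x (r / 2) r20; rewrite -ball_normE.
  near=> z d => Kz w Kw zw.
  have xz : `|x - z| < r / 2 by near: z; exact: nx.
  have dr : d < r / 2 by near: d; exact: nbhs_right_lt.
  have H1 : `|u x - u z| < e / 2.
    apply: B => //; rewrite -ball_normE /=; apply: lt_trans xz _.
    by rewrite ltr_pdivrMr // ltr_pMr // ltr1n.
  have H2 : `|u x - u w| < e / 2.
    apply: B => //; rewrite -ball_normE /= (splitr r).
    rewrite -(subrK z x) -addrA; apply: le_lt_trans (ler_normD _ _) _.
    by rewrite ltrD // (lt_trans zw).
  rewrite -(subrK (u x) (u z)) -addrA; apply: le_trans (ler_normD _ _) _.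
  by rewrite [e]splitr lerD // ltW // distrC.
move=> [d /= d0 H]; exists (d / 2); first by rewrite divr_gt0.
move=> z w Kz Kw zw; apply: (H (d / 2)) => //=; last by rewrite divr_gt0.
by rewrite sub0r normrN gtr0_norm ?divr_gt0 // ltr_pdivrMr // ltr_pMr // ltr1n.
Unshelve. all: by end_near. Qed.

(** The image of an ultrafilter is an ultrafilter, and it converges in the compact interval. One and
    the same G works for every bounded sequence, which replaces a diagonal subsequence. *)
Lemma bounded_ultra_cvg (T : Type) (G : set_system T) (f : T -> R) (C : R) :
  UltraFilter G -> (forall m, `|f m| <= C) -> exists l, `|l| <= C /\ f @ G --> l.
Proof.
move=> GU fC; have PG : ProperFilter G by exact: ultra_proper.
have FU : UltraFilter (f @ G).
  apply: Build_UltraFilter => F' PF sub; rewrite eqEsubset; split=> // B F'B.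
  have [//|GnB] := in_ultra_setVsetC (f @^-1` B) GU.
  have F'nB : F' (~` B) by exact: (sub (~` B) GnB).
  exfalso; apply: (@filter_not_empty _ F' PF).
  by rewrite -(setICr B); exact: filterI.
have : compact `[- C, C]%classic by exact: segment_compact.
rewrite compact_ultra => /(_ (f @ G) FU)[|l [lC fl]].
  suff : G (f @^-1` `[- C, C]%classic) by [].
  by apply: filterE => m /=; rewrite in_itv /= -ler_norml; exact: fC.
by exists l; split=> //; move: lC; rewrite /= in_itv /= -ler_norml.
Qed.

Lemma hsumS (a b : nat -> R) m z :
  hsum a b m.+1 z = hsum a b m z + (a m * rpow m z + b m * ipow m z).
Proof. by rewrite /hsum big_ord_recr. Qed.

Lemma hsum_term_le (a b : nat -> R) (C s : R) k z : 0 <= s -> sqnorm2 z <= s ^+ 2 ->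
  `|a k| <= C -> `|b k| <= C -> `|a k * rpow k z + b k * ipow k z| <= 2 * C * s ^+ k.
Proof.
move=> s0 zs ak bk; have [H1 H2] := pow_bound k s0 zs.
apply: le_trans (ler_normD _ _) _; rewrite !normrM -mulrA mulr_natl mulr2n.
by rewrite lerD // ler_pM.
Qed.

Lemma hsum_tail_le (a b : nat -> R) (C s : R) z : 0 <= s < 1 -> sqnorm2 z <= s ^+ 2 ->
  (forall k, `|a k| <= C /\ `|b k| <= C) ->
  forall p q, (p <= q)%N ->
    `|hsum a b q z - hsum a b p z| <= 2 * C * s ^+ p / (1 - s).
Proof.
move=> /andP[s0 s1] zs ab p q pq.
have C0 : 0 <= C by have [+ _] := ab 0%N; exact: le_trans.
have s1' : 0 < 1 - s by rewrite subr_gt0.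
rewrite ler_pdivlMr //.
(* The sharper bound with s^p - s^q is the one that passes through the induction on q. *)
suff H : `|hsum a b q z - hsum a b p z| * (1 - s) <= 2 * C * (s ^+ p - s ^+ q).
  by apply: le_trans H _; rewrite ler_wpM2l ?mulr_ge0 // gerBl exprn_ge0.
elim: q pq => [|q IH]; first by rewrite leqn0 => /eqP ->; rewrite !subrr normr0 mul0r mulr0.
rewrite leq_eqVlt => /orP[/eqP <-|]; first by rewrite !subrr normr0 mul0r mulr0.
rewrite ltnS => /IH {}IH; rewrite hsumS addrAC.
apply: (@le_trans _ _ ((`|hsum a b q z - hsum a b p z| + 2 * C * s ^+ q) * (1 - s))).
  rewrite ler_pM2r //; apply: le_trans (ler_normD _ _) _; rewrite lerD2l.
  by have [? ?] := ab q; exact: hsum_term_le.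
by rewrite mulrDl exprS; move: IH; set X := `|_|; nra.
Qed.

Lemma continuous_pow k : continuous (@rpow R k) /\ continuous (@ipow R k).
Proof.
elim: k => [|k [H1 H2]].
  by split=> z; rewrite /continuous_at; exact: cvg_cst.
split=> z; rewrite /continuous_at.
  rewrite (_ : rpow k.+1 = (fun w => w.1 * rpow k w - w.2 * ipow k w)); last first.
    by apply/funext => w; rewrite rpowS.
  by apply: cvgB; apply: cvgM; [exact: continuous_fst|exact: H1|exact: continuous_snd|exact: H2].
rewrite (_ : ipow k.+1 = (fun w => w.1 * ipow k w + w.2 * rpow k w)); last first.
  by apply/funext => w; rewrite ipowS.
by apply: cvgD; apply: cvgM; [exact: continuous_fst|exact: H2|exact: continuous_snd|exact: H1].
Qed.

Lemma continuous_hsum (a b : nat -> R) m z0 : continuous (fun z => hsum a b m (z - z0)).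
Proof.
move=> z; rewrite /continuous_at.
have c0 : (fun w => w - z0) @ z --> z - z0 by apply: cvgB; [exact: cvg_id|exact: cvg_cst].
elim: m => [|m IH].
  rewrite (_ : (fun z => _) = cst 0); last by apply/funext => w; rewrite /hsum big_ord0.
  by rewrite /hsum big_ord0; exact: cvg_cst.
rewrite (_ : (fun z => _) = (fun z => hsum a b m (z - z0) +
   (a m * rpow m (z - z0) + b m * ipow m (z - z0)))); last first.
  by apply/funext => w; rewrite hsumS.
rewrite hsumS; apply: cvgD => //; have [H1 H2] := continuous_pow m.
by apply: cvgD; apply: cvgMl_tmp; apply: (cvg_comp _ _ c0); [exact: H1|exact: H2].
Qed.

Lemma sqnorm2Z (r : R) z : sqnorm2 (r *: z) = r ^+ 2 * sqnorm2 z.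
Proof. by rewrite /sqnorm2 /= /GRing.scale /=; ring. Qed.

Lemma powZ (r : R) k z : rpow k (r *: z) = r ^+ k * rpow k z /\
  ipow k (r *: z) = r ^+ k * ipow k z.
Proof.
elim: k => [|k [H1 H2]]; first by rewrite !rpow0 !ipow0 expr0 mul1r mulr0.
by rewrite !rpowS !ipowS H1 H2 exprS /= /GRing.scale /=; split; ring.
Qed.

Lemma hsumZ (a b : nat -> R) m (r : R) z :
  hsum a b m (r *: z) = hsum (fun k => a k * r ^+ k) (fun k => b k * r ^+ k) m z.
Proof.
by apply: eq_bigr => k _; have [-> ->] := powZ r k z; rewrite !mulrA.
Qed.

Lemma max_principle_norm u (a b : nat -> R) m z0 (r c M : R) : 0 < r ->
  {within cdisk z0 r, continuous u} ->
  (forall z, sqnorm2 (z - z0) < r ^+ 2 -> has_laplacian u z 0 \/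
     (z.2 = c /\ exists d, is_derive z e2 u d)) ->
  (forall z, sqnorm2 (z - z0) = r ^+ 2 -> `|u z - hsum a b m (z - z0)| <= M) ->
  forall z, cdisk z0 r z -> `|u z - hsum a b m (z - z0)| <= M.
Proof.
move=> r0 cu hu uM.
pose h z := hsum a b m (z - z0).
have ch : {within cdisk z0 r, continuous h}.
  by apply: continuous_subspaceT; exact: continuous_hsum.
have lh z (k : R) : has_laplacian (fun w => k * h w) z 0.
  by rewrite -[0](mulr0 k); apply: has_laplacianZ; exact: has_laplacian_hsum.
have dh z : exists d, is_derive z e2 h d.
  by have [_ [uy [_ [_ [_ _ /nbhs_singleton H _ _]]]]] := has_laplacian_hsum a b m z z0; exists (uy z).
move=> z zD; rewrite ler_norml; apply/andP; split.
  rewrite lerNl opprB.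
  apply: (@max_principle _ (h - u) z0 r c M) => //.
  - exact: within_continuousB.
  - move=> w /hu[L|[wc [d Hd]]]; [left|right].
      have -> : h - u = (fun w => 1 * h w) \+ (fun w => -1 * u w).
        by apply/funext => x /=; rewrite mul1r mulN1r.
      by rewrite -[0]addr0; apply: has_laplacianD (lh _ _) _;
         rewrite -[0](mulr0 (-1)); exact: has_laplacianZ.
    by split=> //; have [d' ?] := dh w; exists (d' - d); exact: is_deriveB.
  - by move=> w /uM; rewrite ler_norml => /andP[+ _]; rewrite lerNl opprB.
apply: (@max_principle _ (u - h) z0 r c M) => //.
- exact: within_continuousB.
- move=> w /hu[L|[wc [d Hd]]]; [left|right].
    have -> : u - h = u \+ (fun w => -1 * h w).
      by apply/funext => x /=; rewrite mulN1r.
    by rewrite -[0]addr0; exact: has_laplacianD.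
  by split=> //; have [d' ?] := dh w; exists (d - d'); exact: is_deriveB.
- by move=> w /uM; rewrite ler_norml => /andP[_ +].
Qed.

End Representation.

Section HarmonicRepresentation.
Context {R : realType}.
Implicit Types (z w : R * R) (u : R * R -> R).

Definition coef_bound (r : R) (a b : nat -> R) : Prop :=
  exists K : R, forall k, `|a k| * r ^+ k <= K /\ `|b k| * r ^+ k <= K.

Lemma harmonic_rep u z0 (r c : R) : 0 < r ->
  {within cdisk z0 r, continuous u} ->
  (forall z, sqnorm2 (z - z0) < r ^+ 2 -> has_laplacian u z 0 \/
     (z.2 = c /\ exists d, is_derive z e2 u d)) ->
  exists a b, coef_bound r a b /\
    forall z, sqnorm2 z < r ^+ 2 ->
      (fun m => hsum a b m z) @ \oo --> u (z0 + z).
Proof.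
move=> r0 cu hu; have rn0 : r != 0 by rewrite gt_eqF.
pose f w := u (z0 + r *: w).
have fD w : sqnorm2 w = 1 -> cdisk z0 r (z0 + r *: w).
  by move=> w1; rewrite /cdisk /= addrC addKr sqnorm2Z w1 mulr1.
have cK := @compact_cdisk _ z0 _ (ltW r0).
have [M fM] : exists M, forall w, sqnorm2 w = 1 -> `|f w| <= M.
  have ca : {within cdisk z0 r, continuous (fun z => `|u z|)}.
    by move=> z; apply: cvg_norm; exact: cu.
  have [|m _ mP] := compact_EVT_max _ cK ca.
    by exists z0; rewrite /cdisk /= subrr /sqnorm2 /= !expr0n /= addr0 exprn_ge0 // ltW.
  by exists `|u m| => w /fD wD; apply: mP; rewrite inE.
have M0 : 0 <= M.
  by apply: le_trans (fM (1, 0) _) => //; rewrite /sqnorm2 /= expr1n expr0n /= addr0.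
have fu (e : R) : 0 < e -> exists2 d : R, 0 < d & forall z w, sqnorm2 z = 1 ->
     sqnorm2 w = 1 -> sqnorm2 (z - w) < d -> `|f z - f w| <= e.
  move=> e0; have [d d0 dP] := compact_unif cK cu e0.
  (* Scaling by r turns this squared Euclidean distance into (d / 2)^2, which keeps both
     coordinates, hence the sup norm, within d / 2. *)
  exists ((d / 2 / r) ^+ 2); first by rewrite exprn_gt0 // !divr_gt0.
  move=> z w z1 w1 zw; apply: dP; [exact: fD|exact: fD|].
  rewrite opprD addrACA subrr add0r -scalerBr.
  have : sqnorm2 (r *: (z - w)) <= (d / 2) ^+ 2.
    rewrite sqnorm2Z mulrC -ler_pdivlMr ?exprn_gt0 // -expr_div_n; exact: ltW.
  move=> /abs_sqnorm2[|H1 H2]; first by rewrite ltW // divr_gt0.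
  apply: (@le_lt_trans _ _ (d / 2)); last by rewrite ltr_pdivrMr // ltr_pMr // ltr1n.
  by rewrite prod_normE ge_max H1 H2.
have [A [B [AB HM]]] := trig_approx fM fu.
have [G [GU sG]] := @ultraFilterLemma nat \oo _.
have PG : ProperFilter G by exact: ultra_proper.
have [al alP] := choice (fun k => bounded_ultra_cvg GU (fun m => (AB m k).1)).
have [be beP] := choice (fun k => bounded_ultra_cvg GU (fun m => (AB m k).2)).
exists (fun k => al k / r ^+ k), (fun k => be k / r ^+ k); split.
  exists (2 * M) => k; have rk : 0 < r ^+ k by rewrite exprn_gt0.
  rewrite !normf_div !(ger0_norm (ltW rk)) !divfK ?gt_eqF //.
  by have [[? _] [? _]] := (alP k, beP k).
move=> z zr; pose w := r^-1 *: z.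
have rw : r *: w = z by rewrite /w scalerA divff // scale1r.
have Er m : hsum (fun k => al k / r ^+ k) (fun k => be k / r ^+ k) m z = hsum al be m w.
  by rewrite -rw hsumZ; apply: eq_bigr => k _; rewrite !divfK // expf_neq0.
under eq_fun do rewrite Er.
pose s := Num.sqrt (sqnorm2 w).
have s0 : 0 <= s by exact: sqrtr_ge0.
have ws : sqnorm2 w = s ^+ 2 by rewrite sqr_sqrtr // sqnorm2_ge0.
have s1 : s < 1.
  rewrite -(ltr_pXn2r (n := 2)) ?nnegrE // -ws expr1n /w sqnorm2Z.
  by rewrite exprVn mulrC ltr_pdivrMr ?exprn_gt0 // mul1r.
(* For given p and e a single index m suffices: u is compared with the m-th approximant by the
   maximum principle, the approximant with its truncation at p by the geometric tail, and that
   truncation with the one of the limit coefficients by convergence along G. *)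
have main (e : R) p : 0 < e -> `|u (z0 + z) - hsum al be p w| <= e + e + 2 * (2 * M) * s ^+ p / (1 - s).
  move=> e0.
  have N1 : \forall m \near G, `|hsum (A m) (B m) p w - hsum al be p w| < e.
    have : (fun m => hsum (A m) (B m) p w) @ G --> hsum al be p w.
      elim: (p) => [|q IH].
        rewrite /hsum big_ord0; under eq_fun do rewrite big_ord0; exact: cvg_cst.
      rewrite hsumS; under eq_fun do rewrite hsumS.
      apply: cvgD IH _; apply: cvgD; apply: cvgMr_tmp.
        by have [] := alP q.
      by have [] := beP q.
    by move=> /cvgrPdist_lt/(_ e e0); apply: filterS => m; rewrite distrC.
  have N2 : \forall m \near G, forall z, sqnorm2 z = 1 ->
      `|f z - hsum (A m) (B m) m.+1 z| <= e by exact: (sG _ (HM e e0)).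
  have N3 : \forall m \near G, (p <= m.+1)%N.
    by apply: sG; exists p => // m /= pm; exact: leqW.
  have [m [m1 m2 m3]] : exists m, [/\ `|hsum (A m) (B m) p w - hsum al be p w| < e,
      (forall z, sqnorm2 z = 1 -> `|f z - hsum (A m) (B m) m.+1 z| <= e) & (p <= m.+1)%N].
    have [m []] := @filter_ex _ G PG _ (filterI N1 (filterI N2 N3)).
    by move=> ? [? ?]; exists m.
  (* The approximants live on the unit circle; this moves them to the circle of radius r, where the
     maximum principle is applied. *)
  have E m' w' : hsum (A m) (B m) m' w' = hsum (fun k => A m k * r^-1 ^+ k) (fun k => B m k * r^-1 ^+ k) m' (r *: w').
    rewrite hsumZ; apply: eq_bigr => k _.
    by rewrite !exprVn !divfK // expf_neq0.
  have U : `|u (z0 + z) - hsum (A m) (B m) m.+1 w| <= e.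
    rewrite E rw; have -> : hsum (fun k => A m k * r^-1 ^+ k) (fun k => B m k * r^-1 ^+ k) m.+1 z
      = hsum (fun k => A m k * r^-1 ^+ k) (fun k => B m k * r^-1 ^+ k) m.+1 (z0 + z - z0).
      by rewrite addrC addKr.
    apply: (max_principle_norm r0 cu hu) => [x xr|].
      pose y := r^-1 *: (x - z0).
      have ry : r *: y = x - z0 by rewrite /y scalerA divff // scale1r.
      have y1 : sqnorm2 y = 1 by rewrite /y sqnorm2Z xr exprVn mulVf // expf_neq0.
      by rewrite -ry -E; have := m2 y y1; rewrite /f ry [z0 + _]addrC subrK.
    by rewrite /cdisk /= addrC addKr ltW.
  have T : `|hsum (A m) (B m) m.+1 w - hsum (A m) (B m) p w| <= 2 * (2 * M) * s ^+ p / (1 - s).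
    by apply: hsum_tail_le => //; [rewrite s0 | rewrite ws].
  move: U T m1; set x1 := hsum (A m) (B m) m.+1 w; set x2 := hsum (A m) (B m) p w.
  set x3 := hsum al be p w; set x0 := u _; set t := _ / _ => U T m1.
  have -> : x0 - x3 = (x0 - x1) + (x1 - x2) + (x2 - x3) by ring.
  apply: le_trans (ler_normD _ _) _; apply: le_trans (lerD (ler_normD _ _) (lexx _)) _.
  by move: U T (ltW m1); lra.
have main' p : `|u (z0 + z) - hsum al be p w| <= 2 * (2 * M) * s ^+ p / (1 - s).
  apply/ler_addgt0Pr => e e0.
  by apply: le_trans (main (e / 2) p _) _; [rewrite divr_gt0 | rewrite -splitr addrC].
apply/cvgrPdist_le => e e0.
have : (fun p => 2 * (2 * M) * s ^+ p / (1 - s)) @ \oo --> 0 * (1 - s)^-1.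
  apply: cvgMr_tmp; rewrite -[X in _ --> X](mulr0 (2 * (2 * M))); apply: cvgMl_tmp.
  by apply: cvg_expr; rewrite ger0_norm.
rewrite mul0r => /cvgrPdist_le/(_ e e0); apply: filterS => p.
rewrite sub0r normrN => H; apply: le_trans (main' p) (le_trans (ler_norm _) H).
Qed.

End HarmonicRepresentation.

(** * Calculus of power series *)

Section PowerSeries.
Context {R : realType}.
Implicit Types (z w : R * R) (a b : nat -> R) (r s : R).

(* The real part of the sum of the c_k z^k, with c_k = a_k - i b_k; a
   junk value when the series diverges. *)
Definition pser a b z : R := lim (hsum a b ^~ z @ \oo).

(** The bounds are asked at every radius below r rather than at r itself: in this form the condition
    survives termwise differentiation. *)
Definition pconv r a b : Prop := forall s, 0 < s < r -> coef_bound s a b.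

Lemma coef_bound_pconv r a b : coef_bound r a b -> pconv r a b.
Proof.
move=> [K HK] s /andP[s0 sr]; exists K => k.
have H x : `|x| * r ^+ k <= K -> `|x| * s ^+ k <= K.
  by apply: le_trans; rewrite ler_wpM2l // lerXn2r ?nnegrE ?(ltW s0) ?(ltW (lt_trans s0 sr)) // ltW.
by have [/H ? /H ?] := HK k.
Qed.

Lemma pconv_muln r a b : pconv r a b ->
  pconv r (fun k => k%:R * a k) (fun k => k%:R * b k).
Proof.
(* The bound at the intermediate radius s' leaves a factor (s / s')^k to absorb k. *)
move=> H s /andP[s0 sr]; pose s' := (s + r) / 2.
have ss' : s < s' by rewrite /s'; lra.
have s'r : s' < r by rewrite /s'; lra.
have s'0 : 0 < s' by apply: lt_trans ss'.
have [|K HK] := H s'; first by rewrite s'0.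
pose t := s / s'; have t01 : 0 <= t < 1.
  by rewrite /t divr_ge0 ?(ltW s0) ?(ltW s'0) //= ltr_pdivrMr // mul1r.
exists (K * (1 - t)^-1) => k.
have E x : `|x| * s' ^+ k <= K -> `|k%:R * x| * s ^+ k <= K * (1 - t)^-1.
  move=> xK; rewrite normrM normr_nat.
  have -> : s ^+ k = s' ^+ k * t ^+ k by rewrite -exprMn mulrC /t divfK // gt_eqF.
  have -> : k%:R * `|x| * (s' ^+ k * t ^+ k) = (`|x| * s' ^+ k) * (k%:R * t ^+ k) by ring.
  apply: ler_pM => //; last exact: mulrn_geom_le.
    by rewrite mulr_ge0 // exprn_ge0 // ltW.
  by rewrite mulr_ge0 // exprn_ge0 //; case/andP: t01.
by have [/E ? /E ?] := HK k.
Qed.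

Definition dcoef a : nat -> R := fun k => k.+1%:R * a k.+1.

Lemma pconv_dcoef r a b : pconv r a b -> pconv r (dcoef a) (dcoef b).
Proof.
move=> /pconv_muln H s sr; have /andP[s0 _] := sr; have [K HK] := H s sr.
exists (K / s) => k; rewrite !ler_pdivlMr // -!mulrA -!exprSr; exact: HK.
Qed.

(** The passage from (a, b) to (b, -a) multiplies a_k - i b_k by i. Applied to [dcoef] it describes
    the y-derivative, because d/dy of Re F is Re (i F'). *)
Lemma pconv_rot r a b : pconv r a b -> pconv r b (fun k => - a k).
Proof.
move=> H s sr; have [K HK] := H s sr; exists K => k.
by rewrite normrN; have [] := HK k.
Qed.

Lemma hsum_scale a b s m z : s != 0 ->
  hsum a b m z = hsum (fun k => a k * s ^+ k) (fun k => b k * s ^+ k) m (s^-1 *: z).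
Proof. by move=> s0; rewrite -hsumZ scalerA divff // scale1r. Qed.

Lemma mid_radius r z : 0 < r -> sqnorm2 z < r ^+ 2 ->
  exists s, 0 < s < r /\ sqnorm2 z < s ^+ 2.
Proof.
move=> r0 zr; pose t := Num.sqrt (sqnorm2 z).
have zt : sqnorm2 z = t ^+ 2 by rewrite sqr_sqrtr // sqnorm2_ge0.
have t0 : 0 <= t by exact: sqrtr_ge0.
have tr : t < r by rewrite -(ltr_pXn2r (n := 2)) ?nnegrE ?(ltW r0) // -zt.
exists ((t + r) / 2); rewrite zt; split; first by apply/andP; split; lra.
by rewrite ltr_pXn2r ?nnegrE //; lra.
Qed.

Lemma pser_cvg r a b z : 0 < r -> pconv r a b -> sqnorm2 z < r ^+ 2 ->
  hsum a b ^~ z @ \oo --> pser a b z.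
Proof.
move=> r0 Hab zr; have [s [sr zs]] := mid_radius r0 zr; have /andP[s0 _] := sr.
have [K HK] := Hab s sr; have sn0 : s != 0 by rewrite gt_eqF.
pose w := s^-1 *: z; pose t := Num.sqrt (sqnorm2 w).
have wt : sqnorm2 w = t ^+ 2 by rewrite sqr_sqrtr // sqnorm2_ge0.
have t0 : 0 <= t by exact: sqrtr_ge0.
have t1 : t < 1.
  rewrite -(ltr_pXn2r (n := 2)) ?nnegrE // -wt expr1n /w sqnorm2Z.
  by rewrite exprVn mulrC ltr_pdivrMr ?exprn_gt0 // mul1r.
have tail p q : (p <= q)%N -> `|hsum a b q z - hsum a b p z| <= 2 * K * t ^+ p / (1 - t).
  move=> pq; rewrite !(hsum_scale a b _ z sn0).
  apply: hsum_tail_le => //; [by rewrite t0 | by rewrite -wt |] => k.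
  by rewrite !normrM !(ger0_norm (exprn_ge0 k (ltW s0))).
have c0 : (fun p => 2 * K * t ^+ p / (1 - t)) @ \oo --> (0 : R).
  rewrite -[X in _ --> X](mul0r (1 - t)^-1); apply: cvgMr_tmp.
  rewrite -[X in _ --> X](mulr0 (2 * K)); apply: cvgMl_tmp.
  by apply: cvg_expr; rewrite ger0_norm.
apply: (@cauchy_cvg R); apply/cauchyP => e e0.
have /cvgrPdist_lt/(_ e e0)[N _ HN] := c0.
exists (hsum a b N z); exists N => // m /= Nm.
rewrite -ball_normE /= distrC; apply: le_lt_trans (tail _ _ Nm) _.
have := HN N (leqnn N); rewrite /= sub0r normrN; exact: le_lt_trans (ler_norm _).
Qed.

Definition cf a b k : R[i] := Complex (a k) (- b k).

Arguments cf : simpl never.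

Lemma cf_term a b k z : a k * rpow k z + b k * ipow k z = complex.Re (cf a b k * cpx z ^+ k).
Proof. by rewrite /rpow /ipow /cf; case: (cpx z ^+ k) => x y /=; rewrite mulNr opprK. Qed.

Definition taylor_err k z w : R[i] :=
  cpx z ^+ k - cpx w ^+ k - k%:R * cpx w ^+ k.-1 * (cpx z - cpx w).

Arguments taylor_err : simpl never.

Lemma taylor_errS k z w : taylor_err k.+1 z w =
  cpx z * taylor_err k z w + k%:R * cpx w ^+ k.-1 * (cpx z - cpx w) ^+ 2.
Proof.
rewrite /taylor_err; case: k => [|k] /=; first by rewrite !expr1 !expr0; ring.
by rewrite -[k.+2%:R]natr1 !exprS; ring.
Qed.

Lemma normc_ge0 (x : R[i]) : 0 <= normc x.
Proof. by case: x => a b; exact: sqrtr_ge0. Qed.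

Lemma normc_Re (x : R[i]) : `|complex.Re x| <= normc x.
Proof.
case: x => a b /=; rewrite -(ler_pXn2r (n := 2)) ?nnegrE ?sqrtr_ge0 //.
by rewrite sqr_sqrtr ?addr_ge0 ?sqr_ge0 // real_normK ?num_real // lerDl sqr_ge0.
Qed.

Lemma normcX (x : R[i]) k : normc (x ^+ k) = normc x ^+ k.
Proof. by elim: k => [|k IH]; rewrite ?expr0 ?normc1 // !exprS normcM IH. Qed.

Lemma normc_nat k : normc (k%:R : R[i]) = k%:R.
Proof. by rewrite normcMn normc1. Qed.

Lemma normc_cpx s z : 0 <= s -> sqnorm2 z <= s ^+ 2 -> normc (cpx z) <= s.
Proof.
move=> s0 zs; rewrite -(ler_pXn2r (n := 2)) ?nnegrE ?normc_ge0 //.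
by rewrite /normc /= sqr_sqrtr // addr_ge0 ?sqr_ge0.
Qed.

(** The factor s^2 on the left avoids an exponent k - 2, and the generous constant k^2 makes the
    induction close: k^2 + k <= (k + 1)^2. *)
Lemma taylor_err_le k s z w : 0 < s -> sqnorm2 z <= s ^+ 2 -> sqnorm2 w <= s ^+ 2 ->
  normc (taylor_err k z w) * s ^+ 2 <= k%:R ^+ 2 * s ^+ k * sqnorm2 (z - w).
Proof.
move=> s0 zs ws; have nz := normc_cpx (ltW s0) zs; have nw := normc_cpx (ltW s0) ws.
have nh : normc (cpx z - cpx w) ^+ 2 = sqnorm2 (z - w).
  by rewrite /normc /= sqr_sqrtr // addr_ge0 ?sqr_ge0.
elim: k => [|k IH].
  by rewrite /taylor_err !expr0 subrr mul0r mul0r subrr normc0 mul0r expr0n /= !mul0r.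
set H := sqnorm2 _ in IH *; have H0 : 0 <= H by exact: sqnorm2_ge0.
have P1 : normc (taylor_err k.+1 z w) <= s * normc (taylor_err k z w) + k%:R * normc (cpx w) ^+ k.-1 * H.
  rewrite taylor_errS; apply: le_trans (le_normcD _ _) _.
  rewrite !normcM !normcX normc_nat -expr2 nh lerD2r ler_wpM2r ?normc_ge0 //.
apply: le_trans (ler_wpM2r _ P1) _; first by rewrite exprn_ge0 // ltW.
have P2 : k%:R * normc (cpx w) ^+ k.-1 * s ^+ 2 <= k%:R * s ^+ k.+1 :> R.
  case: (k) => [|j] /=; first by rewrite !mul0r.
  rewrite [s ^+ j.+2](_ : _ = s ^+ j * s ^+ 2); last by rewrite -exprD addn2.
  rewrite mulrA ler_wpM2r ?exprn_ge0 ?(ltW s0) // ler_wpM2l //.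
  by apply: lerXn2r; rewrite ?nnegrE ?normc_ge0 ?(ltW s0).
have sk : 0 <= s ^+ k by rewrite exprn_ge0 // ltW.
have P3 : s * normc (taylor_err k z w) * s ^+ 2 <= s * (k%:R ^+ 2 * s ^+ k * H).
  by rewrite -mulrA ler_wpM2l // ltW.
rewrite mulrDl; apply: le_trans (lerD P3 _) _.
  rewrite mulrAC; exact: ler_wpM2r P2.
rewrite -natr1 [s ^+ k.+1]exprS.
have k0 : 0 <= k%:R :> R by [].
have X : 0 <= s * s ^+ k * H by rewrite !mulr_ge0 // ltW.
have -> : (k%:R + 1) ^+ 2 * (s * s ^+ k) * H = (k%:R ^+ 2 + 2 * k%:R + 1) * (s * s ^+ k * H) :> R by ring.
have -> : s * (k%:R ^+ 2 * s ^+ k * H) + k%:R * (s * s ^+ k) * H = (k%:R ^+ 2 + k%:R) * (s * s ^+ k * H) :> R by ring.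
by rewrite ler_wpM2r //; lra.
Qed.

Lemma hsum_taylor a b m z w :
  hsum a b m.+1 z - hsum a b m.+1 w - (z.1 - w.1) * hsum (dcoef a) (dcoef b) m w
   - (z.2 - w.2) * hsum (dcoef b) (fun k => - dcoef a k) m w
  = \sum_(k < m.+1) complex.Re (cf a b k * taylor_err k z w).
Proof.
elim: m => [|m IH].
  rewrite /hsum !big_ord0 !big_ord1 /= /taylor_err /cf /=.
  by ring.
rewrite big_ord_recr -IH /= 2!(hsumS a b m.+1).
rewrite (hsumS (dcoef a) (dcoef b) m) (hsumS (dcoef b) _ m).
set A := hsum a b m.+1 z; set B := hsum a b m.+1 w.
have -> : complex.Re (cf a b m.+1 * taylor_err m.+1 z w) =
   (a m.+1 * rpow m.+1 z + b m.+1 * ipow m.+1 z) - (a m.+1 * rpow m.+1 w + b m.+1 * ipow m.+1 w)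
   - m.+1%:R * (a m.+1 * ((z.1 - w.1) * rpow m w - (z.2 - w.2) * ipow m w)
     + b m.+1 * ((z.1 - w.1) * ipow m w + (z.2 - w.2) * rpow m w)).
  rewrite !cf_term /taylor_err !mulrBr /=.
  have Rsub (x y : R[i]) : complex.Re (x - y) = complex.Re x - complex.Re y by case: x y => ? ? [? ?].
  rewrite !Rsub; congr (_ - _ - _).
  rewrite /rpow /ipow /cf /=; have nE : (m.+1%:R : R[i]) = Complex m.+1%:R 0 by rewrite -(rmorph_nat (real_complex R)).
  rewrite nE /cpx; case: (_ ^+ m) => x y /=; ring.
rewrite /dcoef; ring.
Qed.

Lemma hsum_taylor_le r a b s : pconv r a b -> 0 < s < r -> exists C, forall m z w,
  sqnorm2 z <= s ^+ 2 -> sqnorm2 w <= s ^+ 2 ->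
  `|hsum a b m.+1 z - hsum a b m.+1 w - (z.1 - w.1) * hsum (dcoef a) (dcoef b) m w
   - (z.2 - w.2) * hsum (dcoef b) (fun k => - dcoef a k) m w| <= C * sqnorm2 (z - w).
Proof.
move=> Hab /andP[s0 sr]; pose s' := (s + r) / 2.
have ss' : s < s' by rewrite /s'; lra.
have s'r : s' < r by rewrite /s'; lra.
have s'0 : 0 < s' by apply: lt_trans ss'.
(* One use for each factor k of the k^2 in [taylor_err_le]. What remains is a geometric series of
   ratio t = s / s'. *)
have [|K HK] := pconv_muln (pconv_muln Hab) (s := s'); first by rewrite s'0.
have K0 : 0 <= K by have [+ _] := HK 0%N; apply: le_trans; rewrite mulr_ge0.
pose t := s / s'; have t0 : 0 <= t by rewrite divr_ge0 // ltW.
have t1 : t < 1 by rewrite ltr_pdivrMr // mul1r.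
exists (2 * K / (1 - t) / s ^+ 2) => m z w zs ws; rewrite hsum_taylor.
set H := sqnorm2 _; have H0 : 0 <= H by exact: sqnorm2_ge0.
have s20 : 0 < s ^+ 2 by rewrite exprn_gt0.
apply: le_trans (ler_norm_sum _ _ _) _.
have E k : `|complex.Re (cf a b k * taylor_err k z w)| <= 2 * K * t ^+ k * (H / s ^+ 2).
  apply: le_trans (normc_Re _) _; rewrite normcM.
  rewrite [leRHS]mulrA ler_pdivlMr // -[leLHS]mulrA.
  apply: le_trans (ler_wpM2l (normc_ge0 _) (taylor_err_le k s0 zs ws)) _.
  rewrite -/H [leLHS]mulrA ler_wpM2r //.
  have -> : s ^+ k = s' ^+ k * t ^+ k by rewrite -exprMn mulrC /t divfK // gt_eqF.
  rewrite !mulrA ler_wpM2r ?exprn_ge0 //.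
  have nc : normc (cf a b k) <= `|a k| + `|b k|.
    rewrite -(ler_pXn2r (n := 2)) ?nnegrE ?normc_ge0 ?addr_ge0 //.
    rewrite /= sqr_sqrtr ?addr_ge0 ?sqr_ge0 // sqrrN sqrrD -!normrX !(ger0_norm (sqr_ge0 _)).
    by rewrite addrAC lerDl mulrn_wge0 // mulr_ge0.
  have [Ha Hb] := HK k.
  move: Ha Hb; rewrite !normrM !normr_nat => Ha Hb.
  have s'k : 0 <= s' ^+ k by rewrite exprn_ge0 // ltW.
  rewrite -!mulrA; apply: le_trans (ler_wpM2r _ nc) _; first by rewrite !mulr_ge0.
  by move: Ha Hb; set n := k%:R; set A := `|a k|; set B := `|b k|; set S := _ ^+ k; nra.
apply: le_trans (ler_sum _ (fun (i : 'I_m.+1) _ => E i)) _.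
rewrite -mulr_suml -mulr_sumr.
have S1 : \sum_(i < m.+1) t ^+ i <= (1 - t)^-1.
  have t1' : 0 < 1 - t by rewrite subr_gt0.
  rewrite -[leRHS]div1r ler_pdivlMr //.
  have := subrX1 t m.+1 => /(congr1 -%R); rewrite opprB -mulNr opprB mulrC => <-.
  by rewrite gerBl exprn_ge0.
have -> : 2 * K / (1 - t) / s ^+ 2 * H = 2 * K * (1 - t)^-1 * (H / s ^+ 2) by ring.
rewrite ler_wpM2r ?divr_ge0 ?(ltW s20) // ler_wpM2l // mulr_ge0 //.
Qed.

End PowerSeries.

Section PowerSeriesCalculus.
Context {R : realType}.
Implicit Types (z w : R * R) (a b : nat -> R) (r s : R) (u F : R * R -> R).

Lemma cvg_le_bound (f : nat -> R) (l C : R) :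
  f @ \oo --> l -> (forall m, f m <= C) -> l <= C.
Proof.
move=> fl fC; rewrite -(cvg_lim (@Rhausdorff R) fl).
by apply: limr_le; [exact: cvgP fl | near=> m].
Unshelve. all: by end_near. Qed.

Lemma cvg_affine4 (f1 f2 f3 f4 : nat -> R) (l1 l2 l3 l4 x y : R) :
  f1 @ \oo --> l1 -> f2 @ \oo --> l2 -> f3 @ \oo --> l3 -> f4 @ \oo --> l4 ->
  (fun m => `|f1 m - f2 m - x * f3 m - y * f4 m|) @ \oo -->
    `|l1 - l2 - x * l3 - y * l4|.
Proof.
move=> c1 c2 c3 c4; apply: cvg_norm; apply: cvgB; last exact: cvgMl_tmp c4.
by apply: cvgB; [exact: cvgB c1 c2 | exact: cvgMl_tmp c3].
Qed.

Lemma pser_taylor r a b s : 0 < r -> pconv r a b -> 0 < s < r -> exists C, forall z w,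
  sqnorm2 z <= s ^+ 2 -> sqnorm2 w <= s ^+ 2 ->
  `|pser a b z - pser a b w - (z.1 - w.1) * pser (dcoef a) (dcoef b) w
   - (z.2 - w.2) * pser (dcoef b) (fun k => - dcoef a k) w| <= C * sqnorm2 (z - w).
Proof.
move=> r0 Hab sr; have [C HC] := hsum_taylor_le Hab sr; exists C => z w zs ws.
have /andP[s0 s1] := sr.
have s2r2 : s ^+ 2 < r ^+ 2 by rewrite ltr_pXn2r // nnegrE ltW.
have zr := le_lt_trans zs s2r2; have wr := le_lt_trans ws s2r2.
have Hd := pconv_dcoef Hab; have Hd' := pconv_rot Hd.
have c1 : (fun m => hsum a b m.+1 z) @ \oo --> pser a b z.
  by have := pser_cvg r0 Hab zr; rewrite -(cvg_shiftS (hsum a b ^~ z)).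
have c2 : (fun m => hsum a b m.+1 w) @ \oo --> pser a b w.
  by have := pser_cvg r0 Hab wr; rewrite -(cvg_shiftS (hsum a b ^~ w)).
have c3 := pser_cvg r0 Hd wr; have c4 := pser_cvg r0 Hd' wr.
have cn := cvg_affine4 (x := z.1 - w.1) (y := z.2 - w.2) c1 c2 c3 c4.
by apply: (cvg_le_bound cn) => m; exact: HC.
Qed.

Definition sdiff F z (A B : R) : Prop := forall e : R, 0 < e ->
  \forall w \near z, `|F w - F z - (w.1 - z.1) * A - (w.2 - z.2) * B| <= e * `|w - z|.

Lemma sqnorm2_le_norm z : sqnorm2 z <= 2 * `|z| ^+ 2.
Proof.
have H1 : `|z.1| <= `|z| by rewrite prod_normE le_max lexx.
have H2 : `|z.2| <= `|z| by rewrite prod_normE le_max lexx orbT.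
rewrite /sqnorm2 mulr_natl mulr2n lerD // -real_normK ?num_real //;
  by apply: lerXn2r; rewrite ?nnegrE.
Qed.

Lemma near_norm_lt z (d : R) : 0 < d -> \forall w \near z, `|w - z| < d.
Proof.
move=> d0; have := nbhsx_ballx z d d0; rewrite -ball_normE /=.
by apply: filterS => w; rewrite /= distrC.
Qed.

Lemma sdiff_quad F z A B C :
  (\forall w \near z, `|F w - F z - (w.1 - z.1) * A - (w.2 - z.2) * B| <= C * sqnorm2 (w - z)) ->
  sdiff F z A B.
Proof.
move=> H e e0; pose D := `|C| + 1; have D0 : 0 < D by rewrite ltr_wpDl.
have d0 : 0 < e / (2 * D) by rewrite divr_gt0 // mulr_gt0.
near=> w; apply: (@le_trans _ _ (C * sqnorm2 (w - z))); first by near: w.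
have wz : `|w - z| < e / (2 * D) by near: w; exact: near_norm_lt.
apply: (@le_trans _ _ (D * (2 * `|w - z| ^+ 2))).
  apply: le_trans (ler_norm _) _; rewrite normrM ler_pM //.
    by rewrite /D lerDl.
  by rewrite ger0_norm ?sqnorm2_ge0 // sqnorm2_le_norm.
rewrite expr2 !mulrA ler_wpM2r // mulrC [D * 2]mulrC.
by rewrite -ler_pdivlMr ?mulr_gt0 // ltW.
Unshelve. all: by end_near. Qed.

Lemma sdiff_line F z A B (x y : R) : sdiff F z A B ->
  is_derive z (x, y) F (x * A + y * B).
Proof.
move=> H.
have Hc : (fun h : R => h^-1 *: ((F \o shift z) (h *: (x, y)) - F z)) @ 0^' --> x * A + y * B.
  apply/cvgrPdist_le => e e0.
  pose N := `|((x, y) : R * R)| + 1; have N0 : 0 < N by rewrite ltr_wpDl.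
  have cL : (fun h : R => h *: ((x, y) : R * R) + z) @ 0 --> z.
    have {2}-> : z = 0 *: ((x, y) : R * R) + z by rewrite scale0r add0r.
    by apply: cvgD; [apply: cvgZr_tmp; exact: cvg_id | exact: cvg_cst].
  have Hn : \forall h \near 0^',
      `|F (h *: (x, y) + z) - F z - ((h *: (x, y) + z).1 - z.1) * A
      - ((h *: (x, y) + z).2 - z.2) * B| <= e / N * `|h *: (x, y) + z - z|.
    by apply: cvg_within; exact: (cL _ (H (e / N) (divr_gt0 e0 N0))).
  near=> h; have h0 : h != 0 by near: h; exact: nbhs_dnbhs_neq.
  have : `|F (h *: (x, y) + z) - F z - ((h *: (x, y) + z).1 - z.1) * A
      - ((h *: (x, y) + z).2 - z.2) * B| <= e / N * `|h *: (x, y) + z - z| by near: h.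
  rewrite addrK /= !addrK normrZ /GRing.scale /= => Hh.
  have -> : x * A + y * B - h^-1 * (F (h *: (x, y) + z) - F z) =
     - h^-1 * (F (h *: (x, y) + z) - F z - h * x * A - h * y * B) by field.
  rewrite normrM normrN normfV [leLHS]mulrC ler_pdivrMr ?normr_gt0 //.
  apply: le_trans Hh _; rewrite mulrA mulrAC ler_wpM2r //.
  by rewrite mulrAC ler_pdivrMr // ler_pM2l // /N lerDl.
by split; [apply/cvg_ex; exists (x * A + y * B) | apply/cvg_lim].
Unshelve. all: by end_near. Qed.

Lemma sdiff_derive F z A B : sdiff F z A B ->
  is_derive z e1 F A /\ is_derive z e2 F B.
Proof.
move=> H; split.
  by apply: (is_derive_eq (sdiff_line 1 0 H)); rewrite mul1r mul0r addr0.
by apply: (is_derive_eq (sdiff_line 0 1 H)); rewrite mul1r mul0r add0r.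
Qed.

Lemma sdiff_continuous F z A B : sdiff F z A B -> {for z, continuous F}.
Proof.
move=> H; apply/cvgrPdist_le => e e0.
pose N := 1 + `|A| + `|B|; have N0 : 0 < N by rewrite /N addrAC ltr_wpDr // ltr_wpDr.
near=> w; rewrite distrC.
have H1 : `|F w - F z - (w.1 - z.1) * A - (w.2 - z.2) * B| <= 1 * `|w - z|.
  by near: w; exact: H.
have H2 : `|w - z| < e / N by near: w; apply: near_norm_lt; rewrite divr_gt0.
have n1 : `|w.1 - z.1| <= `|w - z| by rewrite prod_normE le_max lexx.
have n2 : `|w.2 - z.2| <= `|w - z| by rewrite prod_normE le_max lexx orbT.
have -> : F w - F z = (F w - F z - (w.1 - z.1) * A - (w.2 - z.2) * B) +
   (w.1 - z.1) * A + (w.2 - z.2) * B by ring.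
apply: le_trans (ler_normD _ _) _; apply: le_trans (lerD (ler_normD _ _) (lexx _)) _.
rewrite !normrM; apply: (@le_trans _ _ (`|w - z| * N)).
  by rewrite /N !mulrDr mulr1 lerD // ?ler_wpM2r // lerD // ?ler_wpM2r // -[leRHS]mul1r.
by rewrite -ler_pdivlMr // ltW.
Unshelve. all: by end_near. Qed.

Lemma sdiff_near F G z A B : (\forall w \near z, F w = G w) -> sdiff F z A B -> sdiff G z A B.
Proof.
move=> FG H e e0; have Fz := nbhs_singleton FG.
near=> w; have <- : F w = G w by near: w.
by rewrite -Fz; near: w; exact: H.
Unshelve. all: by end_near. Qed.

Lemma pser_sdiff r a b z : 0 < r -> pconv r a b -> sqnorm2 z < r ^+ 2 ->
  sdiff (pser a b) z (pser (dcoef a) (dcoef b) z) (pser (dcoef b) (fun k => - dcoef a k) z).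
Proof.
move=> r0 Hab zr; have [s [sr zs]] := mid_radius r0 zr.
have [C HC] := pser_taylor r0 Hab sr.
apply: (@sdiff_quad _ _ _ _ C).
have : \forall w \near z, sqnorm2 (w - 0) < s ^+ 2 by apply: open_disk_nbhs; rewrite subr0.
by apply: filterS => w; rewrite subr0 => ws; apply: HC; exact: ltW.
Qed.

Lemma pser_opp r a b z : 0 < r -> pconv r a b -> sqnorm2 z < r ^+ 2 ->
  pser (fun k => - a k) (fun k => - b k) z = - pser a b z.
Proof.
move=> r0 Hab zr; apply/cvg_lim => //.
have -> : (hsum (fun k => - a k) (fun k => - b k) ^~ z) = - (hsum a b ^~ z).
  by apply/funext => m /=; rewrite /hsum fctE -sumrN; apply: eq_bigr => k _; ring.
by apply: cvgN; exact: pser_cvg zr.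
Qed.

End PowerSeriesCalculus.

(** * Functions with power series on the unit disk: derivatives and unique continuation *)

Section DiskSeries.
Context {R : realType}.
Implicit Types (z w : R * R) (a b : nat -> R) (r s : R) (u F : R * R -> R).

(** The coefficients may depend on r, so that [harmonic_rep] applies radius by radius without a
    uniqueness statement. *)
Definition disk_series u : Prop := forall r, 0 < r < 1 ->
  exists a b, pconv r a b /\ forall z, sqnorm2 z < r ^+ 2 -> u z = pser a b z.

(** This is what is known of a reflected coordinate before any regularity across the axis. The first
    alternative is also allowed on the axis, so that functions with Laplacian 0 everywhere, such as
    the conformality defects, fall under the same representation. *)
Definition harmonic_off_axis u : Prop := forall z, disk z -> {for z, continuous u} /\
  (has_laplacian u z 0 \/ (z.2 = 0 /\ exists d, is_derive z e2 u d)).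

Lemma disk_radius z : disk z -> exists r, 0 < r < 1 /\ sqnorm2 z < r ^+ 2.
Proof. by move=> zd; apply: mid_radius; rewrite // expr1n. Qed.

Lemma sub_disk r z : 0 < r < 1 -> sqnorm2 z <= r ^+ 2 -> disk z.
Proof.
move=> /andP[r0 r1] zr; apply: le_lt_trans zr _.
by rewrite -[ltRHS](expr1n _ 2) ltr_pXn2r // nnegrE ltW.
Qed.

Lemma harmonic_off_axis_rep u z0 r : 0 < r -> cdisk z0 r `<=` disk ->
  harmonic_off_axis u -> exists a b, coef_bound r a b /\
    forall z, sqnorm2 z < r ^+ 2 -> hsum a b ^~ z @ \oo --> u (z0 + z).
Proof.
move=> r0 sub hu; apply: (@harmonic_rep _ u z0 r 0 r0).
  apply/subspace_continuousP => z /sub /hu[cz _].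
  by apply: cvg_within_filter; exact: cz.
by move=> z /ltW /sub /hu[].
Qed.

Lemma harmonic_off_axis_series u : harmonic_off_axis u -> disk_series u.
Proof.
move=> hu r r01; have /andP[r0 r1] := r01.
have [|a [b [Hab ab]]] := @harmonic_off_axis_rep u 0 r r0 _ hu.
  by move=> z; rewrite /cdisk /= subr0; exact: sub_disk.
exists a, b; split; first exact: coef_bound_pconv.
by move=> z /ab; rewrite add0r => H; apply/esym/cvg_lim.
Qed.

Lemma open_disk_near r z : sqnorm2 z < r -> \forall w \near z, sqnorm2 w < r.
Proof.
rewrite -{1}[z]subr0 => /open_disk_nbhs; apply: filterS => w; by rewrite subr0.
Qed.

Lemma disk_near z : disk z -> \forall w \near z, disk w.
Proof. exact: open_disk_near. Qed.

Lemma pser_local r a b u z : 0 < r -> pconv r a b ->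
  (forall w, sqnorm2 w < r ^+ 2 -> u w = pser a b w) -> sqnorm2 z < r ^+ 2 ->
  [/\ sdiff u z ('D_e1 u z) ('D_e2 u z),
      'D_e1 u z = pser (dcoef a) (dcoef b) z &
      'D_e2 u z = pser (dcoef b) (fun k => - dcoef a k) z].
Proof.
move=> r0 Hab uE zr.
have H : sdiff u z (pser (dcoef a) (dcoef b) z) (pser (dcoef b) (fun k => - dcoef a k) z).
  apply: sdiff_near (pser_sdiff r0 Hab zr).
  by apply: filterS (open_disk_near zr) => w /uE.
by have [[_ ->] [_ ->]] := sdiff_derive H.
Qed.

Lemma disk_series_sdiff u z : disk_series u -> disk z ->
  sdiff u z ('D_e1 u z) ('D_e2 u z).
Proof.
move=> hu /disk_radius[r [r01 zr]]; have /andP[r0 _] := r01.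
by have [a [b [Hab uE]]] := hu r r01; have [] := pser_local r0 Hab uE zr.
Qed.

Lemma disk_series_derive u z : disk_series u -> disk z ->
  is_derive z e1 u ('D_e1 u z) /\ is_derive z e2 u ('D_e2 u z).
Proof. by move=> hu zd; apply: sdiff_derive; exact: disk_series_sdiff. Qed.

Lemma disk_series_continuous u z : disk_series u -> disk z -> {for z, continuous u}.
Proof. by move=> hu zd; apply: sdiff_continuous (disk_series_sdiff hu zd). Qed.

Lemma disk_seriesD1 u : disk_series u -> disk_series (fun z => 'D_e1 u z).
Proof.
move=> hu r r01; have [a [b [Hab uE]]] := hu r r01.
have /andP[r0 _] := r01; exists (dcoef a), (dcoef b); split; first exact: pconv_dcoef.
by move=> z zr; have [] := pser_local r0 Hab uE zr.
Qed.

Lemma disk_seriesD2 u : disk_series u -> disk_series (fun z => 'D_e2 u z).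
Proof.
move=> hu r r01; have [a [b [Hab uE]]] := hu r r01.
have /andP[r0 _] := r01; exists (dcoef b), (fun k => - dcoef a k); split.
  exact: pconv_rot (pconv_dcoef Hab).
by move=> z zr; have [] := pser_local r0 Hab uE zr.
Qed.

(** The Cauchy-Riemann equations of the holomorphic function u_x - i u_y, read off the
    coefficients. *)
Lemma disk_series_cauchy_riemann u z : disk_series u -> disk z ->
  'D_e1 (fun w => 'D_e2 u w) z = 'D_e2 (fun w => 'D_e1 u w) z /\
  'D_e2 (fun w => 'D_e2 u w) z = - 'D_e1 (fun w => 'D_e1 u w) z.
Proof.
move=> hu /disk_radius[r [r01 zr]]; have /andP[r0 _] := r01.
have [a [b [Hab uE]]] := hu r r01; have Hd := pconv_dcoef Hab.
have E1 w : sqnorm2 w < r ^+ 2 -> 'D_e1 u w = pser (dcoef a) (dcoef b) w.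
  by move=> wr; have [] := pser_local r0 Hab uE wr.
have E2 w : sqnorm2 w < r ^+ 2 -> 'D_e2 u w = pser (dcoef b) (fun k => - dcoef a k) w.
  by move=> wr; have [] := pser_local r0 Hab uE wr.
have N x : dcoef (fun k => - dcoef x k) = (fun k => - dcoef (dcoef x) k).
  by apply/funext => k; rewrite /dcoef mulrN.
have [_ -> ->] := pser_local r0 Hd E1 zr.
have [_ -> ->] := pser_local r0 (pconv_rot Hd) E2 zr.
rewrite !N; split=> //; apply: pser_opp zr => //.
exact: pconv_dcoef.
Qed.

(** Once the earlier coefficients vanish, evaluation at x = t s isolates the k-th term up to a tail
    of at most 2 K t^(k+1). Dividing by t^k gives |a_k| s^k <= 2 K t, and t is arbitrarily small. *)
Lemma power_series_eq0 a s (K : R) : 0 < s -> (forall k, `|a k| * s ^+ k <= K) ->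
  (forall x : R, 0 < x < s -> (fun m => \sum_(k < m) a k * x ^+ k) @ \oo --> (0 : R)) ->
  forall k, a k = 0.
Proof.
move=> s0 aK H k; have [n] := ubnP k; elim: n k => // n IH k kn.
have K0 : 0 <= K by apply: le_trans (aK 0%N); rewrite mulr_ge0 ?exprn_ge0 // ltW.
(* The restriction t <= 1/2 bounds the geometric factor 1 / (1 - t) by 2. *)
have bound (t : R) : 0 < t -> t <= 2^-1 -> `|a k| * s ^+ k <= 2 * K * t.
  move=> t0 t1; have t1' : t < 1 by apply: le_lt_trans t1 _; rewrite invf_lt1 ?ltr1n.
  have xs : 0 < t * s < s by rewrite mulr_gt0 // gtr_pMl.
  have Hx : (fun m => `|\sum_(k < m) a k * (t * s) ^+ k|) @ \oo --> `|0 : R|.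
    by apply: cvg_norm; exact: H.
  have E m : (k < m)%N -> `|a k| * (t * s) ^+ k - 2 * K * t ^+ k.+1 <= `|\sum_(i < m) a i * (t * s) ^+ i|.
    move=> km; rewrite -(big_mkord xpredT (fun i => a i * (t * s) ^+ i)).
    rewrite (@big_cat_nat _ _ _ k) ?(ltnW km) //= big_nat_cond big1 ?add0r; last first.
      by move=> i /andP[/andP[_ ik] _]; rewrite IH ?mul0r // (leq_trans ik).
    rewrite big_ltn // lerBlDr.
    rewrite -[X in X <= _](ger0_norm (x := `|a k| * (t * s) ^+ k)); last first.
      by rewrite mulr_ge0 // exprn_ge0 // mulr_ge0 // ltW.
    set A := a k * _; set B := \sum_(_ <= _ < _) _.
    have -> : `| `|a k| * (t * s) ^+ k| = `|A|.
      by rewrite normrM normr_id /A normrM.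
    have -> : A = (A + B) - B by rewrite addrK.
    apply: le_trans (ler_normB _ _) _; rewrite [X in _ <= `|X| + _]subrK lerD2l.
    rewrite /B -{1}[k.+1]add0n big_addn big_mkord.
    apply: le_trans (ler_norm_sum _ _ _) _.
    apply: (@le_trans _ _ (\sum_(i < m - k.+1) K * t ^+ k.+1 * t ^+ i)).
      apply: ler_sum => i _; rewrite -mulrA -exprD normrM normrX.
      rewrite (ger0_norm (mulr_ge0 (ltW t0) (ltW s0))) exprMn mulrCA [K * _]mulrC.
      by rewrite addnC ler_wpM2l // exprn_ge0 // ltW.
    have -> : 2 * K * t ^+ k.+1 = K * t ^+ k.+1 * 2 by ring.
    rewrite -mulr_sumr ler_wpM2l //; first by rewrite mulr_ge0 // exprn_ge0 // ltW.
    have t1'' : 0 < 1 - t by rewrite subr_gt0.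
    apply: (@le_trans _ _ (1 - t)^-1).
      rewrite -[leRHS]div1r ler_pdivlMr //.
      have := subrX1 t (m - k.+1) => /(congr1 -%R); rewrite opprB -mulNr opprB mulrC => <-.
      by rewrite gerBl exprn_ge0 // ltW.
    by rewrite -[leRHS]invrK lef_pV2 ?posrE ?invr_gt0 //; lra.
  have : `|a k| * (t * s) ^+ k - 2 * K * t ^+ k.+1 <= 0.
    rewrite -(normr0 R) -(cvg_lim (@Rhausdorff R) Hx).
    apply: limr_ge; first exact: cvgP Hx.
    by exists k.+1 => // m /= km; exact: E.
  rewrite subr_le0 exprMn exprS.
  have tk : 0 < t ^+ k by rewrite exprn_gt0.
  rewrite -(ler_pM2r (x := t ^+ k) tk (`|a k| * s ^+ k)).
  by move=> H1; apply: le_trans (le_trans _ H1) _; rewrite le_eqVlt; apply/orP; left; apply/eqP; ring.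
have ak0 : `|a k| * s ^+ k <= 0.
  apply/ler_addgt0Pr => e e0; rewrite add0r.
  pose t := Num.min 2^-1 (e / (2 * K + 1)).
  have D0 : 0 < 2 * K + 1 by rewrite ltr_wpDl // mulr_ge0.
  have t0 : 0 < t by rewrite lt_min invr_gt0 ltr0n divr_gt0.
  apply: le_trans (bound t t0 _) _; first by rewrite ge_min lexx.
  apply: (@le_trans _ _ ((2 * K + 1) * (e / (2 * K + 1)))).
    apply: ler_pM; rewrite ?mulr_ge0 ?(ltW t0) //; first by rewrite lerDl.
    by rewrite ge_min lexx orbT.
  by rewrite mulrC divfK // gt_eqF.
apply/eqP; rewrite -normr_le0; move: ak0; by rewrite pmulr_lle0 // exprn_gt0.
Qed.

Lemma pow_axis k (x : R) : rpow k (x, 0) = x ^+ k /\ ipow k (x, 0) = 0.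
Proof.
elim: k => [|k [H1 H2]]; first by rewrite rpow0 ipow0 expr0.
by rewrite rpowS ipowS H1 H2 /= !mul0r mulr0 subr0 addr0 exprS.
Qed.

(** On the axis Im z^k = 0, so only the series of the a_k is left. *)
Lemma pser_axis_eq0 r a b : 0 < r -> pconv r a b ->
  (forall x, 0 < x < r -> pser a b (x, 0) = 0) -> forall k, a k = 0.
Proof.
move=> r0 Hab H; have [|K HK] := Hab (r / 2).
  by rewrite divr_gt0 // ltr_pdivrMr // ltr_pMr // ltr1n.
apply: (@power_series_eq0 a (r / 2) K); first by rewrite divr_gt0.
  by move=> k; have [] := HK k.
move=> x /andP[x0 xr]; have xr' : x < r.
  by apply: lt_trans xr _; rewrite ltr_pdivrMr // ltr_pMr // ltr1n.
rewrite -[X in _ --> X](H x); last by rewrite x0.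
have -> : (fun m => \sum_(k < m) a k * x ^+ k) = hsum a b ^~ (x, 0).
  apply/funext => m; apply: eq_bigr => k _.
  by have [-> ->] := pow_axis k x; rewrite mulr0 addr0.
apply: (pser_cvg r0 Hab).
by rewrite /sqnorm2 /= expr0n /= addr0 ltr_pXn2r // nnegrE ltW.
Qed.

(** The Cauchy data on the axis determine u: u = 0 there kills the a_k, and u_y = 0, obtained as a
    one-sided derivative from above, kills the b_k with k >= 1. The coefficient b_0 multiplies Im
    z^0 = 0. *)
Lemma disk_series_continuation u : disk_series u ->
  (forall z, disk z -> 0 <= z.2 -> u z = 0) -> forall z, disk z -> u z = 0.
Proof.
move=> hu u0 z zd; have [r [r01 zr]] := disk_radius zd.
have [a [b [Hab uE]]] := hu r r01; have /andP[r0 r1] := r01.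
have axr x : 0 < x < r -> sqnorm2 ((x, 0) : R * R) < r ^+ 2.
  move=> /andP[x0 xr].
  by rewrite /sqnorm2 /= expr0n /= addr0 ltr_pXn2r // nnegrE ltW.
have axd x : 0 < x < r -> disk ((x, 0) : R * R).
  by move=> /axr /ltW; exact: sub_disk.
have a0 : forall k, a k = 0.
  apply: (pser_axis_eq0 r0 Hab) => x xr; rewrite -uE; last exact: axr.
  by apply: u0 => //; exact: axd.
have b0 : forall k, dcoef b k = 0.
  apply: (pser_axis_eq0 r0 (pconv_rot (pconv_dcoef Hab))) => x xr.
  have [H _ <-] := pser_local r0 Hab uE (axr x xr).
  set A := 'D_e1 u _ in H; set B := 'D_e2 u _ in H *.
  apply/eqP; rewrite -normr_le0; apply/ler_addgt0Pr => e e0; rewrite add0r.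
  have : \forall w \near ((x, 0) : R * R), disk w /\
    `|u w - u (x, 0) - (w.1 - x) * A - (w.2 - 0) * B| <= e * `|w - (x, 0)|.
    by apply: filterI; [exact/disk_near/axd | exact: H].
  move=> /nbhs_ballP[d /= d0 Hd].
  have [|wd] := Hd (x, d / 2).
    rewrite -ball_normE /=; have -> : (x, 0) - (x, d / 2) = (x - x, 0 - d / 2) by [].
    rewrite prod_normE /= subrr sub0r normr0 normrN gt_max d0 /= gtr0_norm ?divr_gt0 //.
    by rewrite ltr_pdivrMr // ltr_pMr // ltr1n.
  have d20 : 0 < d / 2 by rewrite divr_gt0.
  rewrite /= !u0 //=; [|exact: axd|exact: ltW].
  have -> : 0 - 0 - (x - x) * A - (d / 2 - 0) * B = - (d / 2 * B) by ring.
  rewrite normrN normrM (gtr0_norm d20).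
  have -> : ((x, d / 2) - (x, 0) : R * R) = (x - x, d / 2 - 0) by [].
  rewrite prod_normE /= subrr subr0 normr0 max_r ?normr_ge0 // (gtr0_norm d20).
  by rewrite [e * _]mulrC ler_pM2l.
rewrite uE //; apply/cvg_lim => //.
rewrite (_ : hsum a b ^~ z = cst 0); first exact: cvg_cst.
apply/funext => m; apply: big1 => k _; rewrite a0 mul0r add0r.
case: k => -[|k] _ /=; first by rewrite ipow0 mulr0.
have := b0 k; rewrite /dcoef => /eqP; rewrite mulf_eq0 pnatr_eq0 /= => /eqP ->.
by rewrite mul0r.
Qed.

(** The hypotheses are the Cauchy-Riemann equations of A - i B and of its derivative A1 - i B1; A^2
    - B^2 and -2 A B are the real and imaginary parts of (A - i B)^2. *)
Lemma has_laplacian_cr (A B A1 B1 : R * R -> R) (A2 B2 : R) z :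
  (\forall w \near z, [/\ is_derive w e1 A (A1 w), is_derive w e2 A (B1 w),
     is_derive w e1 B (B1 w) & is_derive w e2 B (- A1 w)]) ->
  [/\ is_derive z e1 A1 A2, is_derive z e2 A1 B2,
      is_derive z e1 B1 B2 & is_derive z e2 B1 (- A2)] ->
  has_laplacian (A * A - B * B) z 0 /\ has_laplacian (A * B) z 0.
Proof.
move=> H [H1 H2 H3 H4]; have [K1 K2 K3 K4] := nbhs_singleton H.
split.
  exists (2 \*: (A * A1 - B * B1)), (2 \*: (A * B1 + B * A1)).
  exists (2 * (A1 z * A1 z + A z * A2 - B1 z * B1 z - B z * B2)),
    (2 * (B1 z * B1 z - A z * A2 - A1 z * A1 z + B z * B2)); split.
  - near=> w; have [L1 L2 L3 L4] : [/\ is_derive w e1 A (A1 w), is_derive w e2 A (B1 w),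
     is_derive w e1 B (B1 w) & is_derive w e2 B (- A1 w)] by near: w.
    apply: (is_derive_eq (is_deriveB (is_deriveM L1 L1) (is_deriveM L3 L3))).
    by rewrite /GRing.scale /= ?fctE /GRing.scale /=; ring.
  - apply: (is_derive_eq (is_deriveZ 2 (is_deriveB (is_deriveM K1 H1) (is_deriveM K3 H3)))).
    by rewrite /GRing.scale /= ?fctE /GRing.scale /=; ring.
  - near=> w; have [L1 L2 L3 L4] : [/\ is_derive w e1 A (A1 w), is_derive w e2 A (B1 w),
     is_derive w e1 B (B1 w) & is_derive w e2 B (- A1 w)] by near: w.
    apply: (is_derive_eq (is_deriveB (is_deriveM L2 L2) (is_deriveM L4 L4))).
    by rewrite /GRing.scale /= ?fctE /GRing.scale /=; ring.
  - apply: (is_derive_eq (is_deriveZ 2 (is_deriveD (is_deriveM K2 H4) (is_deriveM K4 H2)))).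
    by rewrite /GRing.scale /= ?fctE /GRing.scale /=; ring.
  - by ring.
exists (A * B1 + B * A1), (B * B1 - A * A1).
exists (2 * A1 z * B1 z + A z * B2 + B z * A2), (- (2 * A1 z * B1 z + A z * B2 + B z * A2)); split.
- near=> w; have [L1 L2 L3 L4] : [/\ is_derive w e1 A (A1 w), is_derive w e2 A (B1 w),
     is_derive w e1 B (B1 w) & is_derive w e2 B (- A1 w)] by near: w.
  apply: (is_derive_eq (is_deriveM L1 L3)).
  by rewrite /GRing.scale /= ?fctE /GRing.scale /=; ring.
- apply: (is_derive_eq (is_deriveD (is_deriveM K1 H3) (is_deriveM K3 H1))).
  by rewrite /GRing.scale /= ; ring.
- near=> w; have [L1 L2 L3 L4] : [/\ is_derive w e1 A (A1 w), is_derive w e2 A (B1 w),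
     is_derive w e1 B (B1 w) & is_derive w e2 B (- A1 w)] by near: w.
  apply: (is_derive_eq (is_deriveM L2 L4)).
  by rewrite /GRing.scale /= ?fctE /GRing.scale /=; ring.
- apply: (is_derive_eq (is_deriveB (is_deriveM K4 H4) (is_deriveM K2 H2))).
  by rewrite /GRing.scale /=; ring.
- by ring.
Unshelve. all: by end_near. Qed.

Lemma conformality_harmonic u : disk_series u -> forall z, disk z ->
  has_laplacian (fun w => 'D_e1 u w ^+ 2 - 'D_e2 u w ^+ 2) z 0 /\
  has_laplacian (fun w => 'D_e1 u w * 'D_e2 u w) z 0.
Proof.
move=> hu; have CR v w : disk_series v -> disk w ->
    [/\ is_derive w e1 (fun x => 'D_e1 v x) ('D_e1 (fun x => 'D_e1 v x) w),
     is_derive w e2 (fun x => 'D_e1 v x) ('D_e2 (fun x => 'D_e1 v x) w),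
     is_derive w e1 (fun x => 'D_e2 v x) ('D_e2 (fun x => 'D_e1 v x) w) &
     is_derive w e2 (fun x => 'D_e2 v x) (- 'D_e1 (fun x => 'D_e1 v x) w)].
  move=> hv wd; have [E1 E2] := disk_series_cauchy_riemann hv wd.
  have [H1 H2] := disk_series_derive (disk_seriesD1 hv) wd.
  have [H3 H4] := disk_series_derive (disk_seriesD2 hv) wd.
  by split; [exact: H1 | exact: H2 | rewrite -E1; exact: H3 | rewrite -E2; exact: H4].
move=> z zd; apply: has_laplacian_cr; last exact: (CR _ _ (disk_seriesD1 hu) zd).
by apply: filterS (disk_near zd) => w; exact: CR.
Qed.

End DiskSeries.

(** * From series in z to double series in x and y *)

Section DoubleSeries.
Context {R : realType}.
Implicit Types (a b : nat -> R) (x y r : R).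

Lemma pow_expand k x y :
  rpow k (x, y) = \sum_(j < k.+1) 'C(k, j)%:R * (x ^+ (k - j) * y ^+ j * rpow j (0, 1)) /\
  ipow k (x, y) = \sum_(j < k.+1) 'C(k, j)%:R * (x ^+ (k - j) * y ^+ j * ipow j (0, 1)).
Proof.
have E : cpx (x, y) = x%:C%C + y%:C%C * cpx (0, 1).
  by apply/eqP; rewrite eq_complex /=; apply/andP; split; apply/eqP; ring.
have H (j : nat) : x%:C%C ^+ (k - j) * (y%:C%C * cpx (0, 1)) ^+ j *+ 'C(k, j) =
    ('C(k, j)%:R * (x ^+ (k - j) * y ^+ j))%:C%C * cpx (0, 1) ^+ j.
  have nE (n : nat) : (n%:R : R[i]) = (n%:R : R)%:C%C by rewrite rmorph_nat.
  by rewrite exprMn -[LHS]mulr_natl nE !rmorphM !rmorphXn /=; ring.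
rewrite /rpow /ipow E exprDn Re_sum Im_sum.
split; apply: eq_bigr => j _; rewrite H; case: (cpx (0, 1) ^+ j) => p q /=; ring.
Qed.

(** The coefficient of x^i y^j in the real part of the series of (a_k - sqrt(-1) b_k) z^k:
    [rpow j (0, 1)] and [ipow j (0, 1)] are the real and imaginary parts of the j-th power of the
    imaginary unit. *)
Definition dbl_coef a b (i j : nat) : R :=
  'C(i + j, j)%:R * (a (i + j)%N * rpow j (0, 1) + b (i + j)%N * ipow j (0, 1)).

Lemma sum_triangle (F : nat -> nat -> R) m :
  \sum_(k < m) \sum_(j < k.+1) F (k - j)%N j =
  \sum_(i < m) \sum_(j < m | (i + j < m)%N) F i j.
Proof.
transitivity (\sum_(k < m) \sum_(j < m | (j <= k)%N) F (k - j)%N j).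
  apply: eq_bigr => k _.
  rewrite (big_ord_widen_cond m xpredT (fun j => F (k - j)%N j)) //.
rewrite (exchange_big_dep xpredT) //= [RHS](exchange_big_dep xpredT) //=.
apply: eq_bigr => j _.
rewrite -(big_mkord (fun k => j <= k)%N (fun k => F (k - j)%N j)).
rewrite -(big_mkord (fun i => i + j < m)%N (fun i => F i j)).
rewrite (big_cat_nat (n := j)) ?(ltnW (ltn_ord j)) //= big_nat_cond big_pred0 ?add0r; last first.
  by move=> i; rewrite -andbA; case: leqP => // _; case: ltnP => //= ij; rewrite leqNgt ij.
rewrite -{1}[nat_of_ord j]add0n big_addn.
rewrite [RHS](big_cat_nat (n := m - j)) ?leq_subr //= [X in _ = _ + X]big_nat_cond [X in _ = _ + X]big_pred0 ?addr0; last first.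
  by move=> i; lia.
rewrite big_nat_cond [RHS]big_nat_cond; apply: eq_big => [i|i _]; last by rewrite addnK.
by lia.
Qed.

Lemma hsum_double a b m x y :
  hsum a b m (x, y) =
  \sum_(i < m) \sum_(j < m | (i + j < m)%N) x ^+ i * y ^+ j * dbl_coef a b i j.
Proof.
rewrite -(sum_triangle (fun i j => x ^+ i * y ^+ j * dbl_coef a b i j)).
apply: eq_bigr => k _; have [-> ->] := pow_expand k x y.
rewrite !mulr_sumr -big_split /=; apply: eq_bigr => j _.
by rewrite /dbl_coef subnK -1?ltnS //; ring.
Qed.

Lemma bin_le_exp k j : ('C(k, j) <= 2 ^ k)%N.
Proof.
elim: k j => [|k IH] [|j] //; first by rewrite bin0 expn_gt0.
by rewrite binS expnS mul2n -addnn leq_add.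
Qed.

(** The radius is divided by 16 = 2 * 8: the factor 2 pays for the binomial, at most 2^(i+j), and
    the powers of 1/8 are kept to outweigh a count of terms in [double_series_cvg]. *)
Lemma dbl_coef_le a b r (K : R) : 0 < r ->
  (forall k, `|a k| * r ^+ k <= K /\ `|b k| * r ^+ k <= K) ->
  forall i j, `|dbl_coef a b i j| * (r / 16) ^+ (i + j) <= 2 * K * 8^-1 ^+ (i + j).
Proof.
move=> r0 HK i j; set k := (i + j)%N; have [Ha Hb] := HK k.
have p1 : sqnorm2 ((0, 1) : R * R) <= 1 ^+ 2 by rewrite /sqnorm2 /= expr0n expr1n add0r.
have [P Q] := pow_bound j (ler01) p1; rewrite expr1n in P Q.
have T : `|a k * rpow j (0, 1) + b k * ipow j (0, 1)| <= `|a k| + `|b k|.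
  apply: le_trans (ler_normD _ _) _; rewrite !normrM.
  by apply: lerD; rewrite -[leRHS]mulr1 ler_wpM2l.
have e16 : (r / 16) ^+ k = r ^+ k * (2^-1 ^+ k * 8^-1 ^+ k).
  by rewrite -!exprMn; congr (_ ^+ _); field.
have B : ('C(k, j))%:R * 2^-1 ^+ k <= 1 :> R.
  rewrite exprVn ler_pdivrMr ?exprn_gt0 // mul1r -natrX ler_nat; exact: bin_le_exp.
rewrite /dbl_coef -/k normrM normr_nat e16.
have -> : 'C(k, j)%:R * `|a k * rpow j (0, 1) + b k * ipow j (0, 1)| * (r ^+ k * (2^-1 ^+ k * 8^-1 ^+ k))
  = ('C(k, j)%:R * 2^-1 ^+ k) * (`|a k * rpow j (0, 1) + b k * ipow j (0, 1)| * r ^+ k) * 8^-1 ^+ k by ring.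
rewrite ler_wpM2r ?exprn_ge0 // -[leRHS]mul1r ler_pM // ?mulr_ge0 ?exprn_ge0 ?(ltW r0) //.
apply: (@le_trans _ _ ((`|a k| + `|b k|) * r ^+ k)); first by rewrite ler_wpM2r // exprn_ge0 // ltW.
by rewrite mulrDl [2 * K]mulr_natl mulr2n lerD.
Qed.

Lemma sqr_le_exp4 m : (m * m <= 4 ^ m)%N.
Proof.
have H : (m <= 2 ^ m)%N by rewrite ltnW // ltn_expl.
by rewrite -[4%N]/(2 * 2)%N expnMn leq_mul.
Qed.

(** [real_analytic_on] uses square partial sums, whereas [hsum] sums over the triangle i + j < m.
    The terms in between satisfy i + j >= m; there are at most m^2 <= 4^m of them, each at most 2 K
    8^-m. *)
Lemma double_series_cvg a b r (K l : R) x y : 0 < r ->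
  (forall k, `|a k| * r ^+ k <= K /\ `|b k| * r ^+ k <= K) ->
  `|x| < r / 16 -> `|y| < r / 16 -> hsum a b ^~ (x, y) @ \oo --> l ->
  (fun m => \sum_(i < m) \sum_(j < m) x ^+ i * y ^+ j * dbl_coef a b i j) @ \oo --> l.
Proof.
move=> r0 HK xr yr Hl.
have K0 : 0 <= K.
  by have [+ _] := HK 0%N; apply: le_trans; rewrite mulr_ge0 // exprn_ge0 // ltW.
pose T m := \sum_(i < m) \sum_(j < m) x ^+ i * y ^+ j * dbl_coef a b i j.
have E m : `|T m - hsum a b m (x, y)| <= 2 * K * 2^-1 ^+ m.
  rewrite hsum_double /T -sumrB.
  apply: (@le_trans _ _ (\sum_(i < m) \sum_(j < m) 2 * K * 8^-1 ^+ m)).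
    apply: le_trans (ler_norm_sum _ _ _) _; apply: ler_sum => i _.
    rewrite (bigID (fun j : 'I_m => (i + j < m)%N)) /= addrAC subrr add0r.
    apply: le_trans (ler_norm_sum _ _ _) _.
    rewrite [leRHS](bigID (fun j : 'I_m => ~~ (i + j < m)%N)) /= -[leLHS]addr0 lerD //.
      apply: ler_sum => j; rewrite -leqNgt => mij.
      apply: (@le_trans _ _ (2 * K * 8^-1 ^+ (i + j))); last first.
        rewrite ler_wpM2l ?mulr_ge0 //; apply: ler_wiXn2l => //.
        by rewrite invf_le1 ?ler1n.
      apply: le_trans (dbl_coef_le r0 HK i j).
      rewrite !normrM mulrC ler_wpM2l // !normrX exprD.
      by apply: ler_pM; rewrite ?exprn_ge0 //; apply: lerXn2r; rewrite ?nnegrE // ?divr_ge0 // ltW.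
    by apply: sumr_ge0 => j _; rewrite mulr_ge0 ?mulr_ge0 // exprn_ge0.
  rewrite !sumr_const !card_ord -mulrnA -[_ *+ (m * m)]mulr_natr -mulrA ler_wpM2l ?mulr_ge0 //.
  have -> : 8^-1 ^+ m = 2^-1 ^+ m * 4^-1 ^+ m :> R.
    by rewrite -exprMn; congr (_ ^+ _); field.
  rewrite -mulrA -[leRHS]mulr1 ler_wpM2l ?exprn_ge0 //.
  rewrite exprVn mulrC ler_pdivrMr ?exprn_gt0 // mul1r -natrX ler_nat; exact: sqr_le_exp4.
have D0 : (fun m => T m - hsum a b m (x, y)) @ \oo --> (0 : R).
  apply/cvgrPdist_le => e e0.
  have : (fun m => 2 * K * 2^-1 ^+ m) @ \oo --> 2 * K * (0 : R).
    by apply: cvgMl_tmp; apply: cvg_expr; rewrite ger0_norm ?invr_ge0 // invf_lt1 ?ltr1n.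
  rewrite mulr0 => /cvgrPdist_le/(_ e e0); apply: filterS => m.
  rewrite !sub0r !normrN => H; apply: le_trans (E m) (le_trans (ler_norm _) H).
have S : (fun m => (T m - hsum a b m (x, y)) + hsum a b m (x, y)) @ \oo --> 0 + l.
  exact: cvgD D0 Hl.
by move: S; rewrite add0r; under eq_fun do rewrite subrK.
Qed.

End DoubleSeries.

(** * Vector-valued harmonic maps *)

Section VectorValued.
Context {R : realType} {n : nat}.
Implicit Types (z w : R * R) (U V : R * R -> 'rV[R]_n).

Lemma rV_norm_le (v : 'rV[R]_n) (e : R) : 0 <= e -> (forall k, `|v 0 k| <= e) -> `|v| <= e.
Proof.
move=> e0 H; rewrite /Num.Def.normr /= mx_normrE (bigmax_le _ e0) //= => -[i k] _ /=.
by rewrite (ord1 i).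
Qed.

Lemma coord_norm_le (v : 'rV[R]_n) k : `|v 0 k| <= `|v|.
Proof. by rewrite [leRHS]/Num.Def.normr /= mx_normrE; exact: (le_bigmax _ _ (0, k)). Qed.

Definition coords_series U := forall k, disk_series (coord U k).

Lemma cvg_coords (T : Type) (F : set_system T) {FF : Filter F} (f : T -> 'rV[R]_n) (l : 'rV[R]_n) :
  (forall k, (fun t => f t 0 k) @ F --> l 0 k) -> f @ F --> l.
Proof.
move=> H; apply/cvgrPdist_le => e e0.
have : \forall t \near F, forall k, `|l 0 k - f t 0 k| <= e.
  by apply: filter_forall => k; have /cvgrPdist_le := H k; exact.
apply: filterS => t Ht; apply: rV_norm_le (ltW e0) _ => k.
by rewrite !mxE; exact: Ht.
Qed.

Lemma coords_derivable U z v : (forall k, derivable (coord U k) z v) -> derivable U z v.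
Proof. by move=> H; apply/derivable_mxP => i k; rewrite (ord1 i); exact: H. Qed.

Lemma coord_derive U z v k : (forall k, derivable (coord U k) z v) ->
  'D_v U z 0 k = 'D_v (coord U k) z.
Proof. by move=> H; rewrite derive_mx ?mxE //; exact: coords_derivable. Qed.

Lemma coords_series_derivable U z : coords_series U -> disk z ->
  derivable U z e1 /\ derivable U z e2.
Proof.
by move=> hU zd; split; apply: coords_derivable => k;
  have [[? _] [? _]] := disk_series_derive (hU k) zd.
Qed.

Lemma coord_derive12 U z k : coords_series U -> disk z ->
  'D_e1 U z 0 k = 'D_e1 (coord U k) z /\ 'D_e2 U z 0 k = 'D_e2 (coord U k) z.
Proof.
by move=> hU zd; split; apply: coord_derive => j;
  have [[? _] [? _]] := disk_series_derive (hU j) zd.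
Qed.

Lemma disk_series_ext (u v : R * R -> R) :
  (forall z, disk z -> u z = v z) -> disk_series u -> disk_series v.
Proof.
move=> uv hu r r01; have [a [b [Hab uE]]] := hu r r01; exists a, b; split=> // z zr.
by rewrite -uv ?uE //; apply: sub_disk r01 _; exact: ltW.
Qed.

Lemma coords_seriesD U : coords_series U ->
  coords_series (fun z => 'D_e1 U z) /\ coords_series (fun z => 'D_e2 U z).
Proof.
move=> hU; split=> k.
  apply: (disk_series_ext _ (disk_seriesD1 (hU k))) => z zd.
  by have [F1 _] := coord_derive12 k hU zd; exact: esym F1.
apply: (disk_series_ext _ (disk_seriesD2 (hU k))) => z zd.
by have [_ F2] := coord_derive12 k hU zd; exact: esym F2.
Qed.

Lemma coords_series_continuous U z : coords_series U -> disk z -> {for z, continuous U}.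
Proof.
by move=> hU zd; apply: cvg_coords => k; exact: (disk_series_continuous (hU k) zd).
Qed.

Lemma coords_series_Ck U m : coords_series U -> Ck_on m disk U.
Proof.
elim: m U => [|m IH] U hU; first by split=> // z; exact: coords_series_continuous.
split; first by move=> z; exact: coords_series_continuous.
have [h1 h2] := coords_seriesD hU; split; [|exact: IH|exact: IH].
by move=> z; exact: coords_series_derivable.
Qed.

Lemma coords_series_harmonic U : coords_series U -> harmonic_on disk U.
Proof.
move=> hU; split; first exact: coords_series_Ck.
move=> z zd; have [h1 h2] := coords_seriesD hU.
apply/rowP => k; rewrite mxE [RHS]mxE.
have [F1 _] := coord_derive12 k h1 zd; have [_ F2] := coord_derive12 k h2 zd.
have E1 : \forall w \near z, coord (fun w => 'D_e1 U w) k w = 'D_e1 (coord U k) w.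
  by apply: filterS (disk_near zd) => w wd; have [] := coord_derive12 k hU wd.
have E2 : \forall w \near z, coord (fun w => 'D_e2 U w) k w = 'D_e2 (coord U k) w.
  by apply: filterS (disk_near zd) => w wd; have [] := coord_derive12 k hU wd.
apply: (etrans (congr2 +%R F1 F2)).
apply: (etrans (congr2 +%R (near_eq_derive _ E1) (near_eq_derive _ E2))).
have [_ C] := disk_series_cauchy_riemann (hU k) zd.
by apply: (etrans (congr2 +%R erefl C)); rewrite subrr.
Qed.

Lemma sdiff_eq (F : R * R -> R) z A B A' B' :
  sdiff F z A B -> A = A' -> B = B' -> sdiff F z A' B'.
Proof. by move=> H <- <-. Qed.

Lemma coords_sdiff D U z (A B : 'rV[R]_n) :
  (forall k, sdiff (coord U k) z (A 0 k) (B 0 k)) -> has_diff_within D U z A B.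
Proof.
move=> H e e0; apply: cvg_within.
have N : \forall w \near z, forall k, `|coord U k w - coord U k z
   - (w.1 - z.1) * A 0 k - (w.2 - z.2) * B 0 k| <= e * `|w - z|.
  have Hk k := H k e e0.
  by move: Hk => /filter_forall.
apply: filterS N => w Hw; apply: rV_norm_le => [|k]; first by rewrite mulr_ge0 // ltW.
by have := Hw k; rewrite !mxE.
Qed.

Lemma coords_series_diff U z : coords_series U -> disk z ->
  has_diff_within disk U z ('D_e1 U z) ('D_e2 U z).
Proof.
move=> hU zd; apply: coords_sdiff => k.
have [F1 F2] := coord_derive12 k hU zd.
exact: sdiff_eq (disk_series_sdiff (hU k) zd) (esym F1) (esym F2).
Qed.

Lemma coords_series_C1 U : coords_series U ->
  C1_within disk U (fun z => 'D_e1 U z) (fun z => 'D_e2 U z).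
Proof.
move=> hU; have [h1 h2] := coords_seriesD hU.
split; last by move=> z; exact: coords_series_diff.
  apply/subspace_continuousP => z zd; apply: cvg_within_filter.
  exact: coords_series_continuous h1 zd.
apply/subspace_continuousP => z zd; apply: cvg_within_filter.
exact: coords_series_continuous h2 zd.
Qed.

Lemma disk_cdisk z : disk z -> exists r : R, 0 < r /\ cdisk z r `<=` disk.
Proof.
move=> /disk_near /nbhs_ballP[d /= d0 H]; exists (d / 2); split; first by rewrite divr_gt0.
move=> w /abs_sqnorm2[|H1 H2]; first by rewrite ltW // divr_gt0.
apply: H; rewrite -ball_normE /= distrC; apply: (@le_lt_trans _ _ (d / 2)).
  by rewrite prod_normE ge_max H1.
by rewrite ltr_pdivrMr // ltr_pMr // ltr1n.
Qed.

(** Assuming [harmonic_off_axis] rather than [coords_series] allows a fresh representation on a disk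
    centred at z, so no series has to be recentred. *)
Lemma coords_analytic U : (forall k, harmonic_off_axis (coord U k)) ->
  real_analytic_on disk U.
Proof.
move=> hU z zd; have [r [r0 sub]] := disk_cdisk zd.
have EX k : exists ab : (nat -> R) * (nat -> R) * R,
  (forall i, `|ab.1.1 i| * r ^+ i <= ab.2 /\ `|ab.1.2 i| * r ^+ i <= ab.2) /\
    forall w, sqnorm2 w < r ^+ 2 -> hsum ab.1.1 ab.1.2 ^~ w @ \oo --> coord U k (z + w).
  by have [a [b [[K HK] H]]] := harmonic_off_axis_rep r0 sub (hU k); exists ((a, b), K).
have [ab abP] := choice EX.
pose K := \sum_k (ab k).2.
have K0 k : 0 <= (ab k).2.
  by have [/(_ 0%N)[+ _] _] := abP k; apply: le_trans; rewrite mulr_ge0 // exprn_ge0 // ltW.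
have Kk k : (ab k).2 <= K.
  by rewrite /K (bigD1 k) //= lerDl sumr_ge0.
pose u i j : 'rV[R]_n := \row_k dbl_coef (ab k).1.1 (ab k).1.2 i j.
have r16 : 0 < r / 16 by rewrite divr_gt0.
exists (r / 16), (2 * K), u; split=> // [i j|x y xr yr].
  have p0 : 0 < (r / 16) ^+ (i + j) by rewrite exprn_gt0.
  rewrite -ler_pdivlMr //; apply: rV_norm_le => [|k].
    by rewrite divr_ge0 ?(ltW p0) // mulr_ge0 // sumr_ge0.
  rewrite mxE ler_pdivlMr //; have [Hk _] := abP k.
  apply: le_trans (dbl_coef_le r0 Hk i j) _.
  apply: (@le_trans _ _ (2 * (ab k).2 * 1)).
    by rewrite ler_wpM2l ?mulr_ge0 // exprn_ile1 // invf_le1 ?ler1n.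
  by rewrite mulr1 ler_wpM2l.
apply: cvg_coords => k; have [Hk Hc] := abP k.
have xyr : sqnorm2 ((x, y) : R * R) < r ^+ 2.
  have H t : `|t| < r / 16 -> t ^+ 2 <= (r / 16) ^+ 2.
    by move=> tr; rewrite -real_normK ?num_real //; apply: lerXn2r; rewrite ?nnegrE // ltW.
  apply: le_lt_trans (lerD (H x xr) (H y yr)) _.
  by move: r0; rewrite expr_div_n -natrX; set q := r ^+ 2 => r0; have : 0 < q by [rewrite exprn_gt0]; lra.
have := double_series_cvg r0 Hk xr yr (Hc _ xyr).
suff -> : (fun m => \sum_(i < m) \sum_(j < m) x ^+ i * y ^+ j * dbl_coef (ab k).1.1 (ab k).1.2 i j)
  = (fun m => (\sum_(i < m) \sum_(j < m) (x ^+ i * y ^+ j) *: u i j) 0 k) by [].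
apply/funext => m; rewrite summxE; apply: eq_bigr => i _.
by rewrite summxE; apply: eq_bigr => j _; rewrite !mxE.
Qed.

Lemma dotvE (u v : 'rV[R]_n) : dotv u v = \sum_k u 0 k * v 0 k.
Proof. by rewrite /dotv mxE; apply: eq_bigr => k _; rewrite mxE. Qed.

Lemma dotv_ge0 (u : 'rV[R]_n) : 0 <= dotv u u.
Proof. by rewrite dotvE sumr_ge0 // => k _; rewrite -expr2 sqr_ge0. Qed.

Lemma enorm_eq (u v : 'rV[R]_n) : enorm u = enorm v <-> dotv u u = dotv v v.
Proof.
split=> [E|]; last by rewrite /enorm => ->.
by rewrite -[LHS]sqr_sqrtr ?dotv_ge0 // -[RHS]sqr_sqrtr ?dotv_ge0 // -/(enorm u) E.
Qed.

(* The conformality defect is harmonic and vanishes on the upper side. *)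
Lemma coords_series_conformal U : coords_series U ->
  (forall z, disk z -> 0 <= z.2 -> enorm ('D_e1 U z) = enorm ('D_e2 U z) /\
     dotv ('D_e1 U z) ('D_e2 U z) = 0) ->
  forall z, disk z -> enorm ('D_e1 U z) = enorm ('D_e2 U z) /\
     dotv ('D_e1 U z) ('D_e2 U z) = 0.
Proof.
move=> hU up.
pose D1 k := fun z => 'D_e1 (coord U k) z; pose D2 k := fun z => 'D_e2 (coord U k) z.
pose P z := \sum_k (D1 k z ^+ 2 - D2 k z ^+ 2).
pose Q z := \sum_k (D1 k z * D2 k z).
have PE z : disk z -> P z = dotv ('D_e1 U z) ('D_e1 U z) - dotv ('D_e2 U z) ('D_e2 U z).
  move=> zd; rewrite !dotvE -sumrB; apply: eq_bigr => k _.
  have [F1 F2] := coord_derive12 k hU zd.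
  exact: (congr2 (fun x y : R => x * x - y * y) (esym F1) (esym F2)).
have QE z : disk z -> Q z = dotv ('D_e1 U z) ('D_e2 U z).
  move=> zd; rewrite dotvE; apply: eq_bigr => k _.
  have [F1 F2] := coord_derive12 k hU zd.
  exact: (congr2 *%R (esym F1) (esym F2)).
have c1 k z : disk z -> D1 k @ z --> D1 k z by move=> zd; exact: disk_series_continuous (disk_seriesD1 (hU k)) zd.
have c2 k z : disk z -> D2 k @ z --> D2 k z by move=> zd; exact: disk_series_continuous (disk_seriesD2 (hU k)) zd.
have csum (F : 'I_n -> R * R -> R) z : (forall k, F k @ z --> F k z) ->
    (fun w => \sum_k F k w) @ z --> \sum_k F k z.
  move=> H; elim: (index_enum _) => [|k s IH].
    by under eq_fun do rewrite big_nil; rewrite big_nil; exact: cvg_cst.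
  by under eq_fun do rewrite big_cons; rewrite big_cons; apply: cvgD.
have hP : disk_series P.
  apply: harmonic_off_axis_series => z zd; split.
    by apply: (csum (fun k w => D1 k w ^+ 2 - D2 k w ^+ 2)) => k; rewrite !expr2;
       apply: cvgB; apply: cvgM; [exact: c1|exact: c1|exact: c2|exact: c2].
  left; apply: (has_laplacian_sum _ (F := fun k w => D1 k w ^+ 2 - D2 k w ^+ 2)) => k.
  by have [] := conformality_harmonic (hU k) zd.
have hQ : disk_series Q.
  apply: harmonic_off_axis_series => z zd; split.
    by apply: (csum (fun k w => D1 k w * D2 k w)) => k; apply: cvgM; [exact: c1|exact: c2].
  left; apply: (has_laplacian_sum _ (F := fun k w => D1 k w * D2 k w)) => k.
  by have [] := conformality_harmonic (hU k) zd.
move=> z zd; split.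
  apply/enorm_eq; have : P z = 0.
    apply: (disk_series_continuation hP) zd => w wd w2; apply: etrans (PE w wd) _.
    have [/enorm_eq E _] := up w wd w2; apply/eqP; rewrite subr_eq0; exact/eqP.
  by move=> P0; apply/eqP; rewrite -subr_eq0; apply/eqP; exact: etrans (esym (PE z zd)) P0.
apply: etrans (esym (QE z zd)) _.
apply: (disk_series_continuation hQ) zd => w wd w2; apply: etrans (QE w wd) _.
by have [] := up w wd w2.
Qed.

End VectorValued.

(** * Reflection of three sheets *)

Section Reflection.
Context {R : realType}.
Implicit Types (z w v : R * R) (u g : R * R -> R).

Definition conjp z : R * R := (z.1, - z.2).

Lemma is_derive_opp_dir u z v (d : R) : is_derive z v u d -> is_derive z (- v) u (- d).
Proof.
move=> [du vu].
pose q (h : R) := h^-1 *: ((u \o shift z) (h *: v) - u z).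
have qd : q @ 0^' --> d by rewrite -vu; exact: du.
have E h : h^-1 *: ((u \o shift z) (h *: (- v)) - u z) = - q (- h).
  by rewrite /q invrN scaleNr opprK scalerN scaleNr.
have H : (fun h : R => h^-1 *: ((u \o shift z) (h *: (- v)) - u z)) @ 0^' --> - d.
  under eq_fun do rewrite E.
  apply: cvgN; apply: cvg_trans qd => A; rewrite /= /nbhs /= => -[e e0 He].
  exists e => // h /= he h0; apply: He; rewrite /= ?oppr_eq0 //.
  by move: he; rewrite !sub0r opprK normrN.
by split; [apply/cvg_ex; exists (- d) | apply/cvg_lim].
Qed.

Lemma is_derive_conjp u z v (d : R) : is_derive (conjp z) (conjp v) u d ->
  is_derive z v (u \o conjp) d.
Proof.
have E : (fun h : R => h^-1 *: (((u \o conjp) \o shift z) (h *: v) - (u \o conjp) z)) =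
   (fun h : R => h^-1 *: ((u \o shift (conjp z)) (h *: conjp v) - u (conjp z))).
  apply/funext => h /=.
  have -> : conjp (h *: v + z) = h *: conjp v + conjp z.
    by congr pair; rewrite /= /GRing.scale /=; ring.
  by [].
by move=> [H1 H2]; split; [rewrite /derivable E | rewrite /derive E].
Qed.

Lemma continuous_conjp : continuous (@conjp).
Proof.
move=> z; apply/cvgrPdist_le => e e0; apply: filterS (near_norm_lt z e0) => w wz.
have -> : conjp z - conjp w = conjp (z - w) by congr pair; rewrite /= opprD.
rewrite prod_normE /= normrN distrC [X in Num.max _ X]distrC.
by apply: ltW; move: wz; rewrite prod_normE.
Qed.

Lemma near_conjp (P : R * R -> Prop) z : (\forall w \near conjp z, P w) ->
  \forall w \near z, P (conjp w).
Proof. by move=> H; exact: (@continuous_conjp z _ H). Qed.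

Lemma has_laplacian_conjp u z (l : R) : has_laplacian u (conjp z) l ->
  has_laplacian (u \o conjp) z l.
Proof.
have c1 : conjp e1 = e1 :> R * R by rewrite /conjp /= oppr0.
have c2 : conjp e2 = - e2 :> R * R by rewrite /conjp /e2 /=; congr pair; rewrite oppr0.
move=> [ux [uy [a [b [H1 H2 H3 H4 <-]]]]].
exists (ux \o conjp), (fun w => - uy (conjp w)), a, b; split=> //.
- apply: filterS (near_conjp H1) => w Hw; apply: is_derive_conjp; rewrite c1; exact: Hw.
- by apply: is_derive_conjp; rewrite c1.
- apply: filterS (near_conjp H3) => w Hw; apply: is_derive_conjp; rewrite c2.
  exact: is_derive_opp_dir.
- have -> : (fun w => - uy (conjp w)) = (fun w => - uy w) \o conjp by [].
  apply: is_derive_conjp; rewrite c2 -[b]opprK; apply: is_derive_opp_dir.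
Qed.

Lemma has_laplacian_near u g z (l : R) : (\forall w \near z, u w = g w) ->
  has_laplacian u z l -> has_laplacian g z l.
Proof.
move=> ug [ux [uy [a [b [H1 H2 H3 H4 <-]]]]].
have ugn : \forall w \near z, \forall x \near w, u x = g x by apply: nbhs_interior.
exists ux, uy, a, b; split=> //.
- near=> w; apply: near_eq_is_derive; first by near: w; exact: ugn.
  by near: w.
- near=> w; apply: near_eq_is_derive; first by near: w; exact: ugn.
  by near: w.
Unshelve. all: by end_near. Qed.

(** This is where 2/3 comes from. A common trace g is preserved, as -g + (2/3) 3 g = g, and so is
    the tangential derivative; below the axis the y-derivative is b_i - (2/3) (sum of the b_j) =
    b_i. Both sides thus have the same first-order expansion. *)
Lemma reflect_sdiff (D : set (R * R)) (g : 'I_3 -> R * R -> R) (i : 'I_3) z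
    (a : R) (b : 'I_3 -> R) : z.2 = 0 ->
  (\forall w \near z, 0 <= w.2 -> D w) ->
  (forall j e, 0 < e -> \forall w \near z, D w ->
     `|g j w - g j z - (w.1 - z.1) * a - (w.2 - z.2) * b j| <= e * `|w - z|) ->
  (forall j, g j z = g i z) -> \sum_j b j = 0 ->
  sdiff (fun w => if 0 <= w.2 then g i w else
    - g i (conjp w) + 2 / 3 * \sum_j g j (conjp w)) z a (b i).
Proof.
(* Below the axis the error is -E_i + (2/3) sum E_j, where E_j is the error of sheet j; with |E_j|
   <= (e / 3) |w - z| this amounts to e |w - z|. *)
move=> z0 Dz Hg gz b0 e e0; have e3 : 0 < e / 3 by rewrite divr_gt0.
have cz : conjp z = z by case: z z0 {Dz Hg gz} => x y /= ->; rewrite /conjp /= oppr0.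
have H1 : \forall w \near z, forall j, D w -> `|g j w - g j z - (w.1 - z.1) * a
     - (w.2 - z.2) * b j| <= e / 3 * `|w - z|.
  have Hk j := Hg j (e / 3) e3.
  by move: Hk => /filter_forall.
have H2 : \forall w \near z, forall j, D (conjp w) -> `|g j (conjp w) - g j z - (w.1 - z.1) * a
     - (- w.2 - z.2) * b j| <= e / 3 * `|w - z|.
  have := H1; rewrite -{1}cz => /near_conjp; apply: filterS => w Hw j Dw.
  have -> : `|w - z| = `|conjp w - z|.
    by rewrite !prod_normE /= z0 !subr0 normrN.
  exact: Hw.
have D2 : \forall w \near z, 0 <= - w.2 -> D (conjp w).
  by have := Dz; rewrite -{1}cz => /near_conjp.
near=> w; rewrite z0 lexx subr0.
have [w0|w0] := leP 0 w.2.
  have -> : w.2 * b i = (w.2 - z.2) * b i by rewrite z0 subr0.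
  apply: (@le_trans _ _ (e / 3 * `|w - z|)).
    have Dw : D w by apply: (near Dz w).
    by apply: (near H1 w).
  by rewrite ler_wpM2r // ler_pdivrMr // ler_pMr // ler1n.
have Dw : D (conjp w) by apply: (near D2 w) => //; rewrite oppr_ge0 ltW.
pose E j := g j (conjp w) - g j z - (w.1 - z.1) * a - (- w.2 - z.2) * b j.
have HE j : `|E j| <= e / 3 * `|w - z| by apply: (near H2 w).
have -> : - g i (conjp w) + 2 / 3 * (\sum_j g j (conjp w)) - g i z - (w.1 - z.1) * a - w.2 * b i
   = - E i + 2 / 3 * \sum_j E j.
  rewrite /E z0 !subr0.
  have gj j : g j (conjp w) - g j z - (w.1 - z.1) * a - - w.2 * b j =
     g j (conjp w) - (g i z + (w.1 - z.1) * a) + w.2 * b j by rewrite gz; ring.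
  under [in RHS]eq_bigr => j _ do rewrite gj.
  rewrite big_split /= sumrB sumr_const card_ord -mulr_sumr b0 -mulr_natr.
  by field.
have HS : `|\sum_j E j| <= e * `|w - z|.
  apply: le_trans (ler_norm_sum _ _ _) _.
  apply: le_trans (ler_sum _ (fun j _ => HE j)) _.
  by rewrite sumr_const card_ord -[_ *+ 3]mulr_natr mulrAC divfK.
apply: le_trans (ler_normD _ _) _; rewrite normrN normrM ger0_norm; last by rewrite divr_ge0.
by move: (HE i) HS; set t := `|w - z|; lra.
Unshelve. all: by end_near. Qed.

End Reflection.

(** * Uniqueness of differentials relative to a set *)

Section OneSidedDifferentials.
Context {R : realType} {n : nat}.
Implicit Types (z w v : R * R) (f : R * R -> 'rV[R]_n) (D : set (R * R)).

(** The directions in which a differential relative to D is determined by f, even when D is not a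
    neighbourhood of z. *)
Definition enters D z v : Prop :=
  exists2 d : R, 0 < d & forall t, 0 < t < d -> D (z + t *: v).

Lemma diff_dir D f z v (a b : 'rV[R]_n) : has_diff_within D f z a b ->
  enters D z v -> forall e : R, 0 < e -> exists2 d : R, 0 < d & forall t, 0 < t < d ->
    `|f (z + t *: v) - f z - t *: (v.1 *: a + v.2 *: b)| <= e * t.
Proof.
move=> H [d0 d00 Dt] e e0; pose N := `|v| + 1; have N0 : 0 < N by rewrite ltr_wpDl.
have := H (e / N) (divr_gt0 e0 N0); rewrite near_withinE => /nbhs_ballP[r /= r0 Hr].
exists (Num.min d0 (r / N)); first by rewrite lt_min d00 divr_gt0.
move=> t /andP[t0]; rewrite lt_min => /andP[td tr].
have zt : z + t *: v - z = t *: v by rewrite addrC addKr.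
have nt : `|t *: v| = t * `|v| by rewrite normrZ gtr0_norm.
have := Hr (z + t *: v) _ (Dt t _); rewrite t0 td => /(_ _ isT).
rewrite zt nt.
have -> : (z + t *: v).1 - z.1 = t * v.1 by rewrite /= addrC addKr.
have -> : (z + t *: v).2 - z.2 = t * v.2 by rewrite /= addrC addKr.
rewrite scalerDr !scalerA opprD addrA => K.
apply: le_trans (K _) _.
  rewrite -ball_normE /= opprD addrA subrr add0r normrN nt.
  apply: (@le_lt_trans _ _ (t * N)); first by rewrite ler_pM2l // /N lerDl.
  by rewrite -ltr_pdivlMr.
by rewrite mulrA mulrAC ler_pM2r // mulrAC ler_pdivrMr // ler_pM2l // /N lerDl.
Qed.

Lemma dir_unique (g : R -> 'rV[R]_n) (c c' : 'rV[R]_n) :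
  (forall e : R, 0 < e -> exists2 d : R, 0 < d & forall t, 0 < t < d -> `|g t - t *: c| <= e * t) ->
  (forall e : R, 0 < e -> exists2 d : R, 0 < d & forall t, 0 < t < d -> `|g t - t *: c'| <= e * t) ->
  c = c'.
Proof.
move=> H H'; apply/eqP; rewrite -subr_eq0 -normr_le0; apply/ler_addgt0Pr => e e0.
rewrite add0r; have e20 : 0 < e / 2 by rewrite divr_gt0.
have [d d0 Hd] := H _ e20; have [d' d'0 Hd'] := H' _ e20.
pose t := Num.min d d' / 2; have m0 : 0 < Num.min d d' by rewrite lt_min d0.
have t0 : 0 < t by rewrite divr_gt0.
have : t < Num.min d d' by rewrite ltr_pdivrMr // ltr_pMr // ltr1n.
rewrite lt_min => /andP[td td'].
have K := Hd t; rewrite t0 td in K; have K' := Hd' t; rewrite t0 td' in K'.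
rewrite -(ler_pM2r t0).
have -> : `|c - c'| * t = `|(g t - t *: c') - (g t - t *: c)|.
  have -> : (g t - t *: c') - (g t - t *: c) = t *: (c - c').
    by rewrite opprB addrC addrA subrK scalerBr.
  by rewrite normrZ gtr0_norm // mulrC.
apply: le_trans (ler_normB _ _) _; apply: le_trans (lerD (K' isT) (K isT)) _.
by rewrite -mulrDl -splitr.
Qed.

(** The comparison takes place on a single ray, so the two maps may have different domains and need
    to agree only there. It identifies tangential derivatives of different sheets and the partials
    of U_i with those of f_i. *)
Lemma diff_unique_dir D D' f f' z v (a b a' b' : 'rV[R]_n) :
  has_diff_within D f z a b -> has_diff_within D' f' z a' b' ->
  enters D z v -> enters D' z v ->
  (forall t : R, 0 < t -> D (z + t *: v) -> D' (z + t *: v) -> f (z + t *: v) = f' (z + t *: v)) ->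
  f z = f' z -> v.1 *: a + v.2 *: b = v.1 *: a' + v.2 *: b'.
Proof.
move=> H H' Dv Dv' ff fz.
apply: (@dir_unique (fun t => f (z + t *: v) - f z)) => e e0; first exact: diff_dir H Dv _ e0.
have [d d0 Hd] := diff_dir H' Dv' e0; have [d1 d10 E] := Dv; have [d2 d20 E'] := Dv'.
exists (Num.min d (Num.min d1 d2)); first by rewrite !lt_min d0 d10.
move=> t /andP[t0]; rewrite !lt_min => /and3P[td t1 t2].
by rewrite ff ?fz //; [apply: Hd | apply: E | apply: E']; rewrite t0.
Qed.

Lemma diff_within_unique D f z (a b a' b' : 'rV[R]_n) :
  has_diff_within D f z a b -> has_diff_within D f z a' b' ->
  enters D z e1 -> enters D z e2 -> a = a' /\ b = b'.
Proof.
move=> H H' h1 h2; split.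
  have := diff_unique_dir H H' h1 h1 (fun _ _ _ _ => erefl) erefl.
  by rewrite /= !scale1r !scale0r !addr0.
have := diff_unique_dir H H' h2 h2 (fun _ _ _ _ => erefl) erefl.
by rewrite /= !scale1r !scale0r !add0r.
Qed.

Lemma enters_open (W : set (R * R)) z v : open W -> W z -> enters W z v.
Proof.
move=> oW Wz; have : nbhs z W by exact: open_nbhs_nbhs.
move=> /nbhs_ballP[r /= r0 Hr]; pose N := `|v| + 1; have N0 : 0 < N by rewrite ltr_wpDl.
exists (r / N); first by rewrite divr_gt0.
move=> t /andP[t0 tr]; apply: Hr; rewrite -ball_normE /= opprD addrA subrr add0r normrN.
rewrite normrZ gtr0_norm //; apply: (@le_lt_trans _ _ (t * N)); first by rewrite ler_pM2l // /N lerDl.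
by rewrite -ltr_pdivlMr.
Qed.

Lemma enters_upper (W : set (R * R)) z v : open W -> W z -> 0 <= z.2 -> 0 <= v.2 ->
  enters (W `&` upper_plane) z v.
Proof.
move=> oW Wz z2 v2; have [d d0 H] := enters_open v oW Wz.
exists d => // t tr; split; first exact: H.
have /andP[t0 _] := tr.
by rewrite /upper_plane /= addr_ge0 // mulr_ge0 // ltW.
Qed.

Lemma has_diff_sub D D' f z a b : D `<=` D' -> has_diff_within D' f z a b ->
  has_diff_within D f z a b.
Proof.
move=> s H e e0; have := H e e0; rewrite !near_withinE; apply: filterS => w Hw Dw.
exact: Hw (s _ Dw).
Qed.

Lemma open_disk : open (@disk R).
Proof. by rewrite openE => z zd; exact: disk_near. Qed.

Lemma half_disk_sub : disk `&` upper_plane `<=` @closed_half_disk R.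
Proof. by move=> z [zd zu]; split=> //; exact: ltW. Qed.

End OneSidedDifferentials.

(** * The reflected sheets: Laplacian 0 off the axis, differentiability on it *)

Section SheetReflection.
Context {R : realType} {n : nat}.
Variables (f fx fy : 'I_3 -> R * R -> 'rV[R]_n).
Hypothesis C1f : forall i, C1_within closed_half_disk (f i) (fx i) (fy i).
Hypothesis harmf : harmonic_Y0 f.
Hypothesis tracef : forall i j (x : R), -1 < x < 1 -> f i (x, 0) = f j (x, 0).
Hypothesis normal0 : forall x : R, -1 < x < 1 -> \sum_j fy j (x, 0) = 0.

Lemma disk_axis (x : R) : disk (x, 0) <-> -1 < x < 1.
Proof.
rewrite /disk /sqnorm2 /= expr0n /= addr0 -ltr_norml -[X in _ < X](expr1n _ 2).
by rewrite -real_normK ?num_real // ltr_pXn2r ?nnegrE.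
Qed.

Lemma trace_fx i j (x : R) : -1 < x < 1 -> fx i (x, 0) = fx j (x, 0).
Proof.
move=> x1; have xd : disk (x, 0) by apply/disk_axis.
have cx : closed_half_disk (x, 0) by apply: half_disk_sub; split=> //=; exact: lexx.
have [_ _ Hi] := C1f i; have [_ _ Hj] := C1f j.
pose D : set (R * R) := disk `&` x_axis.
have sD : D `<=` closed_half_disk.
  by move=> z [zd z0]; apply: half_disk_sub; split=> //; rewrite /upper_plane /= z0.
have Dv : enters D (x, 0) e1.
  have [d d0 H] := enters_open e1 open_disk xd; exists d => // t tr.
  by split; [exact: H | rewrite /x_axis /= add0r /GRing.scale /= mulr0].
have := diff_unique_dir (has_diff_sub sD (Hi _ cx)) (has_diff_sub sD (Hj _ cx)) Dv Dv _ _.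
rewrite /= !scale1r !scale0r !addr0; apply; last exact: tracef.
move=> t t0 [td t2] _; move: td t2; case: (_ + _) => p q td /= q0.
by move: td; rewrite /x_axis /= in q0; rewrite q0 => /disk_axis; exact: tracef.
Qed.

Lemma coord_is_derive (g : R * R -> 'rV[R]_n) z v k : derivable g z v ->
  is_derive z v (coord g k) ('D_v g z 0 k).
Proof.
move=> dg; have dk := (derivable_mxP g z v).1 dg 0 k.
by apply: DeriveDef => //; rewrite derive_mx // mxE.
Qed.

Lemma harmonic_coord_laplacian (D : set (R * R)) (g : R * R -> 'rV[R]_n) z k :
  open D -> harmonic_on D g -> D z -> has_laplacian (coord g k) z 0.
Proof.
move=> oD [[_ [dg [_ [dg1 _ _]] [_ [dg2 _ _]]]] Lg] Dz.
have nD : \forall w \near z, D w by exact: open_nbhs_nbhs.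
exists (fun w => 'D_e1 g w 0 k), (fun w => 'D_e2 g w 0 k).
exists ('D_e1 (fun w => 'D_e1 g w) z 0 k), ('D_e2 (fun w => 'D_e2 g w) z 0 k); split.
- by apply: filterS nD => w Dw; apply: coord_is_derive; have [] := dg w Dw.
- by apply: (@coord_is_derive (fun w => 'D_e1 g w)); have [] := dg1 z Dz.
- by apply: filterS nD => w Dw; apply: coord_is_derive; have [] := dg w Dw.
- by apply: (@coord_is_derive (fun w => 'D_e2 g w)); have [] := dg2 z Dz.
- have := Lg z Dz; move: ('D_e1 _ z) ('D_e2 _ z) => A B AB.
  by have := congr1 (fun M : 'rV[R]_n => M 0 k) AB; rewrite !mxE.
Qed.

Lemma open_half_disk_open : open (@open_half_disk R).
Proof.
apply: openI; first exact: open_disk.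
apply: (@open_comp _ _ (fun z : R * R => z.2) [set t | 0 < t]); last exact: open_gt.
by move=> z _; exact: continuous_snd.
Qed.

Lemma coord_reflection i k w : coord (multi_sheeted_reflection f i) k w =
  if 0 <= w.2 then coord (f i) k w else
    - coord (f i) k (conjp w) + 2 / 3 * \sum_j coord (f j) k (conjp w).
Proof.
rewrite /coord /multi_sheeted_reflection; case: ifP => // _.
by rewrite !mxE summxE.
Qed.

Lemma reflection_axis_sdiff i k (x : R) : -1 < x < 1 ->
  sdiff (coord (multi_sheeted_reflection f i) k) (x, 0) (fx i (x, 0) 0 k) (fy i (x, 0) 0 k).
Proof.
move=> x1; have xd : disk (x, 0) by apply/disk_axis.
have cx : closed_half_disk (x, 0) by apply: half_disk_sub; split=> //=; exact: lexx.
have -> : coord (multi_sheeted_reflection f i) k = (fun w => if 0 <= w.2 then coord (f i) k w else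
    - coord (f i) k (conjp w) + 2 / 3 * \sum_j coord (f j) k (conjp w)).
  by apply/funext => w; exact: coord_reflection.
apply: (@reflect_sdiff _ closed_half_disk (fun j => coord (f j) k) i _ _ (fun j => fy j (x, 0) 0 k)) => //.
- by apply: filterS (disk_near xd) => w wd w0; apply: half_disk_sub.
- move=> j e e0; have [_ _ /(_ _ cx e e0)] := C1f j.
  rewrite near_withinE; apply: filterS => w Hw Dw; apply: le_trans (Hw Dw).
  by rewrite (trace_fx i j x1); apply: le_trans (coord_norm_le _ k); rewrite !mxE.
- by move=> j; rewrite /coord (tracef i j x1).
- by have := congr1 (fun M : 'rV[R]_n => M 0 k) (normal0 x1); rewrite summxE mxE.
Qed.

Lemma reflection_harmonic i k :
  harmonic_off_axis (coord (multi_sheeted_reflection f i) k).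
Proof.
pose U := coord (multi_sheeted_reflection f i) k.
have L j z : open_half_disk z -> has_laplacian (coord (f j) k) z 0.
  exact: harmonic_coord_laplacian open_half_disk_open (harmf j).
have C j z : open_half_disk z -> {for z, continuous (coord (f j) k)}.
  move=> zd; have [[cf _] _] := harmf j.
  exact: (continuous_comp (cf z zd) (@coord_continuous _ _ _ 0 k (f j z))).
move=> [x y] zd; have [y0|y0|y0] := ltgtP y 0.
- have cd : open_half_disk (conjp (x, y)).
    by split; [move: zd; rewrite /disk /sqnorm2 /= sqrrN | rewrite /= oppr_gt0].
  have E : \forall w \near ((x, y) : R * R), - coord (f i) k (conjp w)
      + 2 / 3 * \sum_j coord (f j) k (conjp w) = U w.
    have : \forall w \near ((x, y) : R * R), w.2 < 0.
      by have /cvgr_lt := @continuous_snd R (x, y); exact.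
    by apply: filterS => w w0; rewrite /U coord_reflection leNgt w0.
  split; last first.
    left; apply: (has_laplacian_near E).
    have -> : (fun w => - coord (f i) k (conjp w) + 2 / 3 * \sum_j coord (f j) k (conjp w)) =
       ((fun w => -1 * coord (f i) k w) \+ (fun w => 2 / 3 * \sum_j coord (f j) k w)) \o conjp.
      by apply/funext => w /=; rewrite mulN1r.
    apply: has_laplacian_conjp; rewrite -[X in has_laplacian _ _ X]addr0.
    apply: has_laplacianD.
      by rewrite -[X in has_laplacian _ _ X](mulr0 (-1)); apply: has_laplacianZ; exact: L.
    rewrite -[X in has_laplacian _ _ X](mulr0 (2 / 3)); apply: has_laplacianZ.
    by apply: (has_laplacian_sum _ (F := fun j => coord (f j) k)) => j; exact: L.
  have Ex := nbhs_singleton E; suff : U @ (x, y) --> U (x, y) by [].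
  rewrite -[in X in _ --> X]Ex.
  apply: cvg_trans (near_eq_cvg E) _.
  have CC j : (fun w => coord (f j) k (conjp w)) @ (x, y) --> coord (f j) k (conjp (x, y)).
    exact: (continuous_comp (@continuous_conjp R (x, y)) (C j _ cd)).
  apply: cvgD; first exact: cvgN.
  apply: cvgMl_tmp; elim: (index_enum _) => [|j s IH].
    by under eq_fun do rewrite big_nil; rewrite big_nil; exact: cvg_cst.
  by under eq_fun do rewrite big_cons; rewrite big_cons; apply: cvgD.
- have hd : open_half_disk (x, y) by [].
  have E : \forall w \near ((x, y) : R * R), coord (f i) k w = U w.
    have : \forall w \near ((x, y) : R * R), 0 < w.2.
      by have /cvgr_gt := @continuous_snd R (x, y); exact.
    by apply: filterS => w w0; rewrite /U coord_reflection ltW.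
  split; last by left; apply: (has_laplacian_near E); exact: L.
  have Ex := nbhs_singleton E; suff : U @ (x, y) --> U (x, y) by [].
  rewrite -[in X in _ --> X]Ex.
  by apply: cvg_trans (near_eq_cvg E) _; exact: C.
- rewrite y0 in zd *; have x1 := (disk_axis x).1 zd.
  have S := reflection_axis_sdiff i k x1.
  split; first exact: sdiff_continuous S.
  by right; split=> //; have [_ H] := sdiff_derive S; exists (fy i (x, 0) 0 k).
Qed.

End SheetReflection.

(** * The conormal and the normal derivatives *)

Section Conormal.
Context {R : realType} {n : nat}.
Implicit Types (z w v : R * R) (f h : R * R -> 'rV[R]_n) (D : set (R * R)) (a b u : 'rV[R]_n).

Lemma dotvC a b : dotv a b = dotv b a.
Proof. by rewrite !dotvE; apply: eq_bigr => k _; rewrite mulrC. Qed.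

Lemma dotvDr u a b : dotv u (a + b) = dotv u a + dotv u b.
Proof. by rewrite !dotvE -big_split; apply: eq_bigr => k _; rewrite mxE mulrDr. Qed.

Lemma dotvZr u (t : R) a : dotv u (t *: a) = t * dotv u a.
Proof. by rewrite !dotvE mulr_sumr; apply: eq_bigr => k _; rewrite mxE mulrCA. Qed.

Lemma dotvNr u a : dotv u (- a) = - dotv u a.
Proof. by rewrite -scaleN1r dotvZr mulN1r. Qed.

Lemma dotvDl u a b : dotv (a + b) u = dotv a u + dotv b u.
Proof. by rewrite dotvC dotvDr !(dotvC u). Qed.

Lemma dotvZl u (t : R) a : dotv (t *: a) u = t * dotv a u.
Proof. by rewrite dotvC dotvZr (dotvC u). Qed.

Lemma dotvNl u a : dotv (- a) u = - dotv a u.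
Proof. by rewrite dotvC dotvNr (dotvC u). Qed.

Lemma dotv_eq0 a : dotv a a = 0 -> a = 0.
Proof.
rewrite dotvE => /eqP; rewrite psumr_eq0 => [|k _]; last by rewrite -expr2 sqr_ge0.
move=> /allP H; apply/rowP => k; rewrite mxE.
by have /implyP/(_ isT) := H k (mem_index_enum _); rewrite mulf_eq0 orbb => /eqP.
Qed.

Lemma dotv_le u a : `|dotv u a| <= (\sum_k `|u 0 k|) * `|a|.
Proof.
rewrite dotvE; apply: le_trans (ler_norm_sum _ _ _) _.
rewrite mulr_suml; apply: ler_sum => k _; rewrite normrM.
by rewrite ler_wpM2l // coord_norm_le.
Qed.

Lemma dotv_approx_eq0 u a (S : set 'rV[R]_n) :
  (forall b, S b -> dotv u b = 0) ->
  (forall e : R, 0 < e -> exists2 b, S b & `|a - b| <= e) -> dotv u a = 0.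
Proof.
move=> uS Sa; apply/eqP; rewrite -normr_le0; apply/ler_addgt0Pr => e e0.
rewrite add0r; pose N := (\sum_k `|u 0 k|) + 1.
have N0 : 0 < N by rewrite ltr_wpDl // sumr_ge0.
have [b Sb ab] := Sa (e / N) (divr_gt0 e0 N0).
have -> : dotv u a = dotv u (a - b) by rewrite dotvDr dotvNr (uS b Sb) subr0.
apply: le_trans (dotv_le _ _) _; apply: (@le_trans _ _ (N * (e / N))).
  by apply: ler_pM => //; [rewrite sumr_ge0 | rewrite /N lerDl].
by rewrite mulrC divfK // gt_eqF.
Qed.

(** A right inverse of the matrix recovers (s, t) linearly from s a + t b; C bounds its entries, and
    the added 1 makes C positive. *)
Lemma row_free_bound a b : row_free (col_mx a b) ->
  exists2 C : R, 0 < C & forall s t, `|((s, t) : R * R)| <= C * `|s *: a + t *: b|.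
Proof.
move=> /row_freeP[B HB]; pose C := \sum_k \sum_j `|B k j| + 1.
exists C; first by rewrite ltr_wpDl // sumr_ge0 // => k _; rewrite sumr_ge0.
move=> s t; set v := s *: a + t *: b.
have E : row_mx s%:M t%:M = v *m B :> 'rV_(1 + 1).
  by rewrite /v -!mul_scalar_mx -mul_row_col -mulmxA HB mulmx1.
have bound j : `|(v *m B) 0 j| <= C * `|v|.
  rewrite mxE; apply: le_trans (ler_norm_sum _ _ _) _.
  rewrite /C mulrDl mul1r -[leLHS]addr0 lerD // mulr_suml; apply: ler_sum => k _.
  rewrite normrM mulrC ler_pM //; last exact: coord_norm_le.
  by rewrite (bigD1 j) //= lerDl sumr_ge0.
have s_ : s = (v *m B) 0 (lshift 1 0) by rewrite -E row_mxEl mxE eqxx mulr1n.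
have t_ : t = (v *m B) 0 (rshift 1 0) by rewrite -E row_mxEr mxE eqxx mulr1n.
by rewrite prod_normE ge_max /=; apply/andP; split; [rewrite [X in `|X|]s_|rewrite [X in `|X|]t_]; exact: bound.
Qed.

(** No differentiable transition map between two parametrizations is at hand, so tangent vectors are
    transferred by approximation. The point h (z1 + t v) equals f w, with w near z2 by continuity of
    the inverse, and comparing the first-order expansions shows that the differential of f at z2
    nearly sends (w - z2) / t to the image of v. That w lies in D2 is the information about
    direction used later. *)
Lemma tangent_transfer D1 D2 h f z1 z2 v (a1 b1 a2 b2 : 'rV[R]_n) :
  has_diff_within D1 h z1 a1 b1 -> enters D1 z1 v ->
  has_diff_within D2 f z2 a2 b2 -> row_free (col_mx a2 b2) ->
  D2 z2 -> inverse_continuous D2 f -> f z2 = h z1 ->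
  (exists2 d : R, 0 < d & forall t, 0 < t < d -> exists2 w, D2 w & f w = h (z1 + t *: v)) ->
  forall e : R, 0 < e -> exists (t : R) w, [/\ 0 < t, D2 w &
    `|v.1 *: a1 + v.2 *: b1 - (((w.1 - z2.1) / t) *: a2 + ((w.2 - z2.2) / t) *: b2)| <= e].
Proof.
move=> Hh Dv Hf rf Dz ic fh [d d0 Hd] e e0.
have [C C0 HC] := row_free_bound rf.
set c := v.1 *: a1 + v.2 *: b1; pose G := `|c| + e; have G0 : 0 < G by rewrite ltr_wpDl.
pose e1 := e / 2; have e10 : 0 < e1 by rewrite divr_gt0.
(* The first bound absorbs the error of f into |w - z2| and gives |w - z2| <= 2 C G t; the second
   then makes that error at most (e / 2) t. *)
pose e2 := Num.min (1 / (2 * C)) (e / (4 * C * G)).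
have e20 : 0 < e2 by rewrite lt_min !divr_gt0 // !mulr_gt0.
have e2C : e2 * (2 * C) <= 1 by rewrite -ler_pdivlMr ?mulr_gt0 // ge_min lexx.
have e2G : e2 * (4 * C * G) <= e by rewrite -ler_pdivlMr ?mulr_gt0 // ge_min lexx orbT.
have [d1 d10 H1] := diff_dir Hh Dv e10.
have := Hf e2 e20; rewrite near_withinE => HN.
have := ic z2 Dz _ HN => /nbhs_ballP[r /= r0 Hr].
(* As h moves by at most G t, the bound t < r / G keeps its value where the inverse of f is
   controlled. *)
pose t := Num.min (Num.min d d1) (r / G) / 2.
have m0 : 0 < Num.min (Num.min d d1) (r / G) by rewrite !lt_min d0 d10 divr_gt0.
have t0 : 0 < t by rewrite divr_gt0.
have : t < Num.min (Num.min d d1) (r / G) by rewrite ltr_pdivrMr // ltr_pMr // ltr1n.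
rewrite !lt_min => /andP[/andP[td td1] tr].
have [|w Dw fw] := Hd t; first by rewrite t0.
have K1 := H1 t; rewrite t0 td1 in K1; have {}K1 := K1 isT.
set E1 := h _ - h _ - _ in K1.
have hE : h (z1 + t *: v) - h z1 = t *: c + E1 by rewrite /E1 -/c [RHS]addrC subrK.
have nh : `|h (z1 + t *: v) - h z1| <= G * t.
  rewrite hE; apply: le_trans (ler_normD _ _) _; rewrite normrZ gtr0_norm //.
  by move: K1; rewrite /G /e1 -/c; set x := `|c|; set y := `|E1|; nra.
have wN : `|f w - f z2 - (w.1 - z2.1) *: a2 - (w.2 - z2.2) *: b2| <= e2 * `|w - z2|.
  apply: (Hr (h (z1 + t *: v))) => //.
  rewrite -ball_normE /= fh distrC; apply: le_lt_trans nh _.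
  by rewrite mulrC -ltr_pdivlMr.
pose L := (w.1 - z2.1) *: a2 + (w.2 - z2.2) *: b2.
have wL : `|w - z2| <= C * `|L| by exact: (HC (w.1 - z2.1) (w.2 - z2.2)).
have fL : `|f w - f z2 - L| <= e2 * `|w - z2| by rewrite /L opprD addrA.
have Lle : `|L| <= G * t + e2 * `|w - z2|.
  have -> : L = (f w - f z2) - (f w - f z2 - L) by rewrite opprB addrC subrK.
  apply: le_trans (ler_normB _ _) _; apply: lerD fL.
  by rewrite fw fh.
have w0 : 0 <= `|w - z2| by [].
have wt : `|w - z2| <= 2 * C * G * t.
  move: wL Lle e2C; set x := `|w - z2| in w0 *; set y := `|L| => wL Lle e2C.
  have : C * y <= C * (G * t + e2 * x) by rewrite ler_pM2l.
  have : e2 * (2 * C) * x <= 1 * x by rewrite ler_wpM2r.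
  by move: wL; lra.
exists t, w; split=> //; rewrite -(ler_pM2l t0).
have -> : t * `|c - (((w.1 - z2.1) / t) *: a2 + ((w.2 - z2.2) / t) *: b2)| = `|t *: c - L|.
  have Ht x : t * (x / t) = x by rewrite mulrC divfK // gt_eqF.
  rewrite -{1}(gtr0_norm t0) -normrZ scalerBr; congr (`|_ - _|).
  by rewrite scalerDr !scalerA !Ht.
have -> : t *: c - L = (f w - f z2 - L) - E1.
  by rewrite fw fh hE addrAC addrK.
apply: le_trans (ler_normB _ _) _; apply: le_trans (lerD fL K1) _.
have X : e2 * `|w - z2| <= e / 2 * t.
  apply: (@le_trans _ _ (e2 * (2 * C * G * t))); first by rewrite ler_pM2l.
  have : e2 * (4 * C * G) * t <= e * t by rewrite ler_pM2r.
  by lra.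
by move: X; rewrite /e1; lra.
Qed.

End Conormal.

Section ConormalOfSheet.
Context {R : realType} {n : nat}.
Implicit Types (z w v : R * R) (f h : R * R -> 'rV[R]_n) (D : set (R * R)) (a b u : 'rV[R]_n).

Lemma inverse_continuous_sub D D' f : D `<=` D' -> inverse_continuous D' f ->
  inverse_continuous D f.
Proof.
move=> s ic z Dz N Nz; apply: filterS (ic z (s _ Dz) N Nz) => y Hy w Dw.
exact: Hy (s _ Dw).
Qed.

Lemma parametrizes_row_free (W : set (R * R)) h M z (a b : 'rV[R]_n) : open W ->
  parametrizes (W `&` upper_plane) h M -> (W `&` upper_plane) z ->
  has_diff_within (W `&` upper_plane) h z a b -> row_free (col_mx a b).
Proof.
move=> oW [_ _ [hx [hy [[_ _ Hd] rf]]]] Wz H.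
have [-> ->] : a = hx z /\ b = hy z.
  have [Wz1 z2] := Wz; apply: (diff_within_unique H (Hd z Wz)).
    by apply: enters_upper => //=; exact: ler01.
  by apply: enters_upper => //=; exact: ler01.
exact: rf.
Qed.

(** The chart h in [outer_conormal] is unrelated to f, so both the tangent line of gamma and the
    inward side are carried over by [tangent_transfer]. The vectors a and b are orthogonal of equal
    length, which leaves a multiple of b of unit length, with the sign fixed by the inward side. *)
Lemma outer_conormalE (Sigma gamma : set 'rV[R]_n) f (x : R) (a b eta : 'rV[R]_n) :
  parametrizes (disk `&` upper_plane) f Sigma -> f @` (disk `&` x_axis) = gamma ->
  -1 < x < 1 -> has_diff_within (disk `&` upper_plane) f (x, 0) a b ->
  dotv a a = dotv b b -> dotv a b = 0 ->
  outer_conormal Sigma gamma (f (x, 0)) eta -> b = - (Num.sqrt (dotv a a)) *: eta.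
Proof.
move=> fP fgamma x1 Hf aabb ab0 [W [h [z [a' [b' [[oW Wz hz [N [oN hP hgamma]]] Hh [s0 [t0 [t00 etaE]]] etaa eta1]]]]]].
have xd : disk (x, 0) by apply/disk_axis.
have xD : (disk `&` upper_plane) (x, 0) by split=> //; rewrite /upper_plane /= lexx.
have [Wz1 z2] := Wz; have z20 : z.2 = 0 by [].
have zU : (W `&` upper_plane) z by split=> //; rewrite /upper_plane /= z20 lexx.
have rfa := parametrizes_row_free open_disk fP xD Hf.
have rfh := parametrizes_row_free oW hP zU Hh.
have [hS hic _] := hP; have [fS fic _] := fP.
have sW : W `&` x_axis `<=` W `&` upper_plane.
  by move=> w [Ww w0]; split=> //; rewrite /upper_plane /= (w0 : w.2 = 0) lexx.
have sD : disk `&` x_axis `<=` disk `&` @upper_plane R.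
  by move=> w [Ww w0]; split=> //; rewrite /upper_plane /= (w0 : w.2 = 0) lexx.
have Dv : enters (disk `&` x_axis) (x, 0) e1.
  have [d d0 H] := enters_open e1 open_disk xd; exists d => // t tr.
  by split; [exact: H | rewrite /x_axis /= add0r /GRing.scale /= mulr0].
have qN : N (f (x, 0)).
  have : (gamma `&` N) (f (x, 0)) by rewrite -hgamma; exists z.
  by case.
(* The tangent of gamma computed in the two charts. *)
have etafx : dotv eta a = 0.
  apply: (@dotv_approx_eq0 _ _ eta a [set v | exists s : R, v = s *: a']).
    by move=> v [s ->]; rewrite dotvZr etaa mulr0.
  move=> e e0.
  have [|t [w [_ [Ww w0] Hw]]] := @tangent_transfer _ _ _ (W `&` x_axis) f h (x, 0) z e1 a b a' b'
    (has_diff_sub sD Hf) Dv (has_diff_sub sW Hh) rfh Wz (inverse_continuous_sub sW hic) hz _ e e0.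
    have [d d0 Hd] := Dv.
    have [d1 d10 Hd1] := diff_dir (has_diff_sub sD Hf) Dv ltr01.
    have : nbhs (f (x, 0)) N by exact: open_nbhs_nbhs.
    move=> /nbhs_ballP[r /= r0 Hr].
    pose G := `|e1.1 *: a + e1.2 *: b| + 1; have G0 : 0 < G by rewrite ltr_wpDl.
    exists (Num.min (Num.min d d1) (r / G)); first by rewrite !lt_min d0 d10 divr_gt0.
    move=> t /andP[t_gt0]; rewrite !lt_min => /andP[/andP[td td1] tr].
    have Dt := Hd t; rewrite t_gt0 td in Dt; have {}Dt := Dt isT.
    have Ft := Hd1 t; rewrite t_gt0 td1 in Ft; have {}Ft := Ft isT.
    suff : (h @` (W `&` x_axis)) (f ((x, 0) + t *: e1)) by move=> [w Ww hw]; exists w.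
    rewrite hgamma; split; first by rewrite -fgamma; exists ((x, 0) + t *: e1).
    apply: Hr; rewrite -ball_normE /= distrC; apply: (@le_lt_trans _ _ (t * G)); last by rewrite -ltr_pdivlMr.
    set c := e1.1 *: a + e1.2 *: b in Ft G G0 tr *.
    have -> : f ((x, 0) + t *: e1) - f (x, 0) = (f ((x, 0) + t *: e1) - f (x, 0) - t *: c) + t *: c.
      by rewrite subrK.
    apply: le_trans (ler_normD _ _) _; rewrite normrZ gtr0_norm // /G mulrDr mulr1 addrC lerD //.
    by rewrite mul1r in Ft.
  exists (((w.1 - z.1) / t) *: a'); first by exists ((w.1 - z.1) / t).
  move: Hw; rewrite (w0 : w.2 = 0) z20 subrr mul0r scale0r addr0.
  by rewrite /= scale1r scale0r addr0.
have eta_eta : dotv eta eta = 1.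
  by rewrite -[LHS]sqr_sqrtr ?dotv_ge0 // -/(enorm eta) eta1 expr1n.
pose c0 := dotv a a.
have c00 : 0 < c0.
  rewrite lt_def dotv_ge0 andbT; apply/eqP => /dotv_eq0 a0.
  have [C C0 HC] := row_free_bound rfa.
  have := HC 1 0; rewrite a0 scaler0 scale0r addr0 normr0 mulr0 leNgt => /negP; apply.
  by rewrite prod_normE /= normr1 normr0 lt_max ltr01.
(* -eta points into the sheet, so it is a limit of combinations of a and b
   with nonnegative b-coefficient. *)
have Hin (e : R) : 0 < e -> exists2 p : R * R, 0 <= p.2 & `|(- eta) - (p.1 *: a + p.2 *: b)| <= e.
  move=> e0; pose v : R * R := (- s0, - t0).
  have v2 : 0 <= v.2 by rewrite /= oppr_ge0 ltW.
  have Wv : enters (W `&` upper_plane) z v by apply: enters_upper => //; rewrite z20.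
  have [|t [w [t_gt0 [_ w2] Hw]]] := @tangent_transfer _ _ _ _ h f z (x, 0) v a' b' a b
    Hh Wv Hf rfa xD fic (esym hz) _ e e0.
    have [d d0 Hd] := Wv; exists d => // t /Hd Ht.
    have : (Sigma `&` N) (h (z + t *: v)) by rewrite -hS; exists (z + t *: v).
    by move=> [+ _]; rewrite -fS => -[w Dw fw]; exists w.
  exists ((w.1 - x) / t, (w.2 - 0) / t); first by rewrite /= subr0 divr_ge0 // ltW.
  move: Hw => /=; suff -> : - s0 *: a' + - t0 *: b' = - eta by [].
  by rewrite etaE opprD !scaleNr.
pose l := dotv b (- eta) / c0.
have lc : l * c0 = dotv b (- eta) by rewrite divfK // gt_eqF.
(* The remainder d is orthogonal to a and b, hence also to -eta, which is a limit of their
   combinations; so d is orthogonal to itself. *)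
have etal : - eta = l *: b.
  apply/eqP; rewrite -subr_eq0; apply/eqP; apply: dotv_eq0.
  set d := - eta - l *: b.
  have da : dotv d a = 0.
    by rewrite /d dotvDl !dotvNl dotvZl etafx (dotvC b a) ab0 mulr0 oppr0 addr0.
  have db : dotv d b = 0.
    by rewrite /d dotvDl dotvNl dotvNl dotvZl -aabb -/c0 lc dotvNr (dotvC b) opprK addrC subrr.
  rewrite {2}/d dotvDr (dotvNr d (l *: b)) dotvZr db mulr0 subr0.
  apply: (@dotv_approx_eq0 _ _ d (- eta) [set v | exists p : R * R, v = p.1 *: a + p.2 *: b]).
    by move=> v [p ->]; rewrite dotvDr !dotvZr da db !mulr0 addr0.
  by move=> e e0; have [p _ Hp] := Hin e e0; exists (p.1 *: a + p.2 *: b) => //; exists p.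
have l0 : 0 <= l.
  rewrite leNgt; apply/negP => ln.
  have nb : 0 < (\sum_k `|b 0 k|) + 1 by rewrite ltr_wpDl // sumr_ge0.
  (* With this tolerance, pairing with b changes by at most half of |l c0|, too little to carry the
     negative l c0 to some p.2 c0 >= 0. *)
  have e0 : 0 < - l * c0 / 2 / ((\sum_k `|b 0 k|) + 1).
    by rewrite divr_gt0 // divr_gt0 // mulr_gt0 // oppr_gt0.
  have [p p2 Hp] := Hin _ e0.
  have : `|dotv b (- eta - (p.1 *: a + p.2 *: b))| <= - l * c0 / 2.
    apply: le_trans (dotv_le _ _) _.
    apply: (@le_trans _ _ (((\sum_k `|b 0 k|) + 1) * (- l * c0 / 2 / ((\sum_k `|b 0 k|) + 1)))).
      by apply: ler_pM => //; [rewrite sumr_ge0 | rewrite lerDl].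
    by rewrite mulrC divfK // gt_eqF.
  rewrite dotvDr (dotvNr b (_ + _)) dotvDr !dotvZr (dotvC b a) ab0 mulr0 add0r -aabb -/c0 -lc.
  rewrite ler_norml => /andP[+ _].
  have lc0 : l * c0 < 0 by rewrite nmulr_rlt0.
  have pc0 : 0 <= p.2 * c0 by rewrite mulr_ge0 // ltW.
  rewrite !mulNr; lra.
have l2 : l ^+ 2 * c0 = 1.
  have : dotv (- eta) (- eta) = 1 by rewrite dotvNl dotvNr opprK.
  by rewrite etal dotvZl dotvZr mulrA -expr2 -aabb.
have lsq : Num.sqrt c0 * l = 1.
  apply/eqP; rewrite -(@pexpr_eq1 _ _ 2) //; last by apply: mulr_ge0 l0; exact: sqrtr_ge0.
  rewrite exprMn sqr_sqrtr ?(ltW c00) //.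
  by rewrite mulrC l2.
by rewrite -/c0 scaleNr -scalerN etal scalerA lsq scale1r.
Qed.

End ConormalOfSheet.

(** * Neighbourhoods on which the reflected map is an embedding *)

Section Embedding.
Context {R : realType} {n : nat}.
Implicit Types (z w v : R * R) (U : R * R -> 'rV[R]_n) (A : set (R * R)) (r : R).

Lemma norm_ballE z r w : ball z r w = (`|z - w| < r).
Proof. by rewrite -ball_normE. Qed.

(* The radii are maximal dyadic ones, hence comparable at nearby points; a point
   of the small ball around b whose image is close to that of the small ball
   around a then lies in the larger ball around a, where U is an embedding. *)
Lemma embedding_nbhd U A (P : R * R -> R -> Prop) :
  (forall a b r s, P a r -> ball b s `<=` ball a r -> P b s) ->
  (forall a r, P a r -> inverse_continuous (ball a r) U) ->
  (forall a, A a -> exists2 r, 0 < r & P a r) ->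
  (forall a, A a -> {for a, continuous U}) -> inverse_continuous A U ->
  exists O, [/\ open O, A `<=` O, inverse_continuous O U &
    forall z, O z -> exists a r, P a r /\ ball a r z].
Proof.
move=> Pmono Pic PA cU icA.
pose e (k : nat) : R := 2^-1 ^+ k.
have e0 k : 0 < e k by rewrite exprn_gt0 // invr_gt0.
have eS k : e k.+1 = e k / 2 by rewrite /e exprSr.
have le_e j k : (j <= k)%N -> e k <= e j.
  by move=> jk; apply: ler_wiXn2l => //; rewrite ?invr_ge0 // invf_le1 ?ler1n.
have kP a : exists k, A a -> P a (e k) /\ forall j, P a (e j) -> (k <= j)%N.
  have [Aa|nAa] := pselect (A a); last by exists 0%N.
  have [r r0 Pr] := PA a Aa.
  have ex : exists k, `[< P a (e k) >].
    have : e @ \oo --> (0 : R).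
      by apply: cvg_expr; rewrite ger0_norm ?invr_ge0 // invf_lt1 ?ltr1n.
    move=> /cvgrPdist_lt/(_ r r0)[k _ /(_ k (leqnn k))] /=.
    rewrite sub0r normrN gtr0_norm // => kr; exists k; apply/asboolP.
    by apply: Pmono Pr _ => w; rewrite !norm_ballE => /lt_trans; apply.
  have [k /asboolP Pk kmin] := ex_minnP ex.
  by exists k => _; split=> // j Pj; apply: kmin; exact/asboolP.
have [k {}kP] := choice kP; pose r a := e (k a).
have r0 a : 0 < r a by exact: e0.
have Pr a : A a -> P a (r a) by move=> /kP[].
(* The ball of radius r b / 2 around a lies in the ball of radius r b around b, so P holds on it; r
   b / 2 is again dyadic, and r a is maximal. *)
have half a b : A a -> A b -> `|a - b| < r b / 2 -> r b / 2 <= r a.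
  move=> Aa Ab ab; rewrite -eS; apply: le_e; have [_ kmin] := kP a Aa; apply: kmin.
  apply: Pmono (Pr b Ab) _ => w; rewrite !norm_ballE eS => aw.
  apply: le_lt_trans (ler_distD a _ _) _.
  by rewrite [ltRHS]splitr; apply: (ltrD _ aw); rewrite distrC.
(* Continuity of the inverse on A, made quantitative: within A, image distance below s a forces
   distance below r a / 4. The value off A is arbitrary. *)
have sP a : exists s, A a -> 0 < s /\ forall w, A w -> `|U a - U w| < s -> `|a - w| < r a / 4.
  have [Aa|nAa] := pselect (A a); last by exists 0.
  have r4 : 0 < r a / 4 by rewrite divr_gt0.
  have /nbhs_ballP[s /= s0 Hs] := icA a Aa _ (nbhsx_ballx a _ r4).
  exists s => _; split=> // w Aw aw; rewrite -norm_ballE.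
  by apply: (Hs (U w)) => //; rewrite -ball_normE.
have [s {}sP] := choice sP.
have dP a : exists d, A a -> [/\ 0 < d, d <= r a / 16 & forall z, ball a d z -> `|U a - U z| < s a / 4].
  have [Aa|nAa] := pselect (A a); last by exists 0.
  have [s0 _] := sP a Aa; have s4 : 0 < s a / 4 by rewrite divr_gt0.
  have /cvgrPdist_lt/(_ _ s4)/nbhs_ballP[d /= d0 Hd] := cU a Aa.
  exists (Num.min d (r a / 16)) => _; split.
  - by rewrite lt_min d0 divr_gt0.
  - by rewrite ge_min lexx orbT.
  - move=> z; rewrite norm_ballE lt_min => /andP[zd _]; apply: Hd.
    by rewrite norm_ballE.
have [d {}dP] := choice dP.
pose O := \bigcup_(a in A) ball a (d a).
exists O; split.
- by apply: bigcup_open => a _; exact: ball_open.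
- by move=> a Aa; exists a => //; rewrite norm_ballE subrr normr0; have [] := dP a Aa.
- move=> z [a Aa za] N Nz.
  have [d0 dr Hd] := dP a Aa; have [s0 Hs] := sP a Aa.
  have Ua := Hd z za.
  have zr : ball a (r a) z.
    move: za; rewrite !norm_ballE => za; apply: (lt_le_trans za); apply: le_trans dr _.
    by rewrite ler_pdivrMr // ler_pMr // ler1n.
  have ny : \forall y \near U z, `|U z - y| < s a / 4.
    have s4 : 0 < s a / 4 by rewrite divr_gt0.
    by have := nbhsx_ballx (U z) _ s4; rewrite -ball_normE.
  apply: filterS2 ny (Pic a (r a) (Pr a Aa) z zr N Nz) => y zy Hy w [b Ab wb] Uw.
  apply: Hy => //; rewrite norm_ballE in wb; rewrite norm_ballE.
  have [d0' dr' Hd'] := dP b Ab; have [s0' Hs'] := sP b Ab.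
  have Ub : `|U b - U w| < s b / 4 by apply: Hd'; rewrite norm_ballE.
  have Uab : `|U a - U b| < s a / 4 + s a / 4 + s b / 4.
    have -> : U a - U b = (U a - U z) + (U z - y) + (U w - U b).
      by rewrite Uw !addrA !subrK.
    apply: le_lt_trans (ler_normD _ _) _; rewrite ltrD //; last by rewrite distrC.
    by apply: le_lt_trans (ler_normD _ _) _; rewrite ltrD.
  have ra0 := r0 a; have rb0 := r0 b.
  have ab_w : `|a - w| <= `|a - b| + `|b - w|.
    exact: ler_distD.
  (* The images of a and b are closer than 3/4 of the larger of s a and s b, so the point with the
     larger one controls |a - b|. Then [half] compares the radii, and |b - w| < r b / 16 leaves room
     to conclude |a - w| < r a. *)
  have [sab|sab] := leP (s b) (s a).
    have ab : `|a - b| < r a / 4 by apply: Hs => //; lra.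
    have rb : r b <= 2 * r a.
      rewrite leNgt; apply/negP => rb.
      have : r b / 2 <= r a by apply: half => //; lra.
      by lra.
    by lra.
  have ba : `|b - a| < r b / 4 by apply: Hs' => //; rewrite distrC; lra.
  rewrite distrC in ba.
  have : r b / 2 <= r a by apply: half => //; lra.
  by lra.
- move=> z [a Aa za]; exists a, (r a); split; first exact: Pr.
  have [_ dr _] := dP a Aa; move: za; rewrite !norm_ballE => za.
  apply: (lt_le_trans za); apply: le_trans dr _.
  by rewrite ler_pdivrMr // ler_pMr // ler1n.
Qed.

(** Strict differentiability: both z and w vary, which is what turns an injective differential into
    local injectivity. It follows from the Taylor estimate at w and continuity of the partial
    derivatives at a. *)
Lemma disk_series_strict (u : R * R -> R) a (e : R) : disk_series u -> disk a -> 0 < e ->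
  \forall d \near (0 : R)^'+, forall z w, `|z - a| < d -> `|w - a| < d ->
    `|u z - u w - (z.1 - w.1) * 'D_e1 u a - (z.2 - w.2) * 'D_e2 u a| <= e * `|z - w|.
Proof.
move=> hu /disk_radius[r [r01 ar]] e0; have /andP[r0 r1] := r01.
have [al [be [Hab uE]]] := hu r r01; have [s [sr as_]] := mid_radius r0 ar.
have [C HC] := pser_taylor r0 Hab sr.
have /andP[s0 s1] := sr.
have s2r2 : s ^+ 2 < r ^+ 2 by rewrite ltr_pXn2r // nnegrE ltW.
pose D := `|C| + 1; have D0 : 0 < D by rewrite ltr_wpDl.
have ad : disk a by apply: (sub_disk r01); exact: ltW.
have e4 : 0 < e / 4 by rewrite divr_gt0.
have c1 := disk_series_continuous (disk_seriesD1 hu) ad.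
have c2 := disk_series_continuous (disk_seriesD2 hu) ad.
have /cvgrPdist_lt/(_ _ e4)/nbhs_ballP[d1 /= d10 H1] := c1.
have /cvgrPdist_lt/(_ _ e4)/nbhs_ballP[d2 /= d20 H2] := c2.
have /nbhs_ballP[d3 /= d30 H3] := open_disk_near as_.
near=> d => z w za wa.
have dd1 : d < d1 by near: d; exact: nbhs_right_lt.
have dd2 : d < d2 by near: d; exact: nbhs_right_lt.
have dd3 : d < d3 by near: d; exact: nbhs_right_lt.
(* As |z - w| < 2 d, the quadratic remainder is at most (e / 2) |z - w|; the two changes of partial
   derivatives take e / 4 each. *)
have dd4 : d < e / (8 * D) by near: d; apply: nbhs_right_lt; rewrite divr_gt0 // mulr_gt0.
have inb x t : `|x - a| < d -> d < t -> ball a t x.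
  by move=> xa dt; rewrite norm_ballE distrC; exact: lt_trans dt.
have zs := H3 z (inb _ _ za dd3); have ws := H3 w (inb _ _ wa dd3).
have K1 := H1 w (inb _ _ wa dd1); have K2 := H2 w (inb _ _ wa dd2).
have [_ E1 E2] := pser_local r0 Hab uE (lt_trans ws s2r2).
have T := HC z w (ltW zs) (ltW ws).
move: T K1 K2; rewrite -E1 -E2 -!uE ?(lt_trans _ s2r2) //.
move: ('D_e1 u w) ('D_e2 u w) ('D_e1 u a) ('D_e2 u a) => A B A' B' T K1 K2.
have n1 : `|z.1 - w.1| <= `|z - w| by rewrite prod_normE le_max lexx.
have n2 : `|z.2 - w.2| <= `|z - w| by rewrite prod_normE le_max lexx orbT.
have zw : `|z - w| < d + d.
  by apply: le_lt_trans (ler_distD a _ _) _; rewrite ltrD // distrC.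
have -> : u z - u w - (z.1 - w.1) * A' - (z.2 - w.2) * B' =
  (u z - u w - (z.1 - w.1) * A - (z.2 - w.2) * B) - (z.1 - w.1) * (A' - A) - (z.2 - w.2) * (B' - B) by ring.
apply: le_trans (ler_normB _ _) _; apply: le_trans (lerD (ler_normB _ _) (lexx _)) _.
have Q : C * sqnorm2 (z - w) <= e / 2 * `|z - w|.
  apply: (@le_trans _ _ (D * (2 * `|z - w| ^+ 2))).
    apply: le_trans (ler_norm _) _; rewrite normrM ler_pM //; first by rewrite /D lerDl.
    by rewrite ger0_norm ?sqnorm2_ge0 // sqnorm2_le_norm.
  have -> : D * (2 * `|z - w| ^+ 2) = (2 * D * `|z - w|) * `|z - w| by ring.
  rewrite ler_wpM2r //; move: dd4; rewrite ltr_pdivlMr ?mulr_gt0 //.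
  have : D * `|z - w| < D * (d + d) by rewrite ltr_pM2l.
  by lra.
have P1 : `|(z.1 - w.1) * (A' - A)| <= e / 4 * `|z - w|.
  by rewrite normrM mulrC ler_pM // ltW.
have P2 : `|(z.2 - w.2) * (B' - B)| <= e / 4 * `|z - w|.
  by rewrite normrM mulrC ler_pM // ltW.
by move: T Q P1 P2; lra.
Unshelve. all: by end_near. Qed.

Lemma coords_series_strict U a (e : R) : coords_series U -> disk a -> 0 < e ->
  \forall d \near (0 : R)^'+, forall z w, `|z - a| < d -> `|w - a| < d ->
    `|U z - U w - ((z.1 - w.1) *: 'D_e1 U a + (z.2 - w.2) *: 'D_e2 U a)| <= e * `|z - w|.
Proof.
move=> hU ad e0.
have Hk k : \forall d \near (0 : R)^'+, forall z w, `|z - a| < d -> `|w - a| < d ->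
    `|coord U k z - coord U k w - (z.1 - w.1) * 'D_e1 U a 0 k - (z.2 - w.2) * 'D_e2 U a 0 k| <= e * `|z - w|.
  have [F1 F2] := coord_derive12 k hU ad.
  apply: filterS (disk_series_strict (hU k) ad e0) => d Hd z w za wa.
  by rewrite F1 F2; exact: Hd.
move: Hk => /filter_forall; apply: filterS => d Hd z w za wa.
apply: rV_norm_le => [|k]; first by rewrite mulr_ge0 // ltW.
have := Hd k z w za wa; move: ('D_e1 U a) ('D_e2 U a) => A B.
by rewrite !mxE opprD addrA.
Qed.

Lemma coords_series_local_embedding U a : coords_series U -> disk a ->
  row_free (col_mx ('D_e1 U a) ('D_e2 U a)) ->
  \forall d \near (0 : R)^'+, inverse_continuous (ball a d) U.
Proof.
move=> hU ad rf; have [C C0 HC] := row_free_bound rf.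
(* With this tolerance the error is at most |z - w| / (2 C), so half of |z - w| is absorbed and |z -
   w| <= 2 C |U z - U w| remains. *)
have e0 : 0 < 1 / (2 * C) by rewrite divr_gt0 // mulr_gt0.
apply: filterS (coords_series_strict hU ad e0) => d Hd z zd N /nbhs_ballP[r /= r0 Hr].
have r2C : 0 < r / (2 * C) by rewrite divr_gt0 // mulr_gt0.
apply: filterS (nbhsx_ballx (U z) _ r2C) => y yr w wd Uw.
apply: Hr; rewrite norm_ballE; rewrite -ball_normE /= in yr.
rewrite !norm_ballE in zd wd.
have := Hd z w; rewrite ![`|_ - a|]distrC => /(_ zd wd); rewrite Uw.
have := HC (z.1 - w.1) (z.2 - w.2).
set L := _ *: _ + _ *: _ => LC H; move: LC.
have -> : (z.1 - w.1, z.2 - w.2) = z - w by [].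
move=> LC.
have Ln : `|L| <= `|U z - y| + 1 / (2 * C) * `|z - w|.
  have -> : L = (U z - y) - (U z - y - L) by rewrite opprB addrC subrK.
  by apply: le_trans (ler_normB _ _) _; rewrite lerD2l.
move: yr; rewrite ltr_pdivlMr ?mulr_gt0 // => yr.
have : C * `|L| <= C * (`|U z - y| + 1 / (2 * C) * `|z - w|) by rewrite ler_pM2l.
have -> : C * (`|U z - y| + 1 / (2 * C) * `|z - w|) = C * `|U z - y| + `|z - w| / 2.
  by field; rewrite gt_eqF.
by move: LC; lra.
Qed.

Lemma conformal_row_free (a b : 'rV[R]_n) : dotv a a = dotv b b -> dotv a b = 0 ->
  a != 0 -> row_free (col_mx a b).
Proof.
move=> ab ab0 a0; apply: inj_row_free => v; rewrite -[v]hsubmxK mul_row_col.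
have aa : dotv a a != 0 by apply: contra a0 => /eqP /dotv_eq0 ->.
rewrite [lsubmx v]mx11_scalar [rsubmx v]mx11_scalar !mul_scalar_mx => H.
move: H; set s := lsubmx v 0 0; set t := rsubmx v 0 0 => H.
have s0 : s = 0.
  have := congr1 (dotv a) H; rewrite dotvDr !dotvZr ab0 mulr0 addr0.
  have -> : dotv a 0 = 0 by rewrite -(scale0r a) dotvZr mul0r.
  by move=> /eqP; rewrite mulf_eq0 (negbTE aa) orbF => /eqP.
have t0 : t = 0.
  have := congr1 (dotv b) H; rewrite dotvDr !dotvZr dotvC ab0 mulr0 add0r -ab.
  have -> : dotv b 0 = 0 by rewrite -(scale0r b) dotvZr mul0r.
  by move=> /eqP; rewrite mulf_eq0 (negbTE aa) orbF => /eqP.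
by rewrite s0 t0 !raddf0 row_mx0.
Qed.

End Embedding.

(** * Balancing of the normal derivatives and the extended surface *)

Section ExtendedSheet.
Context {R : realType} {n : nat}.
Variables (f fx fy : 'I_3 -> R * R -> 'rV[R]_n).
Hypothesis C1f : forall i, C1_within closed_half_disk (f i) (fx i) (fy i).
Hypothesis conff : forall i z, closed_half_disk z ->
  enorm (fx i z) = enorm (fy i z) /\ dotv (fx i z) (fy i z) = 0.
Hypothesis harmf : harmonic_Y0 f.
Hypothesis tracef : forall i j (x : R), -1 < x < 1 -> f i (x, 0) = f j (x, 0).
Variables (Sigma : 'I_3 -> set 'rV[R]_n) (gamma : set 'rV[R]_n).
Hypothesis paramf : parametrizes_sheets f Sigma gamma.

(** The sheets share f_x along the axis, so the factor in f_y = -|f_x| eta is common to the three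
    and the balance of the conormals passes to the f_y. *)
Lemma sheets_normal_sum (eta : 'I_3 -> 'rV[R]_n -> 'rV[R]_n) :
  (forall i q, gamma q -> outer_conormal (Sigma i) gamma q (eta i q)) ->
  (forall q, gamma q -> \sum_(i < 3) eta i q = 0) ->
  forall x : R, -1 < x < 1 -> \sum_j fy j (x, 0) = 0.
Proof.
move=> Heta eta0 x x1; pose i0 : 'I_3 := ord0; pose q := f i0 (x, 0).
have xD : (disk `&` upper_plane) (x, 0).
  by split; [exact/disk_axis | rewrite /upper_plane /= lexx].
have xC := half_disk_sub xD.
have gq : gamma q.
  have [_ <-] := paramf i0; exists (x, 0) => //.
  by split; [exact/disk_axis | rewrite /x_axis].
have E j : fy j (x, 0) = - (Num.sqrt (dotv (fx i0 (x, 0)) (fx i0 (x, 0)))) *: eta j q.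
  have [Pj gj] := paramf j; have [_ _ Dj] := C1f j.
  have [/enorm_eq nj oj] := conff j xC.
  rewrite (trace_fx C1f tracef i0 j x1).
  apply: (outer_conormalE Pj gj x1 (has_diff_sub half_disk_sub (Dj _ xC)) nj oj).
  by rewrite (tracef j i0 x1); exact: Heta.
under eq_bigr => j _ do rewrite E.
by rewrite -scaler_sumr eta0 // scaler0.
Qed.

Variable i : 'I_3.
Let U := multi_sheeted_reflection f i.
Hypothesis harmU : forall k, harmonic_off_axis (coord U k).

Let seriesU : coords_series U.
Proof. by move=> k; exact: harmonic_off_axis_series. Qed.

Lemma reflection_upper z : 0 <= z.2 -> U z = f i z.
Proof. by rewrite /U /multi_sheeted_reflection => ->. Qed.

Lemma reflection_partials z : (disk `&` upper_plane) z ->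
  'D_e1 U z = fx i z /\ 'D_e2 U z = fy i z.
Proof.
move=> zD; have [zd z0] := zD; have zC := half_disk_sub zD.
have [_ _ Hf] := C1f i.
have HU := has_diff_sub (D := disk `&` upper_plane) (fun w (wD : (disk `&` upper_plane) w) => wD.1)
  (coords_series_diff seriesU zd).
have {}Hf := has_diff_sub half_disk_sub (Hf _ zC).
have agree v (t : R) : 0 < t -> (disk `&` upper_plane) (z + t *: v) ->
  (disk `&` upper_plane) (z + t *: v) -> U (z + t *: v) = f i (z + t *: v).
  by move=> _ [_ w0] _; exact: reflection_upper.
have en v : 0 <= v.2 -> enters (disk `&` upper_plane) z v.
  by move=> v0; apply: enters_upper => //; exact: open_disk.
have Uz : U z = f i z by exact: reflection_upper.
split.
  have := diff_unique_dir HU Hf (en e1 (lexx _)) (en e1 (lexx _)) (agree e1) Uz.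
  by rewrite /= !scale1r !scale0r !addr0.
have := diff_unique_dir HU Hf (en e2 ler01) (en e2 ler01) (agree e2) Uz.
by rewrite /= !scale1r !scale0r !add0r.
Qed.

Lemma reflection_conformal z : disk z ->
  enorm ('D_e1 U z) = enorm ('D_e2 U z) /\ dotv ('D_e1 U z) ('D_e2 U z) = 0.
Proof.
apply: (coords_series_conformal seriesU) => w wd w0.
have wD : (disk `&` upper_plane) w by [].
have [E1 E2] := reflection_partials wD; rewrite E1 E2.
exact/conff/half_disk_sub.
Qed.

(** For a conformal map full rank means U_x != 0, which is an open condition and holds at a because
    f_i is an immersion there. *)
Lemma reflection_immersed_near a : (disk `&` upper_plane) a ->
  \forall z \near a, disk z /\ row_free (col_mx ('D_e1 U z) ('D_e2 U z)).
Proof.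
move=> aD; have [ad a0] := aD; have [D1s _] := coords_seriesD seriesU.
have [Pf _] := paramf i; have [_ _ Hf] := C1f i.
have rf := parametrizes_row_free open_disk Pf aD (has_diff_sub half_disk_sub (Hf _ (half_disk_sub aD))).
have [E1 E2] := reflection_partials aD.
have na : 'D_e1 U a != 0.
  rewrite E1; apply/eqP => fx0; have [C C0 HC] := row_free_bound rf.
  have := HC 1 0; rewrite fx0 scaler0 scale0r addr0 normr0 mulr0 leNgt => /negP; apply.
  by rewrite prod_normE /= normr1 normr0 lt_max ltr01.
have nn : \forall z \near a, 'D_e1 U z != 0.
  have cD := coords_series_continuous D1s ad.
  have /cvgrPdist_lt/(_ `|'D_e1 U a|) := cD.
  rewrite normr_gt0 => /(_ na); apply: filterS => z.
  move: ('D_e1 U z) ('D_e1 U a) => p q; apply: contraTneq => ->.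
  by rewrite subr0 ltxx.
apply: filterS2 nn (disk_near ad) => z nz zd; split=> //.
by have [/enorm_eq e o] := reflection_conformal zd; exact: conformal_row_free.
Qed.

Lemma reflection_extension : exists M, analytic_extension_by (Sigma i) U M.
Proof.
have [[fS fic _] _] := paramf i.
have anU : real_analytic_on disk U := coords_analytic harmU.
(* These properties pass to smaller balls, as [embedding_nbhd] requires. Only continuity of the
   inverse has to be glued over the balls; the other two hold pointwise on their union. *)
pose P a (r : R) := [/\ ball a r `<=` disk, inverse_continuous (ball a r) U &
  forall z, ball a r z -> row_free (col_mx ('D_e1 U z) ('D_e2 U z))].
have [|||||O [oO AO icO OP]] := @embedding_nbhd _ _ U (disk `&` upper_plane) P.
- move=> a b r s [H1 H2 H3] sub; split.
  + by move=> z /sub /H1.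
  + exact: inverse_continuous_sub sub H2.
  + by move=> z /sub /H3.
- by move=> a r [].
- move=> a aD; have [ad _] := aD.
  have /nbhs_ballP[r /= r0 Hr] := reflection_immersed_near aD.
  have rfa := (nbhs_singleton (reflection_immersed_near aD)).2.
  have N : \forall d \near (0 : R)^'+, [/\ 0 < d, d < r & inverse_continuous (ball a d) U].
    near=> d; split; near: d; [exact: nbhs_right_gt | exact: nbhs_right_lt |].
    exact: coords_series_local_embedding.
  have [d [d0 dr icd]] := filter_ex N.
  have sub (z : R * R) : ball a d z -> ball a r z by rewrite !norm_ballE => /lt_trans; apply.
  exists d; first exact: d0.
  split; [|exact: icd|]; move=> z /sub /Hr [zd rfz]; [exact: zd|exact: rfz].
- by move=> a [ad _]; exact: coords_series_continuous.
- move=> z zD N Nz; have [_ z0] := zD.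
  rewrite (reflection_upper z0); apply: filterS (fic z zD N Nz) => y Hy w wD Uw.
  by apply: Hy => //; rewrite -reflection_upper //; have [] := wD.
have Od : O `<=` disk by move=> z /OP[a [r [[sub _ _] /sub]]].
have UO M : U @` O = M -> parametrizes O U M.
  move=> UM; split=> //; exists (fun z => 'D_e1 U z), (fun z => 'D_e2 U z); split.
    have [c1 c2 H] := coords_series_C1 seriesU; split.
    - exact: continuous_subspaceW Od c1.
    - exact: continuous_subspaceW Od c2.
    - by move=> z /Od /H; exact: has_diff_sub.
  by move=> z /OP[a [r [[_ _ H] /H]]].
exists (U @` O); split=> //.
(* The single chart U on O serves at every point of M, with the whole space as ambient
   neighbourhood. *)
- move=> q Mq; exists O, U; split; last by move=> z /Od; exact: anU.
  split=> //; exists setT; split=> //; first exact: openT.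
  by rewrite setIT; exact: UO.
- rewrite -fS => _ [z zD <-]; exists z; first exact: AO.
  by rewrite reflection_upper //; have [] := zD.
- by exists O; split=> //; exact: UO.
Unshelve. all: by end_near. Qed.

End ExtendedSheet.
Theorem theorem7 (R : realType) (n : nat)
    (Gamma : 'I_3 -> set 'rV[R]_n) (qm qp : 'rV[R]_n)
    (psi : 'I_3 -> R * R -> 'rV[R]_n)
    (hGamma : triple_arc_graph Gamma qm qp)
    (hpsi : uniform_parametrization Gamma qm qp psi)
    (Phi : 'I_3 -> R * R -> R * R) (c : 'I_3 -> R)
    (alpha : 'I_3 -> R * R -> 'rV[R]_n)
    (hPhi : gluing_map Phi) (hc : weights c)
    (halpha : admissible psi Phi alpha)
    (hmin : weighted_energy c alpha = minimal_energy psi)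
    (mu : R) (hmu : 0 < mu < 1)
    (hreg : holder_gluing 2 mu Phi) (hns : nonsingular_gluing Phi)
    (p : set ('I_3 * (R * R)))
    (hp : (regular_set Phi alpha `&` free_curve Phi) p)
    (Sigma : 'I_3 -> set 'rV[R]_n) (gamma : set 'rV[R]_n)
    (eta : 'I_3 -> 'rV[R]_n -> 'rV[R]_n)
    (hSigma : balanced_sheets Sigma gamma eta)
    (hpgamma : quotient_image alpha [set p] `<=` gamma)
    (himage : exists V, quotient_nbhs Phi p V /\
       \bigcup_(i in [set: 'I_3]) Sigma i = quotient_image alpha V)
    (f : 'I_3 -> R * R -> 'rV[R]_n)
    (hconf : conformal_Y0 f) (hharm : harmonic_Y0 f)
    (hparam : parametrizes_sheets f Sigma gamma) :
  forall i : 'I_3,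
    let U := multi_sheeted_reflection f i in
    [/\ conformal_on disk U, harmonic_on disk U &
        exists M : set 'rV[R]_n, analytic_extension_by (Sigma i) U M].
Proof.
have [hc1 htr] := hconf.
have EX j : exists p : (R * R -> 'rV[R]_n) * (R * R -> 'rV[R]_n),
    C1_within closed_half_disk (f j) p.1 p.2 /\ forall z, closed_half_disk z ->
      enorm (p.1 z) = enorm (p.2 z) /\ dotv (p.1 z) (p.2 z) = 0.
  by have [fx [fy H]] := hc1 j; exists (fx, fy).
have [F FP] := choice EX.
have C1f j := (FP j).1; have conff j := (FP j).2.
have [_ _ _ Heta eta0] := hSigma.
have normal0 := sheets_normal_sum C1f conff htr hparam Heta eta0.
move=> i U.
have harmU k : harmonic_off_axis (Defs.coord U k).
  exact: (reflection_harmonic C1f hharm htr normal0).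
have seriesU : coords_series U by move=> k; exact: harmonic_off_axis_series.
split.
- exists (fun z => 'D_e1 U z), (fun z => 'D_e2 U z); split; first exact: coords_series_C1.
  exact: (reflection_conformal C1f conff harmU).
- exact: coords_series_harmonic.
- exact: (reflection_extension C1f conff hparam harmU).
Qed.
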